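(* Let $X\subset\mathbb{R}^2$ be the 2-dimensional Sierpinski gasket with vertices $p_1,p_2,p_3$ and let $Z$ be the Brownian motion on $X$ with laws $\{\mathbb{P}_x\}_{x\in X}$. Let $R$ be the restriction to $X$ of the Euclidean reflection $\hat R$ of $\mathbb{R}^2$ with $\hat R(p_1)=p_2$, let $H=X\cap\hat H$ where $\hat H$ is the fixed line of $\hat R$, and let $X_1,X_2$ be the two connected pieces of $X\setminus H$ containing $p_1,p_2$ respectively, so that (A1) and (A2) hold for $x_1=p_1$, $x_2=p_2$. Then $\hat{\mathscr{C}}(\mathbb{P}_{p_1},\mathbb{P}_{p_2})\supset\mathscr{C}_0(\mathbb{P}_{p_1},\mathbb{P}_{p_2})$.
   Context: Take $p_1,p_2,p_3\in\mathbb{R}^2$ with $|p_i-p_j|=1$ for $i\ne j$, $\Psi_i(x)=(x-p_i)/2+p_i$; the Sierpinski gasket is the unique nonempty compact $X$ with $X=\bigcup_{i=1}^3\Psi_i(X)$. The Brownian motion on $X$ is the diffusion obtained as the scaling limit of continuous time random walks on the approximating graphs $V_n$ (Barlow–Perkins, Lindstrøm), where $V_0=\{p_1,p_2,p_3\}$, $V_n=\bigcup_i\Psi_i(V_{n-1})$. (A1): $R:X\to X$ is continuous, $R\circ R=\mathrm{id}$ and $\mathbb{P}_{x_1}\circ R^{-1}=\mathbb{P}_{x_2}$ ($R$ acting on paths pointwise). (A2): $H=\{x:Rx=x\}$ satisfies $X\setminus H=X_1\sqcup X_2$ with $X_1,X_2$ disjoint open and $R(X_1)=X_2$. $\mathscr{C}(\mu_1,\mu_2)$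 is the set of couplings. Markovian couplings: with coordinate process $Z^*=(Z_1,Z_2)$, $\mathscr{F}^*_s=\sigma\{Z^*(u):u\le s\}$, shift $(\theta_sZ^* )(t)=Z^*(s+t)$, $\mathscr{C}_0(\mathbb{P}_{x_1},\mathbb{P}_{x_2})$ is the set of $\mathbb{P}\in\mathscr{C}(\mathbb{P}_{x_1},\mathbb{P}_{x_2})$ with $\mathbb{P}[\,\cdot\mid\mathscr{F}^*_s]\circ\theta_s^{-1}\in\mathscr{C}(\mathbb{P}_{Z_1(s)},\mathbb{P}_{Z_2(s)})$ for each $s>0$. $\hat{\mathscr{C}}(\mathbb{P}_{x_1},\mathbb{P}_{x_2})$: the set of $\mathbb{P}\in\mathscr{C}(\mathbb{P}_{x_1},\mathbb{P}_{x_2})$ such that for each $t>0$ there is a Borel $\Xi^{(t)}\subset X_1\times X_2$ with $\mathbb{P}(Z^*(t)\in(\Xi^{(t)})^c\cap(X_1\times X_2))=0$ such that every $(x,y)\in\Xi^{(t)}$ has the property: if there is a decreasing sequence $r_n>0$, $r_n\to0$, with $\mathbb{P}_x[Z(r_n)\in A]\ge\mathbb{P}_y[Z(r_n)\in A]$ for all Borel $A\subset X_1\cup H$ and $\mathbb{P}_x[Z(r_n)\in A']\le\mathbb{P}_y[Z(r_n)\in A']$ for all Borel $A'\subset X_2\cup H$ and all $n$, then $x=Ry$. *)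

(* Defs.v *)
From HB Require Import structures.
From mathcomp Require Import all_boot all_order all_algebra.
From mathcomp Require Import all_classical all_reals all_analysis.
Import Order.TTheory GRing.Theory Num.Theory numFieldNormedType.Exports.

Set Implicit Arguments.
Unset Strict Implicit.
Unset Printing Implicit Defensive.

Local Open Scope classical_set_scope.
Local Open Scope ring_scope.

Section SG.
Variable R : realType.

Definition pt := (R * R)%type.

Definition dist (x y : pt) : R :=
  Num.sqrt ((x.1 - y.1) ^+ 2 + (x.2 - y.2) ^+ 2).

Definition Psi (p x : pt) : pt :=
  ((x.1 - p.1) / 2 + p.1, (x.2 - p.2) / 2 + p.2).

(* the Euclidean reflection hat R of R^2 with hat R(p1) = p2, i.e. the
   reflection in the perpendicular bisector of [p1,p2]
   (|p2 - p1| = 1, so u := p2 - p1 is a unit vector) *)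
Definition refl (p1 p2 : pt) (z : pt) : pt :=
  let m := ((p1.1 + p2.1) / 2, (p1.2 + p2.2) / 2) in
  let u := (p2.1 - p1.1, p2.2 - p1.2) in
  let c := (z.1 - m.1) * u.1 + (z.2 - m.2) * u.2 in
  (z.1 - 2 * c * u.1, z.2 - 2 * c * u.2).

Definition fixline (p1 p2 : pt) : set pt := [set z | refl p1 p2 z = z].

Definition Hset (p1 p2 : pt) (X : set pt) : set pt := X `&` fixline p1 p2.
Definition X1set (p1 p2 : pt) (X : set pt) : set pt :=
  connected_component (X `\` Hset p1 p2 X) p1.
Definition X2set (p1 p2 : pt) (X : set pt) : set pt :=
  connected_component (X `\` Hset p1 p2 X) p2.

Fixpoint Vn (p1 p2 p3 : pt) (n : nat) : seq pt :=
  match n with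
  | 0 => [:: p1; p2; p3]
  | n'.+1 => undup (flatten [seq [seq Psi p x | x <- Vn p1 p2 p3 n']
                                  | p <- [:: p1; p2; p3]])
  end.

Fixpoint En (p1 p2 p3 : pt) (n : nat) : seq (pt * pt) :=
  match n with
  | 0 => [:: (p1, p2); (p2, p3); (p1, p3)]
  | n'.+1 => flatten [seq [seq (Psi p e.1, Psi p e.2) | e <- En p1 p2 p3 n']
                         | p <- [:: p1; p2; p3]]
  end.

Definition nbr (p1 p2 p3 : pt) (n : nat) (x y : pt) : bool :=
  ((x, y) \in En p1 p2 p3 n) || ((y, x) \in En p1 p2 p3 n).

Definition deg (p1 p2 p3 : pt) (n : nat) (x : pt) : nat :=
  count (nbr p1 p2 p3 n x) (Vn p1 p2 p3 n).

Definition trans (p1 p2 p3 : pt) (n : nat) (x y : pt) : R :=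
  (nbr p1 p2 p3 n x y)%:R / (deg p1 p2 p3 n x)%:R.

Fixpoint transk (p1 p2 p3 : pt) (n k : nat) (x y : pt) : R :=
  match k with
  | 0 => (x == y)%:R
  | k'.+1 => \sum_(z <- Vn p1 p2 p3 n) trans p1 p2 p3 n x z * transk p1 p2 p3 n k' z y
  end.

(* transition probabilities of the continuous time random walk on V_n
   (exp(1) holding times, uniform jumps to neighbours), run at speed 5^n:
   p^n_t(x,y) = sum_k e^{-5^n t} (5^n t)^k / k! * P^k(x,y) *)
Definition rwp (p1 p2 p3 : pt) (n : nat) (t : R) (x y : pt) : R :=
  limn (series (fun k : nat =>
     expR (- ((5 ^ n)%:R * t)) * ((5 ^ n)%:R * t) ^+ k / (k`!)%:R
       * transk p1 p2 p3 n k x y)).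

(* E^{RW_n}_x [ f_1(Y(t_1)) * ... * f_k(Y(t_k)) ] where the list l gives the
   time increments t_1, t_2 - t_1, ... together with the test functions *)
Fixpoint rwE (p1 p2 p3 : pt) (n : nat) (x : pt) (l : seq (R * (pt -> R))) : R :=
  match l with
  | [::] => 1
  | (dt, f) :: l' =>
      \sum_(y <- Vn p1 p2 p3 n) rwp p1 p2 p3 n dt x y * f y * rwE p1 p2 p3 n y l'
  end.

(* Path space C([0,oo), R^2) with the sigma-algebra generated by the   *)
(* coordinate maps.  A path is a continuous map R -> R^2 which is       *)
(* constant on (-oo,0] (so it is determined by its restriction to       *)
(* [0,oo)).                                                             *)
Record path := Path {
  pf :> R -> pt ;
  pcont : continuous pf ;
  pconst : forall t, t <= 0 -> pf t = pf 0 }.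

HB.instance Definition _ := gen_eqMixin path.
HB.instance Definition _ := gen_choiceMixin path.

Lemma cst_path_cont : continuous (fun _ : R => ((0 : R), (0 : R)) : pt).
Proof. exact: cst_continuous. Qed.

HB.instance Definition _ :=
  isPointed.Build path (@Path (fun _ => (0, 0)) cst_path_cont (fun _ _ => erefl)).

Definition Gpath : set (set path) :=
  [set (fun w : path => w t) @^-1` B | t in [set: R] &
                                       B in (measurable : set (set pt))].

Definition PathM := g_sigma_algebraType Gpath.

Lemma shift_time_cont (s : R) : continuous (fun t : R => s + Num.max t 0).
Proof.
move=> t; apply: cvgD; first exact: cvg_cst.
have := @continuous_max R R (fun x => x) (fun _ => 0) t.
by apply; [exact: cvg_id | exact: cvg_cst].
Qed.

Arguments shift_time_cont : clear implicits.

Lemma shift_cont (s : R) (w : path) : continuous (fun t : R => w (s + Num.max t 0)).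
Proof.
move=> t.
have h1 := @shift_time_cont s t.
have h2 := @pcont w (s + Num.max t 0).
exact: (continuous_comp h1 h2).
Qed.

Lemma shift_const (s : R) (w : path) (t : R) :
  t <= 0 -> w (s + Num.max t 0) = w (s + Num.max 0 0).
Proof. by move=> t0; rewrite maxxx; congr (w (s + _)); apply/max_idPr. Qed.

Definition shift (s : R) (w : path) : PathM :=
  @Path (fun t : R => w (s + Num.max t 0)) (@shift_cont s w) (@shift_const s w).

(* The Brownian motion on the Sierpinski gasket: {P x} is the family   *)
(* of laws on path space obtained as the scaling limit of the          *)
(* continuous time random walks on V_n, i.e. for x in X, for every      *)
(* x_n in V_n with x_n -> x, the finite dimensional distributions of    *)
(* the walks started at x_n converge (weakly) to those of P x:          *)
(*   E^{RW_n}_{x_n}[prod_i f_i(Y(t_i))] -> E_{P x}[prod_i f_i(Z(t_i))]   *)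
(* for all times 0 <= t_1 <= ... <= t_k and bounded continuous f_i.     *)
Fixpoint prodF (w : path) (t : R) (l : seq (R * (pt -> R))) : R :=
  match l with
  | [::] => 1
  | (dt, f) :: l' => f (w (t + dt)) * prodF w (t + dt) l'
  end.

Definition bounded_cont (f : pt -> R) : Prop :=
  continuous f /\ exists M : R, forall z, `|f z| <= M.

Definition IsBMonSG (p1 p2 p3 : pt) (X : set pt)
    (P : pt -> probability PathM R) : Prop :=
  forall x : pt, X x ->
  forall xs : nat -> pt, (forall n, xs n \in Vn p1 p2 p3 n) -> xs @ \oo --> x ->
  forall l : seq (R * (pt -> R)),
    (forall e, e \in l -> 0 <= e.1 /\ bounded_cont e.2) ->
    (fun n => (rwE p1 p2 p3 n (xs n) l)%:E) @ \oo -->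
      (\int[P x]_w (prodF w 0 l)%:E)%E.

Definition coupling (Q : probability (PathM * PathM)%type R)
    (mu1 mu2 : probability PathM R) : Prop :=
  (forall B : set PathM, measurable B -> Q (fst @^-1` B) = mu1 B) /\
  (forall B : set PathM, measurable B -> Q (snd @^-1` B) = mu2 B).

Definition Fstar (s : R) : set (set (PathM * PathM)%type) :=
  <<s [set (fun w : (PathM * PathM)%type => ((w.1 : path) u, (w.2 : path) u)) @^-1` B
       | u in [set u : R | 0 <= u <= s] &
         B in (measurable : set (set (pt * pt)%type))] >>.

(* Markovian couplings C_0(P_{x1}, P_{x2}).  The requirement that the
   regular conditional law Q[ . | F^*_s] o theta_s^{-1} be a coupling of
   P_{Z_1(s)} and P_{Z_2(s)} is the statement that its two marginals are
   P_{Z_1(s)} and P_{Z_2(s)} Q-a.s., i.e. by definition of conditional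
   probability: for every A in F^*_s and every measurable B,
     Q(A, theta_s Z_i in B) = E_Q[ 1_A P_{Z_i(s)}(B) ]. *)
Definition markov_coupling (P : pt -> probability PathM R) (x1 x2 : pt)
    (Q : probability (PathM * PathM)%type R) : Prop :=
  coupling Q (P x1) (P x2) /\
  forall s : R, 0 < s ->
  forall A : set (PathM * PathM)%type, Fstar s A ->
  forall B : set PathM, measurable B ->
    Q (A `&` [set w | B (shift s w.1)]) = (\int[Q]_(w in A) P ((w.1 : path) s) B)%E /\
    Q (A `&` [set w | B (shift s w.2)]) = (\int[Q]_(w in A) P ((w.2 : path) s) B)%E.

Definition Chat (P : pt -> probability PathM R) (x1 x2 : pt)
    (X1 X2 H : set pt) (Rf : pt -> pt)
    (Q : probability (PathM * PathM)%type R) : Prop :=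
  coupling Q (P x1) (P x2) /\
  forall t : R, 0 < t ->
  exists Xi : set (pt * pt)%type,
    Xi `<=` X1 `*` X2 /\ measurable Xi /\
    Q [set w | (~` Xi `&` (X1 `*` X2)) ((w.1 : path) t, (w.2 : path) t)] = 0%E /\
    forall x y, Xi (x, y) ->
      (exists r : nat -> R,
         (forall n, 0 < r n) /\ (forall n, r n.+1 < r n) /\ r @ \oo --> 0 /\
         forall n,
           (forall A : set pt, measurable A -> A `<=` X1 `|` H ->
              P y [set w : PathM | A ((w : path) (r n))] <=
              P x [set w : PathM | A ((w : path) (r n))])%E /\
           (forall A' : set pt, measurable A' -> A' `<=` X2 `|` H ->
              P x [set w : PathM | A' ((w : path) (r n))] <=
              P y [set w : PathM | A' ((w : path) (r n))])%E) ->
      x = Rf y.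

End SG.

(* Main.v *)
Require Import Defs.
From HB Require Import structures.
From mathcomp Require Import all_boot all_order all_algebra.
From mathcomp Require Import all_classical all_reals all_analysis.
From mathcomp Require Import measurable_realfun ring lra.
Import Order.TTheory GRing.Theory Num.Theory numFieldNormedType.Exports.

Set Implicit Arguments.
Unset Strict Implicit.
Unset Printing Implicit Defensive.

Local Open Scope classical_set_scope.
Local Open Scope ring_scope.

(* Take Xi = X1 x X2.  If x <> R y, then x and y have different distances to some
   point h of the axis H, say a in {x, y} is closer to h than b.  For a level m
   large enough the walk started at b needs at least one more crossing of level m
   than the walk started at a in order to come near h.  Crossing times of level m
   are i.i.d., and the probability that one of them is at most r is O(5^m r).
   Hence, for all small r and for a cell C at h, P_b(Z_r in C) < P_a(Z_r in C),
   and C may be chosen on either side of H.  The estimates hold for the walks on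
   V_n uniformly in n, and pass to the limit. *)

(** * Barycentric coordinates and the graphs V_n *)

(** The law of a crossing time at small times is never computed. Both estimates are expressed by the
    same unknown, the probability of a certain number of crossings: the walk from a has at least a
    constant times it, the walk from b at most P(S <= k) times it, S being one more crossing time,
    so that the unknown cancels in the quotient. Distances are barycentric. One coordinate changes
    by at most 2^-m along an edge of level m, which bounds the crossings needed from b below;
    explicit paths bound those needed from a above. The two bounds have to match, and this dictates
    h: if x and y differ in the [p3] coordinate, h is an axis point near [p3] and is reached through
    [p3]; otherwise h is the axis corner of the cell Psi_p3^k Psi_c that contains a and is reached
    inside this cell. The number of steps is Poisson, hence unbounded; steps beyond 4 times the mean
    are an error vanishing as n grows. Limits keep only weak inequalities, so strictness also needs
    a positive lower bound for the walk from a that is uniform in n; it comes from a finer level,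
    chosen according to r. *)

Record equilateral (R : realType) := Equilateral {
  pp1 : pt R ; pp2 : pt R ; pp3 : pt R ;
  dist12 : dist pp1 pp2 = 1 ;
  dist23 : dist pp2 pp3 = 1 ;
  dist13 : dist pp1 pp3 = 1 }.

Section Barycentric.
Variables (R : realType) (T : equilateral R).
Local Notation p1 := (pp1 T).
Local Notation p2 := (pp2 T).
Local Notation p3 := (pp3 T).

Definition V0 : seq (pt R) := [:: p1; p2; p3].
Definition V (n : nat) : seq (pt R) := Vn p1 p2 p3 n.
Definition edge (n : nat) : rel (pt R) := nbr p1 p2 p3 n.

Definition centroid : pt R :=
  ((p1.1 + p2.1 + p3.1) / 3, (p1.2 + p2.2 + p3.2) / 3).

(* For a vertex [p] of a unit equilateral triangle with centroid [g] this is the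
   affine function equal to 1 at [p] and to 0 at the other two vertices. *)
Definition bc (p z : pt R) : R :=
  1 / 3 + 2 * ((z.1 - centroid.1) * (p.1 - centroid.1)
             + (z.2 - centroid.2) * (p.2 - centroid.2)).

Definition tri (z : pt R) : Prop := forall q, q \in V0 -> 0 <= bc q z.

Lemma dist_eq1 (x y : pt R) : dist x y = 1 ->
  (x.1 - y.1) ^+ 2 + (x.2 - y.2) ^+ 2 = 1.
Proof.
rewrite /dist => h; set s := (X in X = 1).
have s0 : 0 <= s by rewrite addr_ge0 // sqr_ge0.
by rewrite -(sqr_sqrtr s0) /s h expr1n.
Qed.

Lemma V0P (p : pt R) : p \in V0 -> [\/ p = p1, p = p2 | p = p3].
Proof.
rewrite !inE => /or3P[/eqP->|/eqP->|/eqP->];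
  by [constructor 1|constructor 2|constructor 3].
Qed.

Lemma p1V0 : p1 \in V0. Proof. by rewrite !inE eqxx. Qed.
Lemma p2V0 : p2 \in V0. Proof. by rewrite !inE eqxx !orbT. Qed.
Lemma p3V0 : p3 \in V0. Proof. by rewrite !inE eqxx !orbT. Qed.

Lemma bc_corner_self (p : pt R) : p \in V0 -> bc p p = 1.
Proof.
have := dist_eq1 (dist12 T); have := dist_eq1 (dist13 T).
have := dist_eq1 (dist23 T).
by move=> h1 h2 h3 /V0P[] ->; rewrite /bc /centroid /=; lra.
Qed.

Lemma neq12 : p1 != p2.
Proof.
by apply/eqP => e; have := dist_eq1 (dist12 T); rewrite e; lra.
Qed.
Lemma neq13 : p1 != p3.
Proof.
by apply/eqP => e; have := dist_eq1 (dist13 T); rewrite e; lra.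
Qed.
Lemma neq23 : p2 != p3.
Proof.
by apply/eqP => e; have := dist_eq1 (dist23 T); rewrite e; lra.
Qed.

Lemma uniq_V0 : uniq V0.
Proof. by rewrite /V0 /= !inE negb_or neq12 neq13 neq23. Qed.

Lemma bc_corner (p q : pt R) : p \in V0 -> q \in V0 -> bc p q = (p == q)%:R.
Proof.
have [<-|pq] := eqVneq p q; first by move=> h _; rewrite bc_corner_self.
have := dist_eq1 (dist12 T); have := dist_eq1 (dist13 T).
have := dist_eq1 (dist23 T).
move=> h1 h2 h3 /V0P[] e /V0P[] e'; move: pq; rewrite e e' ?eqxx // => _;
  by rewrite /bc /centroid /=; lra.
Qed.

Lemma bc_sum (z : pt R) : bc p1 z + bc p2 z + bc p3 z = 1.
Proof. by rewrite /bc /centroid /=; field. Qed.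

Lemma bc_Psi (q p z : pt R) : bc q (Psi p z) = (bc q z + bc q p) / 2.
Proof. by rewrite /bc /Psi /=; field. Qed.

(** Two sides of the triangle are linearly independent: by Lagrange's identity the square of their
    determinant is 1 - (1/2)^2 = 3/4. Cramer's rule then recovers the point. *)
Lemma bc_inj (x y : pt R) : (forall q, q \in V0 -> bc q x = bc q y) -> x = y.
Proof.
move=> h.
have := h _ p1V0; have := h _ p2V0; have := h _ p3V0.
have := dist_eq1 (dist12 T); have := dist_eq1 (dist13 T).
have := dist_eq1 (dist23 T).
clear h; rewrite /bc /centroid /=.
case: x => x1 x2; case: y => y1 y2 /=.
set a := p1.1 - p2.1; set b := p1.2 - p2.2.
set c := p1.1 - p3.1; set d := p1.2 - p3.2.
have -> : p2.1 - p3.1 = c - a by rewrite /a /c; ring.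
have -> : p2.2 - p3.2 = d - b by rewrite /b /d; ring.
move=> h23 h13 h12 h3 h2 h1.
have ea : (x1 - y1) * a + (x2 - y2) * b = 0 by rewrite /a /b; lra.
have ec : (x1 - y1) * c + (x2 - y2) * d = 0 by rewrite /c /d; lra.
have hac : a * c + b * d = 2^-1 by lra.
have D2 : (a * d - b * c) ^+ 2 = 3 / 4.
  transitivity ((a ^+ 2 + b ^+ 2) * (c ^+ 2 + d ^+ 2) - (a * c + b * d) ^+ 2).
    by ring.
  by rewrite h12 h13 hac; field.
have D0 : a * d - b * c != 0.
  by apply/eqP => e; move: D2; rewrite e; lra.
have k1 : (x1 - y1) * (a * d - b * c) = 0.
  transitivity (((x1 - y1) * a + (x2 - y2) * b) * d
     - ((x1 - y1) * c + (x2 - y2) * d) * b); first by ring.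
  by rewrite ea ec; ring.
have k2 : (x2 - y2) * (a * d - b * c) = 0.
  transitivity (((x1 - y1) * c + (x2 - y2) * d) * a
     - ((x1 - y1) * a + (x2 - y2) * b) * c); first by ring.
  by rewrite ea ec; ring.
move/eqP: k1; rewrite mulf_eq0 (negbTE D0) orbF subr_eq0 => /eqP ->.
by move/eqP: k2; rewrite mulf_eq0 (negbTE D0) orbF subr_eq0 => /eqP ->.
Qed.

Lemma Psi_inj (p : pt R) : injective (Psi p).
Proof.
move=> [x1 x2] [y1 y2]; rewrite /Psi /= => -[h1 h2]; congr pair; lra.
Qed.

Lemma Psi_fix (p : pt R) : Psi p p = p.
Proof. by rewrite /Psi; case: p => a b /=; congr pair; field. Qed.

Lemma Psi_mid (p q : pt R) : Psi p q = Psi q p.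
Proof. by rewrite /Psi /=; congr pair; field. Qed.

Lemma tri_corner (p : pt R) : p \in V0 -> tri p.
Proof. by move=> hp q hq; rewrite bc_corner. Qed.

Lemma tri_Psi (p z : pt R) : p \in V0 -> tri z -> tri (Psi p z).
Proof.
move=> hp hz q hq; rewrite bc_Psi; have := hz q hq; have := tri_corner hp hq.
lra.
Qed.

Lemma bc_le1 (p z : pt R) : p \in V0 -> tri z -> bc p z <= 1.
Proof.
move=> hp hz; have := bc_sum z; have := hz _ p1V0; have := hz _ p2V0.
by have := hz _ p3V0; case/V0P: hp => ->; lra.
Qed.

Lemma bc1_corner (p z : pt R) : p \in V0 -> tri z -> 1 <= bc p z -> z = p.
Proof.
move=> hp hz h1; apply: bc_inj => q hq; rewrite [bc q p]bc_corner //.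
have := bc_sum z; have := hz _ p1V0; have := hz _ p2V0; have := hz _ p3V0.
have [->|] := eqVneq q p; first by have := bc_le1 hp hz; rewrite /=; lra.
by case/V0P: hp h1 => ->; case/V0P: hq => ->; rewrite ?eqxx //=; lra.
Qed.

(** The coordinate [bc q] is at most 1/2 on the cell of [p] and at least 1/2 on the cell of [q];
    equality on the first forces [x = q], and symmetrically [y = p]. *)
Lemma Psi_meet (p q x y : pt R) : p \in V0 -> q \in V0 -> p != q ->
  tri x -> tri y -> Psi p x = Psi q y -> x = q /\ y = p.
Proof.
move=> hp hq pq hx hy e; split; apply: bc1_corner => //.
  have := congr1 (bc q) e; rewrite !bc_Psi bc_corner_self // [bc q p]bc_corner //.
  by rewrite eq_sym (negbTE pq) /=; have := hy _ hq; lra.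
have := congr1 (bc p) e; rewrite !bc_Psi bc_corner_self // [bc p q]bc_corner //.
by rewrite (negbTE pq) /=; have := hx _ hp; lra.
Qed.

Lemma mem_VS (n : nat) (z : pt R) :
  z \in V n.+1 <-> exists2 p, p \in V0 & exists2 x, x \in V n & z = Psi p x.
Proof.
have -> : V n.+1 = undup (flatten [seq [seq Psi p x | x <- V n] | p <- V0]) by [].
rewrite mem_undup; split.
  case/flattenP => s /mapP[p hp ->] /mapP[x hx ->]; by exists p => //; exists x.
case=> p hp [x hx ->]; apply/flattenP; exists [seq Psi p x | x <- V n].
  by apply/mapP; exists p.
by apply/mapP; exists x.
Qed.

Lemma V_tri (n : nat) (z : pt R) : z \in V n -> tri z.
Proof.
elim: n z => [|n IH] z; first exact: tri_corner.
by case/mem_VS => p hp [x hx ->]; apply: tri_Psi => //; exact: IH.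
Qed.

Lemma uniq_V (n : nat) : uniq (V n).
Proof. by case: n => [|n]; [exact: uniq_V0|exact: undup_uniq]. Qed.

Lemma V0_sub (n : nat) (z : pt R) : z \in V0 -> z \in V n.
Proof.
elim: n => // n IH hz; apply/mem_VS; exists z => //; exists z; first exact: IH.
by rewrite Psi_fix.
Qed.

Lemma Psi_V (n : nat) (p z : pt R) : p \in V0 -> z \in V n -> Psi p z \in V n.+1.
Proof. by move=> hp hz; apply/mem_VS; exists p => //; exists z. Qed.

Lemma edge0 (x y : pt R) : edge 0 x y = [&& x \in V0, y \in V0 & x != y].
Proof.
rewrite /edge /nbr /= !inE !xpair_eqE.
have n12 := neq12; have n13 := neq13; have n23 := neq23.
apply/idP/idP.
  case/orP => /or3P[]/andP[/eqP-> /eqP->]; rewrite !eqxx ?orbT /=;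
  by rewrite ?n12 ?n13 ?n23 // eq_sym ?n12 ?n13 ?n23.
case/and3P => /or3P[]/eqP-> /or3P[]/eqP->; rewrite ?eqxx ?orbT //=.
Qed.

Lemma edgeS (n : nat) (x y : pt R) :
  edge n.+1 x y <-> exists2 p, p \in V0 &
    exists x', exists2 y', edge n x' y' & x = Psi p x' /\ y = Psi p y'.
Proof.
rewrite /edge /nbr.
have -> : En p1 p2 p3 n.+1 = flatten
  [seq [seq (Psi p e.1, Psi p e.2) | e <- En p1 p2 p3 n] | p <- V0] by [].
split.
  case/orP => /flattenP[s /mapP[p hp ->]] /mapP[[a b] hab /= [-> ->]];
    exists p => //.
    by exists a, b; rewrite // hab.
  by exists b, a; rewrite // hab orbT.
case=> p hp [x' [y' /orP[] h [-> ->]]]; apply/orP; [left|right];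
apply/flattenP.
  exists [seq (Psi p e.1, Psi p e.2) | e <- En p1 p2 p3 n].
    by apply/mapP; exists p.
  by apply/mapP; exists (x', y').
exists [seq (Psi p e.1, Psi p e.2) | e <- En p1 p2 p3 n].
  by apply/mapP; exists p.
by apply/mapP; exists (y', x').
Qed.

Lemma edge_sym (n : nat) (x y : pt R) : edge n x y = edge n y x.
Proof. by rewrite /edge /nbr orbC. Qed.

Lemma edge_mem (n : nat) (x y : pt R) : edge n x y -> x \in V n /\ y \in V n.
Proof.
elim: n x y => [|n IH] x y; first by rewrite edge0 => /and3P[].
case/edgeS => p hp [x' [y' h [-> ->]]].
by case: (IH _ _ h) => *; split; apply: Psi_V.
Qed.

Definition nb (n : nat) (x : pt R) : seq (pt R) := [seq z <- V n | edge n x z].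

Lemma mem_nb (n : nat) (x z : pt R) : z \in nb n x = edge n x z.
Proof.
rewrite mem_filter; apply/andP/idP => [[]//|h]; split=> //.
by case: (edge_mem h).
Qed.

Lemma uniq_nb (n : nat) (x : pt R) : uniq (nb n x).
Proof. by rewrite filter_uniq // uniq_V. Qed.

(** Only the gluing points [Psi j i], with [i] a corner other than [j], have neighbours in another
    cell; the side condition excludes exactly them. *)
Lemma nbS (n : nat) (j x : pt R) : j \in V0 -> x \in V n ->
  x \notin V0 \/ x = j ->
  perm_eq (nb n.+1 (Psi j x)) (map (Psi j) (nb n x)).
Proof.
move=> hj hx hxj; apply: uniq_perm; first exact: uniq_nb.
  by rewrite map_inj_uniq ?uniq_nb //; exact: Psi_inj.
move=> z; rewrite mem_nb; apply/idP/idP.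
  case/edgeS => p hp [x' [y' h [e ->]]]; have [hx' hy'] := edge_mem h.
  have [pj|pj] := eqVneq p j.
    by subst p; rewrite mem_map ?mem_nb; [rewrite (Psi_inj e)|exact: Psi_inj].
  rewrite eq_sym in pj.
  have [xp x'j] := Psi_meet hj hp pj (V_tri hx) (V_tri hx') e.
  case: hxj => [|xj]; first by rewrite xp hp.
  by move: pj; rewrite -xj xp eqxx.
case/mapP => y; rewrite mem_nb => h ->; apply/edgeS; exists j => //.
by exists x, y.
Qed.

Lemma nbS_mid (n : nat) (j i : pt R) : j \in V0 -> i \in V0 -> i != j ->
  perm_eq (nb n.+1 (Psi j i)) (map (Psi j) (nb n i) ++ map (Psi i) (nb n j)).
Proof.
move=> hj hi ij.
(* The graph has no loops. By [Psi_meet] a point common to the two lists would be the image of [j]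
   listed as a neighbour of [j]. *)
have irr : forall m (x : pt R), edge m x x = false.
  elim=> [|m IH] x; first by rewrite edge0 eqxx !andbF.
  apply/negP => /edgeS[p hp [x' [y' h [-> /Psi_inj e]]]].
  by move: h; rewrite e IH.
apply: uniq_perm; first exact: uniq_nb.
  rewrite cat_uniq !map_inj_uniq ?uniq_nb ?andbT /=; try exact: Psi_inj.
  apply/hasPn => z /mapP[y]; rewrite mem_nb => hy ->; apply/negP.
  case/mapP => y'; rewrite mem_nb => hy' e.
  have [_ hyV] := edge_mem hy; have [_ hyV'] := edge_mem hy'.
  have [yj _] := Psi_meet hi hj ij (V_tri hyV) (V_tri hyV') e.
  by move: hy; rewrite yj irr.
move=> z; rewrite mem_cat mem_nb; apply/idP/idP.
  case/edgeS => p hp [x' [y' h [e ->]]]; have [hx' hy'] := edge_mem h.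
  have [pj|pj] := eqVneq p j.
    subst p; apply/orP; left.
    by rewrite mem_map ?mem_nb; [rewrite (Psi_inj e)|exact: Psi_inj].
  rewrite eq_sym in pj.
  have [xp x'j] := Psi_meet hj hp pj (tri_corner hi) (V_tri hx') e.
  by subst p x'; apply/orP; right; rewrite mem_map ?mem_nb //; exact: Psi_inj.
case/orP => /mapP[y]; rewrite mem_nb => h ->; apply/edgeS.
  by exists j => //; exists i, y.
by exists i => //; exists j, y => //; rewrite Psi_mid.
Qed.

Lemma size_nb_corner (n : nat) (p : pt R) : p \in V0 -> size (nb n p) = 2%N.
Proof.
elim: n p => [|n IH] p hp; last first.
  rewrite -{1}(Psi_fix p) (perm_size (nbS hp (V0_sub n hp) _)); last by right.
  by rewrite size_map IH.
have n12 := neq12; have n13 := neq13; have n23 := neq23.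
have n21 : p2 != p1 by rewrite eq_sym.
have n31 : p3 != p1 by rewrite eq_sym.
have n32 : p3 != p2 by rewrite eq_sym.
rewrite /nb /V /= !edge0 hp p1V0 p2V0 p3V0 /=.
by case/V0P: hp => ->; rewrite !eqxx ?n12 ?n13 ?n23 ?n21 ?n31 ?n32.
Qed.

Lemma size_nb (n : nat) (x : pt R) : x \in V n -> (0 < size (nb n x))%N.
Proof.
elim: n x => [|n IH] x; first by move=> h; rewrite size_nb_corner.
case/mem_VS => j hj [y hy ->]; have [h|h] := boolP (y \in V0); last first.
  by rewrite (perm_size (nbS hj hy _)) ?size_map ?IH //; left.
have [->|e] := eqVneq y j.
  by rewrite Psi_fix size_nb_corner.
by rewrite (perm_size (nbS_mid n hj h e)) size_cat !size_map addn_gt0 IH.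
Qed.

End Barycentric.

(** * Averaging operators, reflections and cells *)

Section Averages.
Variables (R : realType) (T : equilateral R).
Local Notation p1 := (pp1 T).
Local Notation p2 := (pp2 T).
Local Notation p3 := (pp3 T).
Local Notation V0 := (V0 T).
Local Notation V := (V T).
Local Notation edge := (edge T).
Local Notation nb := (nb T).
Local Notation bc := (bc T).
Local Notation tri := (tri T).

Definition avg (n : nat) (f : pt R -> R) (x : pt R) : R :=
  (\sum_(z <- nb n x) f z) / (size (nb n x))%:R.

Lemma avg_le n (f g : pt R -> R) x : (forall z, z \in V n -> f z <= g z) ->
  avg n f x <= avg n g x.
Proof.
move=> h; rewrite /avg ler_wpM2r ?invr_ge0 ?ler0n //.
rewrite big_seq [leRHS]big_seq; apply: ler_sum => z.
by rewrite mem_nb => /edge_mem[_ hz]; exact: h.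
Qed.

Lemma eq_avg n (f g : pt R -> R) x : (forall z, z \in V n -> f z = g z) ->
  avg n f x = avg n g x.
Proof. by move=> h; apply/le_anti; rewrite !avg_le // => z /h ->. Qed.

Lemma avgD n (f g : pt R -> R) x :
  avg n (fun z => f z + g z) x = avg n f x + avg n g x.
Proof. by rewrite /avg big_split mulrDl. Qed.

Lemma avgZ n (c : R) (f : pt R -> R) x :
  avg n (fun z => c * f z) x = c * avg n f x.
Proof. by rewrite /avg -mulr_sumr mulrA. Qed.

Lemma avg_cst n (c : R) x : x \in V n -> avg n (fun=> c) x = c.
Proof.
move=> hx; rewrite /avg big_const_seq count_predT iter_addr addr0 -[c *+ _]mulr_natr.
by rewrite mulfK // pnatr_eq0 -lt0n size_nb.
Qed.

Lemma avg_Psi n (f : pt R -> R) (j x : pt R) : j \in V0 -> x \in V n ->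
  x \notin V0 \/ x = j -> avg n.+1 f (Psi j x) = avg n (f \o Psi j) x.
Proof.
move=> hj hx h; have hp := nbS hj hx h.
by rewrite /avg (perm_size hp) size_map (perm_big _ hp) big_map.
Qed.

(** The weights are equal because a corner has degree two at every level, so each of the two cells
    contributes two neighbours. *)
Lemma avg_mid n (f : pt R -> R) (j i : pt R) : j \in V0 -> i \in V0 -> i != j ->
  avg n.+1 f (Psi j i) = (avg n (f \o Psi j) i + avg n (f \o Psi i) j) / 2.
Proof.
move=> hj hi h; have hp := nbS_mid n hj hi h.
rewrite /avg (perm_size hp) size_cat !size_map (perm_big _ hp) big_cat !big_map.
by rewrite !size_nb_corner //=; field.
Qed.

(** * Reflections as automorphisms of the graphs *)

Lemma refl_Psi (p q s z : pt R) :
  refl p q (Psi s z) = Psi (refl p q s) (refl p q z).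
Proof. by rewrite /refl /Psi /=; congr pair; field. Qed.

Lemma refl_id (p z : pt R) : refl p p z = z.
Proof. by case: z => a b; rewrite /refl /=; congr pair; ring. Qed.

Lemma bc_refl (p q z : pt R) : p \in V0 -> q \in V0 -> p != q ->
  bc p (refl p q z) = bc q z.
Proof.
move=> hp hq pq.
have := bc_corner_self hp; have := bc_corner_self hq.
have := bc_corner hp hq; rewrite (negbTE pq) /bc; move: (centroid T) => g; rewrite /refl /=.
move=> hpq hqq hpp.
(* Two geometric facts about the centroid g suffice: (q - p).(p - g) = -1/2, and the midpoint of p
   and q is seen from g in a direction orthogonal to q - p. *)
have h1 : (q.1 - p.1) * (p.1 - g.1) + (q.2 - p.2) * (p.2 - g.2) = - 1 / 2 by lra.
have h2 : ((p.1 + q.1) / 2 - g.1) * (q.1 - p.1) +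
  ((p.2 + q.2) / 2 - g.2) * (q.2 - p.2) = 0 by lra.
set c := (z.1 - _) * _ + _.
transitivity (1 / 3 + 2 * ((z.1 - g.1) * (p.1 - g.1) + (z.2 - g.2) * (p.2 - g.2))
  - 4 * c * ((q.1 - p.1) * (p.1 - g.1) + (q.2 - p.2) * (p.2 - g.2))).
  by field.
rewrite h1.
have -> : c = (z.1 - g.1) * (q.1 - p.1) + (z.2 - g.2) * (q.2 - p.2).
  by apply/eqP; rewrite -subr_eq0; apply/eqP; rewrite -[RHS]oppr0 -h2 /c; field.
by field.
Qed.

Lemma refl_sym (p q z : pt R) : refl p q z = refl q p z.
Proof. by rewrite /refl /=; congr pair; field. Qed.

Lemma bc_refl_third (p q r z : pt R) : p \in V0 -> q \in V0 -> r \in V0 ->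
  p != q -> r != p -> r != q -> bc r (refl p q z) = bc r z.
Proof.
move=> hp hq hr pq rp rq.
have s (y : pt R) : bc p y + bc q y + bc r y = 1.
  rewrite -(bc_sum T y); move: pq rp rq.
  by case/V0P: hp => ->; case/V0P: hq => ->; case/V0P: hr => ->;
    rewrite ?eqxx // => _ _ _; ring.
have := s z; have := s (refl p q z).
by rewrite bc_refl // refl_sym bc_refl 1?eq_sym //; lra.
Qed.

Lemma refl_corner (p q s : pt R) : p \in V0 -> q \in V0 -> p != q -> s \in V0 ->
  refl p q s = if s == p then q else if s == q then p else s.
Proof.
move=> hp hq pq hs.
have qp : q != p by rewrite eq_sym.
case: ifPn => [/eqP->|sp].
  apply: (@bc_inj _ T) => r hr; have [->|rp] := eqVneq r p.
    by rewrite bc_refl // !bc_corner // (negbTE pq) (negbTE qp).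
  have [->|rq] := eqVneq r q; first by rewrite refl_sym bc_refl // !bc_corner_self.
  by rewrite bc_refl_third // !bc_corner // (negbTE rp) (negbTE rq).
case: ifPn => [/eqP->|sq].
  apply: (@bc_inj _ T) => r hr; have [->|rp] := eqVneq r p.
    by rewrite bc_refl // !bc_corner_self.
  have [->|rq] := eqVneq r q.
    by rewrite refl_sym bc_refl // !bc_corner // (negbTE pq) (negbTE qp).
  by rewrite bc_refl_third // !bc_corner // (negbTE rp) (negbTE rq).
apply: (@bc_inj _ T) => r hr; have [->|rp] := eqVneq r p.
  by rewrite bc_refl // !bc_corner // !(eq_sym _ s) (negbTE sp) (negbTE sq).
have [->|rq] := eqVneq r q.
  by rewrite refl_sym bc_refl // !bc_corner // !(eq_sym _ s) (negbTE sp) (negbTE sq).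
by rewrite bc_refl_third.
Qed.

Lemma reflK (p q : pt R) : p \in V0 -> q \in V0 -> involutive (refl p q).
Proof.
move=> hp hq z; have [->|pq] := eqVneq p q; first by rewrite !refl_id.
apply: (@bc_inj _ T) => r hr.
have qp : q != p by rewrite eq_sym.
have [->|rp] := eqVneq r p; first by rewrite bc_refl // refl_sym bc_refl.
have [->|rq] := eqVneq r q; first by rewrite refl_sym bc_refl // bc_refl.
by rewrite !bc_refl_third.
Qed.

Lemma refl_V0 (p q s : pt R) : p \in V0 -> q \in V0 -> s \in V0 ->
  refl p q s \in V0.
Proof.
move=> hp hq hs; have [->|pq] := eqVneq p q; first by rewrite !refl_id.
by rewrite refl_corner //; do 2 case: ifP => //.
Qed.

Lemma refl_V n (p q z : pt R) : p \in V0 -> q \in V0 -> z \in V n ->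
  refl p q z \in V n.
Proof.
move=> hp hq; elim: n z => [|n IH] z hz; first exact: refl_V0.
case/mem_VS: hz => s hs [x hx ->]; rewrite refl_Psi Psi_V ?refl_V0 //.
exact: IH.
Qed.

Lemma refl_edge n (p q x y : pt R) : p \in V0 -> q \in V0 ->
  edge n (refl p q x) (refl p q y) = edge n x y.
Proof.
move=> hp hq.
have inj := inv_inj (reflK hp hq).
have h : forall m a b, edge m a b -> edge m (refl p q a) (refl p q b).
  elim=> [|m IH] a b.
    rewrite !edge0 => /and3P[ha hb hab].
    by rewrite !refl_V0 //= (inj_eq inj).
  case/edgeS => s hs [x' [y' e [-> ->]]]; apply/edgeS.
  exists (refl p q s); first exact: refl_V0.
  exists (refl p q x'), (refl p q y'); first exact: IH.
  by rewrite !refl_Psi.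
by apply/idP/idP => /h //; rewrite !reflK.
Qed.

Lemma avg_refl n (p q x : pt R) (f : pt R -> R) : p \in V0 -> q \in V0 ->
  avg n f (refl p q x) = avg n (f \o refl p q) x.
Proof.
move=> hp hq; have inj := inv_inj (reflK hp hq).
have hperm : perm_eq (nb n (refl p q x)) (map (refl p q) (nb n x)).
  apply: uniq_perm; rewrite ?map_inj_uniq ?uniq_nb //.
  move=> z; rewrite -[z](reflK hp hq) mem_map // !mem_nb refl_edge //.
by rewrite /avg (perm_size hperm) size_map (perm_big _ hperm) big_map.
Qed.

(** * Words, cells, and the cells at a vertex *)

Definition Psiw (w : seq (pt R)) (z : pt R) : pt R := foldr (@Psi R) z w.
Definition word (w : seq (pt R)) : bool := all (mem V0) w.

Lemma word_nseq k p : p \in V0 -> word (nseq k p).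
Proof. by move=> hp; rewrite /word all_nseq /= hp orbT. Qed.

Lemma word_cat w w' : word (w ++ w') = word w && word w'.
Proof. exact: all_cat. Qed.

Lemma word_rcons w p : word (rcons w p) = (p \in V0) && word w.
Proof. exact: all_rcons. Qed.

Lemma Psiw_cat w w' z : Psiw (w ++ w') z = Psiw w (Psiw w' z).
Proof. by rewrite /Psiw foldr_cat. Qed.

Lemma Psiw_V w n z : word w -> z \in V n -> Psiw w z \in V (size w + n).
Proof.
elim: w => [//|p w IH] /= /andP[hp hw] hz; apply: Psi_V => //; exact: IH.
Qed.

Lemma Psiw_tri w z : word w -> tri z -> tri (Psiw w z).
Proof.
elim: w => [//|p w IH] /= /andP[hp hw] hz; apply: tri_Psi => //; exact: IH.
Qed.

Lemma V_cells m n z : z \in V (m + n) ->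
  exists w, exists2 y, [/\ word w, size w = m & y \in V n] & z = Psiw w y.
Proof.
elim: m z => [|m IH] z; first by move=> hz; exists [::], z.
case/mem_VS => p hp [x /IH[w [y [hw sw hy] ->]] ->].
by exists (p :: w), y; split; rewrite //= ?hp //= sw.
Qed.

Lemma Psi_notV0 p z : p \in V0 -> tri z -> z \notin V0 -> Psi p z \notin V0.
Proof.
move=> hp hz hn; apply/negP => h.
have e : Psi p z = Psi (Psi p z) (Psi p z) by rewrite Psi_fix.
have [pq|pq] := eqVneq p (Psi p z).
  by move: e; rewrite -{2}pq => /Psi_inj e; move: hn; rewrite e h.
by have [e' _] := Psi_meet hp h pq hz (tri_corner h) e; move: hn; rewrite e' h.
Qed.

Lemma Psiw_notV0 w z : word w -> tri z -> z \notin V0 -> Psiw w z \notin V0.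
Proof.
elim: w => [//|p w IH] /= /andP[hp hw] hz hn; apply: Psi_notV0 => //.
  exact: Psiw_tri.
exact: IH.
Qed.

(** Inside a cell the fine walk is a copy of the walk on [V n], since a cell is joined to its
    outside only through its corners. *)
Lemma avg_interior w n f x : word w -> x \in V n -> x \notin V0 ->
  avg (size w + n) f (Psiw w x) = avg n (f \o Psiw w) x.
Proof.
elim: w f => [|p w IH] f /=; first by move=> *; apply: eq_avg.
case/andP => hp hw hx hn.
rewrite addSn avg_Psi ?IH //; first exact: Psiw_V.
by left; apply: Psiw_notV0 => //; exact: V_tri hx.
Qed.

Definition cell_at m v w q := [/\ word w, size w = m, q \in V0 & Psiw w q = v].

Lemma Psiw_nseq m p : Psiw (nseq m p) p = p.
Proof. by elim: m => //= m ->; rewrite Psi_fix. Qed.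

Lemma corner_cells m p w q : p \in V0 -> cell_at m p w q -> w = nseq m p /\ q = p.
Proof.
move=> hp; elim: m w => [|m IH] w [hw sw hq e].
  by move: e; rewrite (size0nil sw).
case: w hw sw e => // j w /= /andP[hj hw] [sw] e.
have [jp|jp] := eqVneq j p.
  subst j; move: e; rewrite -{2}(Psi_fix p) => /Psi_inj e.
  by have [//|-> ->] := IH w.
have e' : Psi j (Psiw w q) = Psi p p by rewrite e Psi_fix.
have [_ pj] := Psi_meet hj hp jp (Psiw_tri hw (tri_corner hq)) (tri_corner hp) e'.
by move: jp; rewrite pj eqxx.
Qed.

Lemma avg_corner m n f p : p \in V0 ->
  avg (m + n) f p = avg n (f \o Psiw (nseq m p)) p.
Proof.
move=> hp; elim: m f => [|m IH] f; first by apply: eq_avg.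
rewrite -{1}(Psi_fix p) addSn avg_Psi ?IH //; first exact: V0_sub.
by right.
Qed.

(** A corner of the whole triangle lies in a single cell, which is then listed twice. With this
    convention the averaging formula and the uniqueness clause hold for all vertices alike. *)
Lemma vertex_cells m v : v \in V m -> exists w1 q1 w2 q2,
  [/\ cell_at m v w1 q1, cell_at m v w2 q2,
    (forall n f, avg (m + n) f v =
       (avg n (f \o Psiw w1) q1 + avg n (f \o Psiw w2) q2) / 2) &
    forall w q, cell_at m v w q -> (w = w1 /\ q = q1) \/ (w = w2 /\ q = q2)].
Proof.
have corner : forall k p, p \in V0 -> exists w1 q1 w2 q2,
  [/\ cell_at k p w1 q1, cell_at k p w2 q2,
    (forall n f, avg (k + n) f p =
       (avg n (f \o Psiw w1) q1 + avg n (f \o Psiw w2) q2) / 2) &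
    forall w q, cell_at k p w q -> (w = w1 /\ q = q1) \/ (w = w2 /\ q = q2)].
  move=> k p hp; have c : cell_at k p (nseq k p) p.
    by split; rewrite ?size_nseq ?Psiw_nseq ?word_nseq.
  exists (nseq k p), p, (nseq k p), p; split => //.
    by move=> n f; rewrite avg_corner //; field.
  by move=> w q /(corner_cells hp); left.
elim: m v => [|m IH] v hv; first exact: corner.
case/mem_VS: hv => j hj [x hx ->].
have [hx0|hx0] := boolP (x \in V0); last first.
  have [w1 [q1 [w2 [q2 [[c1 c2 c3 c4] [d1 d2 d3 d4] h1 h2]]]]] := IH x hx.
  exists (j :: w1), q1, (j :: w2), q2; split.
  - by split; rewrite //= ?hj //= ?c2 ?c4.
  - by split; rewrite //= ?hj //= ?d2 ?d4.
  - move=> n f; rewrite addSn avg_Psi ?h1 //; last by left.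
    rewrite -c4; have := Psiw_V c1 (V0_sub n c3); by rewrite c2.
  case=> [q []//|p w q [] /= /andP[hp hw] [sw] hq e].
  have [pj|pj] := eqVneq p j.
    subst p; move/Psi_inj: e => e.
    by have [//|[-> ->]|[-> ->]] := h2 w q; [left|right].
  rewrite eq_sym in pj.
  have [xp _] := Psi_meet hj hp pj (V_tri hx) (Psiw_tri hw (tri_corner hq)) (esym e).
  by move: hx0; rewrite xp hp.
have [->|xj] := eqVneq x j; first by rewrite Psi_fix; exact: corner.
exists (j :: nseq m x), x, (x :: nseq m j), j; split.
- by split; rewrite //= ?hj ?word_nseq ?size_nseq ?Psiw_nseq.
- by split; rewrite //= ?hx0 ?word_nseq ?size_nseq ?Psiw_nseq // Psi_mid.
- by move=> n f; rewrite addSn avg_mid // !avg_corner.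
case=> [q []//|p w q [] /= /andP[hp hw] [sw] hq e].
have [pj|pj] := eqVneq p j.
  subst p; move/Psi_inj: e => e.
  by have [//|-> ->] := @corner_cells m x w q hx0; left.
rewrite eq_sym in pj.
have [xp e'] := Psi_meet hj hp pj (V_tri hx) (Psiw_tri hw (tri_corner hq)) (esym e).
subst p.
by have [//|-> ->] := @corner_cells m j w q hj; right.
Qed.

End Averages.

(** * Hitting distributions and crossings of a cell *)

Section Hitting.
Variables (R : realType) (T : equilateral R).
Local Notation p1 := (pp1 T).
Local Notation p2 := (pp2 T).
Local Notation p3 := (pp3 T).
Local Notation V0 := (V0 T).
Local Notation V := (V T).
Local Notation edge := (edge T).
Local Notation tri := (tri T).
Local Notation avg := (avg T).
Local Notation word := (word T).
Local Notation cell_at := (cell_at T).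

Implicit Types (B : pred (pt R)) (d : pt R -> nat -> R) (W : nat -> R)
  (f : pt R -> R) (k n : nat) (x y z q v : pt R) (w : seq (pt R)).

(* With tau the hitting time of B by the walk on V_n started at x, this is
   E_x[d(X_tau, k - tau); tau <= k]. *)
Fixpoint hit n (B : pred (pt R)) (d : pt R -> nat -> R) (k : nat) (x : pt R) : R :=
  if B x then d x k else if k is k'.+1 then avg n (hit n B d k') x else 0.

Lemma hit_in n B d k x : B x -> hit n B d k x = d x k.
Proof. by case: k => [|k] /= ->. Qed.

Lemma hit0 n B d x : ~~ B x -> hit n B d 0 x = 0.
Proof. by move=> /= /negbTE ->. Qed.

Lemma hitS n B d k x : ~~ B x -> hit n B d k.+1 x = avg n (hit n B d k) x.
Proof. by move=> /= /negbTE ->. Qed.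

Lemma avg_ge0 n f x : (forall z, z \in V n -> 0 <= f z) -> 0 <= avg n f x.
Proof.
(* Zero is written as a product so that [avgZ] evaluates its average; [avg_cst] would require [x] to
   be a vertex. *)
move=> h; apply: le_trans (_ : avg n (fun=> 0 * 0) x <= _).
  by rewrite avgZ mul0r.
by apply: avg_le => z hz; rewrite mul0r h.
Qed.

Lemma hit_le n B d d' k x :
  (forall q, B q -> forall j, (j <= k)%N -> d q j <= d' q j) ->
  hit n B d k x <= hit n B d' k x.
Proof.
elim: k x => [|k IH] x h.
  have [b|b] := boolP (B x); first by rewrite !hit_in // h.
  by rewrite !hit0.
have [b|b] := boolP (B x); first by rewrite !hit_in // h.
rewrite !hitS //; apply: avg_le => z _; apply: IH => q hq j hj.
by apply: h => //; exact: leqW.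
Qed.

Lemma eq_hit n B B' d d' k x : B =1 B' -> (forall q, B q -> d q = d' q) ->
  hit n B d k x = hit n B' d' k x.
Proof.
move=> hB hd; elim: k x => [|k IH] x /=; rewrite -hB; case: ifP => b //.
- by rewrite hd.
- by rewrite hd.
- by apply: eq_avg => z _; exact: IH.
Qed.

Lemma hit_lin n B (a : R) d d' k x :
  hit n B (fun q j => a * d q j + d' q j) k x = a * hit n B d k x + hit n B d' k x.
Proof.
elim: k x => [|k IH] x /=; case: ifP => // _; first by rewrite mulr0 addr0.
rewrite -avgZ -avgD; by apply: eq_avg => z _; exact: IH.
Qed.

Lemma hit_ge0 n B d k x : (forall q, B q -> forall j, 0 <= d q j) ->
  0 <= hit n B d k x.
Proof.
move=> h; elim: k x => [|k IH] x /=; case: ifP => // b; do ?by apply: h.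
exact: avg_ge0.
Qed.

Lemma hit_bound n B d W k x : (forall j, 0 <= W j) ->
  (forall j, W j <= W j.+1) -> (forall q, B q -> forall j, d q j <= W j) ->
  x \in V n -> hit n B d k x <= W k.
Proof.
move=> W0 Wn h; elim: k x => [|k IH] x hx /=; case: ifP => b //; do ?by apply: h.
rewrite (le_trans _ (Wn k)) // -[leRHS](avg_cst (W k) hx).
by apply: avg_le => z hz; exact: IH.
Qed.

Lemma hit_nondec n B d k x : (forall q, B q -> forall j, 0 <= d q j) ->
  (forall q, B q -> forall j, d q j <= d q j.+1) ->
  hit n B d k x <= hit n B d k.+1 x.
Proof.
move=> d0 dn; elim: k x => [|k IH] x.
  have [b|b] := boolP (B x); first by rewrite !hit_in ?dn.
  by rewrite hit0 // hit_ge0.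
have [b|b] := boolP (B x); first by rewrite !hit_in ?dn.
by rewrite !hitS //; apply: avg_le => z _.
Qed.

Lemma hit_refl n B d k a b x : a \in V0 -> b \in V0 ->
  hit n B d k (refl a b x) = hit n (B \o refl a b) (d \o refl a b) k x.
Proof.
move=> ha hb; elim: k x => [|k IH] x /=; case: ifP => // _.
by rewrite avg_refl //; apply: eq_avg => z _; exact: IH.
Qed.

Definition offc (q : pt R) : pred (pt R) := [pred x | (x \in V0) && (x != q)].

(* With S the time the walk on V_n takes from one corner to the other two,
   this is the sequence k |-> E[W(k - S); S <= k]. *)
Definition cross n (W : nat -> R) (k : nat) : R := hit n (offc p1) (fun=> W) k p1.

Lemma mem_refl a b x : a \in V0 -> b \in V0 -> (refl a b x \in V0) = (x \in V0).
Proof.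
move=> ha hb; apply/idP/idP => h; last exact: refl_V0.
by rewrite -[x](reflK ha hb) refl_V0.
Qed.

(** The reflection exchanging [p1] and [q] is an automorphism of the graph, so a crossing has the
    same law from every corner. *)
Lemma crossE n W k q : q \in V0 -> hit n (offc q) (fun=> W) k q = cross n W k.
Proof.
move=> hq; have [->//|qp] := eqVneq q p1.
have pq : p1 != q by rewrite eq_sym.
have hp := p1V0 T.
have e : refl p1 q p1 = q by rewrite (@refl_corner _ T) // eqxx.
rewrite -{2}e hit_refl //; apply: eq_hit => // x.
rewrite /offc /= mem_refl //; congr (_ && _).
by rewrite -{2}e (inj_eq (inv_inj (reflK hp hq))).
Qed.

Lemma cross_le n W W' k : (forall j, (j <= k)%N -> W j <= W' j) ->
  cross n W k <= cross n W' k.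
Proof. by move=> h; apply: hit_le => q _ j hj; exact: h. Qed.

Lemma cross_ge0 n W k : (forall j, 0 <= W j) -> 0 <= cross n W k.
Proof. by move=> h; apply: hit_ge0 => *; exact: h. Qed.

Lemma cross_nondec n W k : (forall j, 0 <= W j) -> (forall j, W j <= W j.+1) ->
  cross n W k <= cross n W k.+1.
Proof. by move=> h h'; apply: hit_nondec => *; [exact: h|exact: h']. Qed.

Lemma cross_bound n W k : (forall j, 0 <= W j) -> (forall j, W j <= W j.+1) ->
  cross n W k <= W k.
Proof. by move=> h h'; apply: hit_bound => //; exact/V0_sub/p1V0. Qed.

Lemma crossZ n c W k : cross n (fun j => c * W j) k = c * cross n W k.
Proof.
have e := hit_lin n (offc p1) c (fun=> W) (fun _ _ => 0) k p1.
transitivity (hit n (offc p1) (fun q j => c * W j + 0) k p1).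
  by apply: eq_hit => // q _; apply/funext => j; rewrite addr0.
rewrite e.
suff -> : hit n (offc p1) (fun _ _ => 0) k p1 = 0 by rewrite addr0.
(* Linearity with coefficient -1 on zero data gives hit(0) = - hit(0) + hit(0), that is, zero. *)
have e0 := hit_lin n (offc p1) (-1) (fun _ _ => 0) (fun _ _ => 0) k p1.
have e1 : hit n (offc p1) (fun q j => -1 * 0 + 0) k p1 =
   hit n (offc p1) (fun _ _ => (0 : R)) k p1.
  by apply: eq_hit => // q _; apply/funext => j; rewrite mulr0 addr0.
by move: e0; rewrite e1 mulN1r addNr.
Qed.

(** By renewal, [crossn n l k] is P(S_1 + ... + S_l <= k) for independent copies S_i of the crossing
    time of the walk on V_n. *)
Definition crossn n l := iter l (cross n) (fun=> 1).

Lemma crossn_ge0 n l k : 0 <= crossn n l k.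
Proof. by elim: l k => [//|l IH] k; exact: cross_ge0. Qed.

Lemma crossn_nondec n l k : crossn n l k <= crossn n l k.+1.
Proof.
elim: l k => [//|l IH] k; apply: cross_nondec => // j; exact: crossn_ge0.
Qed.

Lemma crossn_nondec_le n l j k : (j <= k)%N -> crossn n l j <= crossn n l k.
Proof.
move=> /subnKC <-; elim: (k - j)%N => [|i IH]; rewrite ?addn0 //.
by rewrite addnS (le_trans IH) // crossn_nondec.
Qed.

Lemma crossnS_le n l k : crossn n l.+1 k <= crossn n l k.
Proof.
apply: (@cross_bound n (crossn n l)) => j; first exact: crossn_ge0.
exact: crossn_nondec.
Qed.

Lemma crossn_anti n l l' k : (l <= l')%N -> crossn n l' k <= crossn n l k.
Proof.
move=> /subnKC <-; elim: (l' - l)%N => [|i IH]; rewrite ?addn0 //.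
by rewrite addnS (le_trans (crossnS_le _ _ _)).
Qed.

(** The last crossing has at most [k] steps left, so its probability is at most [crossn n 1 k] and
    can be taken out. This is the small factor gained by requiring one more crossing. *)
Lemma crossn_split n l k : crossn n l.+1 k <= crossn n 1 k * crossn n l k.
Proof.
have H : forall l W c k, (forall j, (j <= k)%N -> W j <= c) ->
    iter l (cross n) W k <= c * crossn n l k.
  elim=> [|l' IH] W c k' h /=; first by rewrite mulr1 h.
  rewrite -crossZ; apply: cross_le => j hj; apply: IH => i hi; apply: h.
  exact: leq_trans hj.
rewrite /crossn iterSr; apply: H => j hj.
exact: (@crossn_nondec_le n 1 j k hj).
Qed.

(** A walk started at [v] makes one crossing of a level-[m] cell before it reaches an outer vertex
    of the star of [v]. A subsolution that starts nonpositive on the star and is at most [W] at the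
    outer vertices is therefore bounded at [v] by [W] delayed by one crossing. *)
Lemma star_upper m n v (U : nat -> pt R -> R) (W : nat -> R) : v \in V m ->
  (forall k x, x \in V (m + n) -> U k.+1 x <= avg (m + n) (U k) x) ->
  (forall w q, cell_at m v w q -> forall y, y \in V n -> U 0%N (Psiw w y) <= 0) ->
  (forall j, 0 <= W j) ->
  (forall w q q', cell_at m v w q -> q' \in V0 -> q' != q ->
     forall k, U k (Psiw w q') <= W k) ->
  forall k, U k v <= cross n W k.
Proof.
move=> hv sub init W0 bnd.
have [w1 [q1 [w2 [q2 [c1 c2 hav _]]]]] := vertex_cells hv.
(* The star is folded onto one cell: in each cell at [v] the bound is the crossing functional at the
   position inside that cell. All cells at [v] are treated at once because the centre feels both of
   them. *)
have main : forall k w q, cell_at m v w q -> forall y, y \in V n ->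
    U k (Psiw w y) <= hit n (offc q) (fun=> W) k y.
  elim=> [|k IH] w q c y hy.
    have [b|b] := boolP (offc q y).
      by rewrite hit_in //; case/andP: b => b1 b2; exact: bnd c _ _ _.
    by rewrite hit0 //; exact: init c _ _.
  have [b|b] := boolP (offc q y).
    by rewrite hit_in //; case/andP: b => b1 b2; exact: bnd c _ _ _.
  have [hw sw hq e] := c.
  have [yq|yq] := eqVneq y q; last first.
    have y0 : y \notin V0 by move: b; rewrite /offc /= yq andbT.
    rewrite hitS //.
    have hs : Psiw w y \in V (m + n) by rewrite -sw; exact: Psiw_V.
    rewrite (le_trans (sub _ _ hs)) // -{1}sw avg_interior //.
    by apply: avg_le => z hz; exact: IH c _ _.
  subst y; rewrite e.
  have hvn : v \in V (m + n).
    by rewrite -e -sw; apply: Psiw_V => //; exact: V0_sub.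
  rewrite (le_trans (sub _ _ hvn)) // hav crossE //.
  (* By [crossE] the two cells give the same bound at the centre, so their mean gives it too. *)
  have step w' q' : cell_at m v w' q' ->
      avg n (U k \o Psiw w') q' <= cross n W k.+1.
    move=> c'; have [_ _ hq' _] := c'.
    rewrite -(crossE _ _ _ hq') hitS ?/offc /= ?eqxx ?andbF //.
    by apply: avg_le => z hz; exact: IH c' _ _.
  have := step _ _ c1; have := step _ _ c2; lra.
move=> k; have [hw sw hq e] := c1.
by rewrite -e -(crossE _ _ _ hq); apply: main c1 _ _; exact: V0_sub.
Qed.

Lemma cell_upper m n w (U : nat -> pt R -> R) (W : nat -> R) :
  word w -> size w = m ->
  (forall k x, x \in V (m + n) -> U k.+1 x <= avg (m + n) (U k) x) ->
  (forall j, 0 <= W j) -> (forall j, W j <= W j.+1) ->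
  (forall y, y \in V n -> U 0%N (Psiw w y) <= 0) ->
  (forall q, q \in V0 -> forall k, U k (Psiw w q) <= W k) ->
  forall k y, y \in V n -> U k (Psiw w y) <= W k.
Proof.
move=> hw sw sub W0 Wn init bnd; elim=> [|k IH] y hy.
  exact: le_trans (init _ _) (W0 _).
have [b|b] := boolP (y \in V0); first exact: bnd.
have hs : Psiw w y \in V (m + n) by rewrite -sw; exact: Psiw_V.
rewrite (le_trans (sub _ _ hs)) // -{1}sw avg_interior //.
rewrite (le_trans _ (Wn k)) // -[leRHS](avg_cst (W k) hy).
by apply: avg_le => z hz; exact: IH.
Qed.

Definition corner_hit n W q : nat -> pt R -> R :=
  hit n (mem V0) (fun t j => if t == q then W j else 0).

(** Decomposition at the first corner that is met: if it is [s], a full crossing is still to be made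
    and contributes [c = cross n W]; otherwise the crossing is over. *)
Lemma hit_corner_sum n (W c : nat -> R) k s s' s'' :
  s \in V0 -> s' \in V0 -> s'' \in V0 -> s' != s -> s'' != s -> s' != s'' ->
  c = cross n W ->
  forall y, y \in V n ->
  hit n (offc s) (fun=> W) k y =
    corner_hit n c s k y + corner_hit n W s' k y + corner_hit n W s'' k y.
Proof.
move=> hs hs' hs'' n1 n2 n3 ec; rewrite /corner_hit.
have corner i y : y \in V0 -> hit n (offc s) (fun=> W) i y =
    (if y == s then c i else 0) + (if y == s' then W i else 0)
    + (if y == s'' then W i else 0).
  move=> y0; have [->|ys] := eqVneq y s.
    by rewrite crossE // ec !(eq_sym s) (negbTE n1) (negbTE n2) !addr0.
  rewrite hit_in ?/offc /= ?y0 ?ys // add0r.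
  have : (y == s') || (y == s'').
    move: ys n1 n2 n3; case/V0P: y0 => ->; case/V0P: hs => ->; case/V0P: hs' => ->;
    by case/V0P: hs'' => ->; rewrite ?eqxx ?orbT.
  case/orP => /eqP ->; rewrite eqxx ?(negbTE n3) ?addr0 //.
  by rewrite eq_sym (negbTE n3) add0r.
move=> y hy; elim: k y hy => [|k IH] y hy; have [y0|y0] := boolP (y \in V0).
- by rewrite corner // ![hit n (mem V0) _ _ _]hit_in.
- by rewrite ![hit n (mem V0) _ _ _]hit0 // hit0 ?addr0 // /offc /= (negbTE y0).
- by rewrite corner // ![hit n (mem V0) _ _ _]hit_in.
rewrite ![hit n (mem V0) _ _ _]hitS // hitS ?/offc /= ?(negbTE y0) //.
by rewrite -!avgD; exact: eq_avg.
Qed.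

Lemma third_corner s s' : s \in V0 -> s' \in V0 -> s' != s ->
  exists s'', [/\ s'' \in V0, s'' != s & s' != s''].
Proof.
move=> hs hs'.
have := neq12 T; have := neq13 T; have := neq23 T => n23 n13 n12.
have := p1V0 T; have := p2V0 T; have := p3V0 T => h3 h2 h1.
case/V0P: hs => ->; case/V0P: hs' => ->; rewrite ?eqxx // => _.
- by exists p3; rewrite h3 n23 eq_sym n13.
- by exists p2; rewrite h2 eq_sym n12 eq_sym n23.
- by exists p3; rewrite h3 n13 eq_sym n23.
- by exists p1; rewrite h1 n12 eq_sym n13.
- by exists p2; rewrite h2 n12 n23.
- by exists p1; rewrite h1 n13 eq_sym n12.
Qed.

Lemma hit_corner_refl n (W : nat -> R) k a b s x : a \in V0 -> b \in V0 ->
  corner_hit n W (refl a b s) k (refl a b x) = corner_hit n W s k x.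
Proof.
move=> ha hb; rewrite /corner_hit hit_refl //; apply: eq_hit => [y|q _] /=.
  by rewrite mem_refl.
by apply/funext => j; rewrite (inj_eq (inv_inj (reflK ha hb))).
Qed.

(** By symmetry the walk leaves the star of [v] through each of its outer vertices, at most four,
    with equal probability at every time. Knowing [L] at just one of them therefore costs a factor
    4. *)
Lemma star_lower m n v w q q' (L : nat -> pt R -> R) (W : nat -> R) K :
  cell_at m v w q -> q' \in V0 -> q' != q ->
  (forall k x, 0 <= L k x) ->
  (forall k x, x \in V (m + n) -> avg (m + n) (L k) x <= L k.+1 x) ->
  (forall j, 0 <= W j) ->
  (forall k, (k <= K)%N -> W k <= L k (Psiw w q')) ->
  forall k, (k <= K)%N -> cross n W k / 4 <= L k v.
Proof.
move=> cw hq' nq L0 sup W0 bnd.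
have hv : v \in V m.
  by case: cw => hw <- hq <-; rewrite -[size w]addn0; exact: Psiw_V.
have [w1 [q1 [w2 [q2 [c1 c2 hav huniq]]]]] := vertex_cells hv.
set c := cross n W.
pose base := corner_hit n c.
pose side := corner_hit n W.
have c0 j : 0 <= c j by exact: cross_ge0.
have base0 s k y : 0 <= base s k y by apply: hit_ge0 => t _ j; case: ifP.
have side0 s k y : 0 <= side s k y by apply: hit_ge0 => t _ j; case: ifP.
(* The part r of a crossing due to returns to its starting corner does not depend on this corner. *)
have rE k s : s \in V0 -> avg n (base s k) s = avg n (base p1 k) p1.
  move=> hs; have [->//|n1] := eqVneq s p1.
  have n1' : p1 != s by rewrite eq_sym.
  have hp := p1V0 T.
  have e : refl p1 s p1 = s by rewrite (@refl_corner _ T) // eqxx.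
  rewrite -{2}e avg_refl //; apply: eq_avg => z _ /=.
  by rewrite /base -(hit_corner_refl n c k p1 z hp hs) e.
(* After one step the crossing functional splits as r + 2t, where t is the part of direct arrivals
   at one other corner; the reflection exchanging the two other corners makes their parts equal. *)
have tE k s s' : s \in V0 -> s' \in V0 -> s' != s ->
    c k.+1 = avg n (base p1 k) p1 + 2 * avg n (side s' k) s.
  move=> hs hs' n1; have [s'' [hs'' n2 n3]] := third_corner hs hs' n1.
  rewrite -(rE k s) // /c -(crossE _ _ _ hs) hitS ?/offc /= ?eqxx ?andbF //.
  rewrite (eq_avg _ (hit_corner_sum k hs hs' hs'' n1 n2 n3 (erefl c))) !avgD.
  suff -> : avg n (side s'' k) s = avg n (side s' k) s by rewrite /side; ring.
  have e : refl s' s'' s = s by rewrite (@refl_corner _ T) // !(eq_sym s) (negbTE n1) (negbTE n2).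
  have e' : refl s' s'' s' = s'' by rewrite (@refl_corner _ T) // eqxx.
  rewrite -{1}e avg_refl //; apply: eq_avg => z _ /=.
  by rewrite /side -(hit_corner_refl n W k s' z hs' hs'') e'.
(* Lower solution on the star: in every cell a return to [v] is worth c/4, and in the cell [w] alone
   a direct arrival at [q'] is worth [W]. At the centre this gives (r/4 + r/4 + t)/2 = (r + 2t)/4 =
   c/4, and more if the two listed cells coincide. *)
have main : forall k, (k <= K)%N ->
   (forall w' s, cell_at m v w' s -> forall y, y \in V n ->
       base s k y / 4 <= L k (Psiw w' y)) /\
   (forall y, y \in V n -> base q k y / 4 + side q' k y <= L k (Psiw w y)) /\
   c k / 4 <= L k v.
  elim=> [|k IH] hk.
    have ck0 : c 0%N = 0 by rewrite /c /cross hit0 // /offc /= eqxx andbF.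
    have b0 s y : base s 0%N y = 0.
      have [y0|y0] := boolP (y \in V0); rewrite /base /corner_hit.
        by rewrite hit_in // ck0 if_same.
      by rewrite hit0.
    split; first by move=> w' s _ y _; rewrite b0 mul0r.
    split; last by rewrite ck0 mul0r.
    move=> y hy; rewrite b0 mul0r add0r /side /corner_hit.
    have [y0|y0] := boolP (y \in V0); last by rewrite hit0.
    by rewrite hit_in //; case: eqP => [->|_]; rewrite ?bnd.
  have [IH1 [IH2 _]] := IH (ltnW hk).
  have hvn : v \in V (m + n).
    by case: cw => hw <- hq <-; apply: Psiw_V => //; exact: V0_sub.
  have centre : c k.+1 / 4 <= L k.+1 v.
    apply: le_trans (sup k v hvn); rewrite hav.
    have low w' s : cell_at m v w' s ->
        avg n (base p1 k) p1 / 4 <= avg n (L k \o Psiw w') s.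
      move=> c'; have [_ _ hs _] := c'.
      rewrite -(rE k s) // mulrC -avgZ; apply: avg_le => z hz /=.
      by rewrite mulrC; exact: IH1 c' _ _.
    have lowq : avg n (base p1 k) p1 / 4 + avg n (side q' k) q <=
        avg n (L k \o Psiw w) q.
      have [_ _ hq _] := cw.
      rewrite -(rE k q) // mulrC -avgZ -avgD; apply: avg_le => z hz /=.
      by rewrite mulrC; exact: IH2.
    have [_ _ hq _] := cw.
    rewrite (tE k q q') //.
    have := low _ _ c1; have := low _ _ c2.
    by case: (huniq _ _ cw) => -[<- <-]; move: lowq; lra.
  have inner w' s (f : pt R -> R) y : cell_at m v w' s -> y \in V n ->
      y \notin V0 -> (forall z, z \in V n -> f z <= L k (Psiw w' z)) ->
      avg n f y <= L k.+1 (Psiw w' y).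
    move=> [hw sw _ _] hy y0 h.
    have hs : Psiw w' y \in V (m + n) by rewrite -sw; exact: Psiw_V.
    apply: le_trans (sup _ _ hs); rewrite -[in leRHS]sw avg_interior //.
    by apply: avg_le => z hz; exact: h.
  split=> [w' s c' y hy|].
    have [y0|y0] := boolP (y \in V0).
      rewrite /base /corner_hit hit_in //; case: eqP => [->|_]; last by rewrite mul0r.
      by case: c' => _ _ _ ->.
    rewrite /base /corner_hit hitS // mulrC -avgZ; apply: (inner _ _ _ _ c') => // z hz.
    by rewrite mulrC; exact: IH1 c' _ _.
  split=> // y hy.
  have [y0|y0] := boolP (y \in V0).
    rewrite /base /side /corner_hit !hit_in //; case: eqP => [->|_].
      by rewrite eq_sym (negbTE nq) addr0; case: cw => _ _ _ ->.
    by rewrite mul0r add0r; case: eqP => [->|_]; rewrite ?bnd.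
  rewrite /base /side /corner_hit !hitS // mulrC -avgZ -avgD.
  apply: (inner _ _ _ _ cw) => // z hz.
  by rewrite mulrC; exact: IH2.
by move=> k hk; have [_ []] := main k hk.
Qed.

(** Strong Markov property at the time the walk hits [B'] inside the subcell of [j]. The hypothesis
    ensures that before this time it neither meets [B] nor stands at a gluing point, so it moves
    like the walk on [V n]. *)
Lemma hit_sub n (B B' : pred (pt R)) d k j y : j \in V0 ->
  (forall y, y \in V n -> ~~ B' y -> (y \notin V0 \/ y = j) /\ ~~ B (Psi j y)) ->
  y \in V n ->
  hit n.+1 B d k (Psi j y) = hit n B' (fun q i => hit n.+1 B d i (Psi j q)) k y.
Proof.
move=> hj h; elim: k y => [|k IH] y hy.
  have [b|b] := boolP (B' y); first by rewrite [RHS]hit_in.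
  by rewrite [RHS]hit0 // hit0 //; case: (h y hy b).
have [b|b] := boolP (B' y); first by rewrite [RHS]hit_in.
have [h1 h2] := h y hy b.
by rewrite [RHS]hitS // hitS // avg_Psi //; apply: eq_avg => z hz /=; exact: IH.
Qed.

Lemma hit_all_refl n W k a b x : a \in V0 -> b \in V0 ->
  hit n (mem V0) (fun=> W) k (refl a b x) = hit n (mem V0) (fun=> W) k x.
Proof.
by move=> ha hb; rewrite hit_refl //; apply: eq_hit => // y /=; rewrite mem_refl.
Qed.

Lemma hit_all_mid n W k i j : i \in V0 -> j \in V0 -> i != j ->
  hit n (mem V0) (fun=> W) k (Psi i j) = hit n (mem V0) (fun=> W) k (Psi p1 p2).
Proof.
have := neq12 T; have := neq13 T; have := neq23 T => n23 n13 n12.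
have := p1V0 T; have := p2V0 T; have := p3V0 T => h3 h2 h1.
have n21 : p2 != p1 by rewrite eq_sym.
have e13 : hit n (mem V0) (fun=> W) k (Psi p1 p3) =
    hit n (mem V0) (fun=> W) k (Psi p1 p2).
  rewrite -(hit_all_refl n W k (Psi p1 p3) h2 h3) refl_Psi !(@refl_corner _ T) //.
  by rewrite (negbTE n12) (negbTE n13) (eq_sym p3) (negbTE n23) eqxx.
have e23 : hit n (mem V0) (fun=> W) k (Psi p2 p3) =
    hit n (mem V0) (fun=> W) k (Psi p1 p2).
  rewrite -(hit_all_refl n W k (Psi p2 p3) h1 h3) refl_Psi !(@refl_corner _ T) //.
  rewrite (eq_sym p3) (negbTE n13) (negbTE n21) (negbTE n23) eqxx.
  by rewrite Psi_mid.
by case/V0P => -> /V0P[] ->; rewrite ?eqxx // => _; rewrite // Psi_mid.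
Qed.

(** The corners are reached from anywhere at least as fast as by a crossing. Both sides are compared
    with [cross n M], where [M] belongs to the exit from the midpoint of a side: a crossing from
    [p1] must first cross the subcell of [p1], whereas a walk from [y] leaves its subcell, by
    induction, at least as fast, and is then at such a midpoint or already at a corner. *)
Lemma exit_cross n W k y : (forall j, 0 <= W j) -> (forall j, W j <= W j.+1) ->
  y \in V n -> cross n W k <= hit n (mem V0) (fun=> W) k y.
Proof.
elim: n W k y => [|n IH] W k y W0 Wn hy.
  by rewrite [leRHS]hit_in //; exact: cross_bound.
pose M j := hit n.+1 (mem V0) (fun=> W) j (Psi p1 p2).
have M0 j : 0 <= M j by apply: hit_ge0.
have Mn j : M j <= M j.+1 by apply: hit_nondec.
have hMW j : M j <= W j.
  apply: hit_bound => //; apply: Psi_V; first exact: p1V0.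
  exact/V0_sub/p2V0.
have hp := p1V0 T.
have le1 x j : x \in V n.+1 -> hit n.+1 (offc p1) (fun=> W) j x <=
    hit n.+1 (mem V0) (fun=> W) j x.
  elim: j x => [|j IHj] x hx.
    have [b|b] := boolP (offc p1 x).
      by rewrite hit_in // hit_in //; case/andP: b.
    by rewrite hit0 //; apply: hit_ge0.
  have [b|b] := boolP (x \in V0).
    by rewrite [leRHS]hit_in //; exact: hit_bound.
  rewrite !hitS ?/offc /= ?(negbTE b) //; exact: avg_le.
apply: le_trans (_ : cross n M k <= _).
  rewrite /cross -{2}(Psi_fix p1).
  rewrite (@hit_sub n _ (offc p1)) //; [|move=> z hz|exact: V0_sub].
    apply: hit_le => q /andP[hq qp] j _.
    rewrite (le_trans (le1 _ _ _)) //; first exact/Psi_V/V0_sub.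
    by rewrite hit_all_mid // eq_sym.
  rewrite /offc /= negb_and negbK => /orP[z0|/eqP->].
    split; first by left.
    by rewrite negb_and (Psi_notV0 hp (V_tri hz) z0).
  by split; [right|rewrite Psi_fix eqxx andbF].
case/mem_VS: hy => j hj [z hz ->].
rewrite (@hit_sub n _ (mem V0)) //; last first.
  move=> x hx x0; split; first by left.
  exact: Psi_notV0 hj (V_tri hx) x0.
rewrite (le_trans (IH M k z M0 Mn hz)) //; apply: hit_le => q hq i _.
have [->|qj] := eqVneq q j.
  by rewrite Psi_fix hit_in.
by rewrite hit_all_mid // eq_sym.
Qed.

(** The unknown position inside the cell is paid for by one additional crossing, through
    [exit_cross]. *)
Lemma cell_lower m n w (L : nat -> pt R -> R) (W : nat -> R) K :
  word w -> size w = m ->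
  (forall k x, 0 <= L k x) ->
  (forall k x, x \in V (m + n) -> avg (m + n) (L k) x <= L k.+1 x) ->
  (forall j, 0 <= W j) -> (forall j, W j <= W j.+1) ->
  (forall q, q \in V0 -> forall k, (k <= K)%N -> W k <= L k (Psiw w q)) ->
  forall k y, (k <= K)%N -> y \in V n -> cross n W k <= L k (Psiw w y).
Proof.
move=> hw sw L0 sup W0 Wn bnd k y hk hy.
apply: le_trans (exit_cross k W0 Wn hy) _.
elim: k y hk hy => [|k IH] y hk hy.
all: have [b|b] := boolP (y \in V0); first by rewrite hit_in ?bnd.
  by rewrite hit0.
have hs : Psiw w y \in V (m + n) by rewrite -sw; exact: Psiw_V.
rewrite hitS // (le_trans _ (sup _ _ hs)) // -{1}sw avg_interior //.
by apply: avg_le => z hz; exact: IH (ltnW hk) hz.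
Qed.

Lemma edge_cell m v v' : edge m v v' -> exists w q q',
  [/\ cell_at m v w q, cell_at m v' w q' & q' != q].
Proof.
elim: m v v' => [|m IH] v v'.
  rewrite edge0 => /and3P[hv hv' n]; exists [::], v, v'; split => //.
  by rewrite eq_sym.
case/edgeS => p hp [x [y [/IH[w [q [q' [[c1 c2 c3 c4] [d1 d2 d3 d4] n]]]] [-> ->]]]].
exists (p :: w), q, q'; split => //; split; rewrite //= ?hp ?c2 ?c4 ?d4 //=.
Qed.

Fixpoint reach m K (v h : pt R) : Prop :=
  if K is K'.+1 then exists2 v', edge m v v' & reach m K' v' h else v = h.

(** Each edge of the path costs one application of [star_lower]: a factor 4 and one crossing. *)
Lemma reach_lower m n (L : nat -> pt R -> R) c0 K l v h :
  (forall k x, 0 <= L k x) ->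
  (forall k x, x \in V (m + n) -> avg (m + n) (L k) x <= L k.+1 x) ->
  0 <= c0 -> (forall k, (k <= K)%N -> c0 <= L k h) ->
  reach m l v h ->
  forall k, (k <= K)%N -> c0 / 4 ^+ l * crossn n l k <= L k v.
Proof.
move=> L0 sup c00 bnd; elim: l v => [|l IH] v /=.
  by move=> -> k hk; rewrite expr0 divr1 mulr1 bnd.
case=> v' /edge_cell[w [q [q' [cv cv' n0]]]] hr k hk.
have [_ _ hq' e'] := cv'.
have h4 : (0 : R) <= c0 / 4 ^+ l by rewrite divr_ge0 // exprn_ge0.
have := @star_lower m n v w q q' L (fun j => c0 / 4 ^+ l * crossn n l j) K
  cv hq' n0 L0 sup.
rewrite e' => /(_ _ (IH _ hr) k hk).
rewrite crossZ => H.
rewrite (_ : c0 / 4 ^+ l.+1 * crossn n l.+1 k =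
  c0 / 4 ^+ l * cross n (crossn n l) k / 4); last first.
  by rewrite exprS invfM [crossn n l.+1 k]/=; ring.
by apply: H => j; rewrite mulr_ge0 // crossn_ge0.
Qed.

Lemma cell_reach_lower m n w (L : nat -> pt R -> R) c0 K l h :
  word w -> size w = m ->
  (forall k x, 0 <= L k x) ->
  (forall k x, x \in V (m + n) -> avg (m + n) (L k) x <= L k.+1 x) ->
  0 <= c0 -> (forall k, (k <= K)%N -> c0 <= L k h) ->
  (forall q, q \in V0 -> exists2 l', (l' <= l)%N & reach m l' (Psiw w q) h) ->
  forall k y, (k <= K)%N -> y \in V n ->
    c0 / 4 ^+ l * crossn n l.+1 k <= L k (Psiw w y).
Proof.
move=> hw sw L0 sup c00 bnd hr k y hk hy.
have h4 : (0 : R) <= c0 / 4 ^+ l by rewrite divr_ge0 // exprn_ge0.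
rewrite -[crossn _ _ _]/(cross n (crossn n l) k) -crossZ.
apply: (@cell_lower m n w L _ K) => //.
- by move=> j; rewrite mulr_ge0 // crossn_ge0.
- by move=> j; rewrite ler_wpM2l // crossn_nondec.
move=> q hq j hj; have [l' hl hre] := hr q hq.
apply: le_trans (reach_lower L0 sup c00 bnd hre hj).
apply: ler_pM => //; first exact: crossn_ge0; last exact: crossn_anti.
rewrite ler_wpM2l // lef_pV2 ?posrE ?exprn_gt0 // ler_weXn2l // ler1n //.
Qed.

(** The function [g] counts crossings: one crossing lowers it by at most 1, and [U] starts
    nonpositive in every cell having a corner where [g] is at least 1. Each unit of [g] is converted
    into a crossing by [star_upper]. *)
Lemma far_upper m n (U : nat -> pt R -> R) (g : pt R -> R) :
  (forall k x, x \in V (m + n) -> U k.+1 x <= avg (m + n) (U k) x) ->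
  (forall k x, x \in V (m + n) -> U k x <= 1) ->
  (forall x y, edge m x y -> g x <= g y + 1) ->
  (forall w q, word w -> size w = m -> q \in V0 -> 1 <= g (Psiw w q) ->
     forall y, y \in V n -> U 0%N (Psiw w y) <= 0) ->
  forall l v, v \in V m -> l%:R <= g v -> forall k, U k v <= crossn n l k.
Proof.
move=> sub U1 lip init; elim=> [|l IH] v hv hg k.
  have [w [y [hw sw hy] ->]] : exists w, exists2 y,
      [/\ word w, size w = m & y \in V 0] & v = Psiw w y.
    by apply: V_cells; rewrite addn0.
  by apply: U1; rewrite -sw; apply: Psiw_V => //; exact: V0_sub.
apply: (@star_upper m n v U (crossn n l)) => //.
- move=> w q [hw sw hq e] y hy; apply: (init w q) => //; rewrite e.
  by apply: le_trans hg; rewrite ler1n.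
- by move=> j; exact: crossn_ge0.
move=> w q q' [hw sw hq e] hq' n0 j; apply: IH.
  by rewrite -sw -[size w]addn0; exact: Psiw_V.
have he : edge m v (Psiw w q').
  rewrite -e -sw; elim: w hw {sw e} => [_|p w IHw] /=.
    by rewrite edge0 hq hq' eq_sym.
  case/andP => hp hw; apply/edgeS; exists p => //.
  by exists (Psiw w q), (Psiw w q'); first exact: IHw.
have := lip _ _ he; move: hg; rewrite -natr1; lra.
Qed.

Lemma cell_far_upper m n w (U : nat -> pt R -> R) (g : pt R -> R) l :
  word w -> size w = m ->
  (forall k x, x \in V (m + n) -> U k.+1 x <= avg (m + n) (U k) x) ->
  (forall k x, x \in V (m + n) -> U k x <= 1) ->
  (forall x y, edge m x y -> g x <= g y + 1) ->
  (forall w q, word w -> size w = m -> q \in V0 -> 1 <= g (Psiw w q) ->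
     forall y, y \in V n -> U 0%N (Psiw w y) <= 0) ->
  (0 < l)%N -> (forall q, q \in V0 -> l%:R <= g (Psiw w q)) ->
  forall k y, y \in V n -> U k (Psiw w y) <= crossn n l k.
Proof.
move=> hw sw sub U1 lip init l0 far k y hy.
have hp := p1V0 T.
apply: (@cell_upper m n w U (crossn n l)) => //.
- by move=> j; exact: crossn_ge0.
- by move=> j; exact: crossn_nondec.
- apply: (init w p1) => //; apply: le_trans (far _ hp).
  by rewrite ler1n.
move=> q hq j; apply: (far_upper sub U1 lip init); last exact: far.
by rewrite -sw -[size w]addn0; exact: Psiw_V.
Qed.

End Hitting.

(** * The law of the crossing time *)

Section CrossingTime.
Variables (R : realType) (T : equilateral R).
Local Notation p1 := (pp1 T).
Local Notation p2 := (pp2 T).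
Local Notation p3 := (pp3 T).
Local Notation V0 := (V0 T).
Local Notation V := (V T).
Local Notation tri := (tri T).
Local Notation avg := (avg T).
Local Notation hit := (hit T).
Local Notation offc := (offc T).
Local Notation crossn := (crossn T).

Implicit Types (d f : pt R -> R) (x y z p q : pt R).

(** By [Psi_meet] the only points with two representations are [Psi p q = Psi q p], where the
    symmetry of [F] is assumed. *)
Lemma glue n (F : pt R -> pt R -> R) :
  (forall p q, p \in V0 -> q \in V0 -> p != q -> F p q = F q p) ->
  exists G : pt R -> R,
    forall p y, p \in V0 -> y \in V n -> G (Psi p y) = F p y.
Proof.
move=> hF.
pose D z := exists u : pt R * pt R,
  [/\ u.1 \in V0, u.2 \in V n & z = Psi u.1 u.2].
exists (fun z => if pselect (D z) is left h then
  F (sval (cid h)).1 (sval (cid h)).2 else 0) => p y hp hy.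
case: pselect => [h|]; last by case; exists (p, y).
case: cid => -[p' y'] /= [hp' hy' e].
have [pp|pp] := eqVneq p p'; first by subst p'; rewrite (Psi_inj e).
have [-> ->] := Psi_meet hp hp' pp (V_tri hy) (V_tri hy') e.
by apply: hF => //; rewrite eq_sym.
Qed.

Definition vsum d : R := d p1 + d p2 + d p3.

Lemma vsumE d p q r : p \in V0 -> q \in V0 -> r \in V0 ->
  q != p -> r != p -> q != r -> vsum d = d p + d q + d r.
Proof.
move=> hp hq hr.
by case/V0P: hp => ->; case/V0P: hq => ->; case/V0P: hr => ->;
  rewrite ?eqxx // => _ _ _; rewrite /vsum; ring.
Qed.

(* The corner values which a function satisfying avg G = G - 1 in the interior
   of V_(n+1), with corner values d, takes on the subcell at p. *)
Definition subcorner n d p q : R :=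
  if q == p then d p else (d p + d q + vsum d) / 5 + 2 * 5 ^+ n.

(** Renormalization. The midpoint values in [subcorner] follow the rule 2/5, 2/5, 1/5 for harmonic
    functions on the gasket, plus the mean time 2 * 5^n from a midpoint to the corners (two
    crossings of mean 5^n on average). The third clause closes the induction, because the equation
    at a midpoint is the mean of two corner averages; 3/5 is the factor by which corner differences
    are renormalized. Among the final bounds, the one with 5^n / 2 controls the subcells away from
    [q0] in the last one. *)
Lemma exit_time_extension n d : exists G : pt R -> R,
  [/\ forall q, q \in V0 -> G q = d q,
      forall x, x \in V n -> x \notin V0 -> avg n G x = G x - 1,
      forall q, q \in V0 -> avg n G q =
        d q + (3 / 5) ^+ n * ((vsum d - d q) / 2 - d q) + 3 ^+ n - 1 &
   [/\ forall c, (forall q, q \in V0 -> c <= d q) ->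
        forall x, x \in V n -> c <= G x,
      forall M, (forall q, q \in V0 -> d q <= M) ->
        forall x, x \in V n -> G x <= M + 5 ^+ n / 2 &
      forall M q0, q0 \in V0 -> d q0 <= M ->
        (forall q, q \in V0 -> q != q0 -> d q <= M - 5 ^+ n) ->
        forall x, x \in V n -> G x <= M]].
Proof.
elim: n d => [|n IH] d.
  exists d; split=> //.
  - by move=> x ->.
  - move=> q hq; rewrite !expr0 mul1r.
    have [s' hs' n1] : exists2 s', s' \in V0 & s' != q.
      have [->|h] := eqVneq q p1.
        by exists p2; [exact: p2V0|rewrite eq_sym neq12].
      by exists p1; [exact: p1V0|rewrite eq_sym].
    have [s'' [hs'' n2 n3]] := third_corner hq hs' n1.
    rewrite (vsumE d hq hs' hs'' n1 n2 n3).
    have hperm : perm_eq (nb T 0 q) [:: s'; s''].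
      apply: uniq_perm; rewrite ?uniq_nb //= ?inE ?n3 //.
      move=> z; rewrite mem_nb edge0 hq andTb [in RHS]inE [in RHS]mem_seq1; apply/andP/orP => [[hz nz]|].
        move: n1 n2 n3 nz; case/V0P: hz => ->; case/V0P: hq => ->;
        case/V0P: hs' => ->; case/V0P: hs'' => ->;
        by rewrite ?eqxx //; auto.
      by case=> /eqP ->; rewrite ?hs' ?hs'' eq_sym ?n1 ?n2.
    rewrite /avg (perm_size hperm) (perm_big _ hperm) /= !big_cons big_nil.
    by field.
  - split=> // M; first by move=> h x hx; have := h x hx; lra.
    move=> q0 _ h h' x hx; have [->//|/(h' x hx)] := eqVneq x q0; lra.
have [F FP] := choice (fun p => IH (subcorner n d p)).
have hsym p q : p != q -> subcorner n d p q = subcorner n d q p.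
  move=> pq; rewrite /subcorner (negbTE pq) eq_sym (negbTE pq); congr (_ / _ + _).
  by rewrite (addrC (d p)).
have [G hG] : exists G : pt R -> R,
    forall p y, p \in V0 -> y \in V n -> G (Psi p y) = F p y.
  apply: glue => p q hp hq pq.
  by have [-> // _ _ _] := FP p; have [-> // _ _ _] := FP q; exact: hsym.
have scE p q r : p \in V0 -> q \in V0 -> r \in V0 -> q != p -> r != p -> q != r ->
    vsum (subcorner n d p) - d p =
      (4 * d p + 3 * d q + 3 * d r) / 5 + 4 * 5 ^+ n.
  move=> hp hq hr n1 n2 n3; rewrite !(vsumE _ hp hq hr n1 n2 n3).
  rewrite /subcorner eqxx (negbTE n1) (negbTE n2) (vsumE _ hp hq hr n1 n2 n3).
  by field.
have e3 : (3 / 5 : R) ^+ n * 5 ^+ n = 3 ^+ n.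
  by rewrite -exprMn mulfVK.
have others p : p \in V0 -> exists q r,
    [/\ q \in V0, r \in V0, q != p, r != p & q != r].
  move=> hp; have [s' hs' n1] : exists2 s', s' \in V0 & s' != p.
    have [->|h] := eqVneq p p1.
      by exists p2; [exact: p2V0|rewrite eq_sym neq12].
    by exists p1; [exact: p1V0|rewrite eq_sym].
  by have [s'' [hs'' n2 n3]] := third_corner hp hs' n1; exists s', s''.
exists G; split.
- move=> q hq; rewrite -{1}(Psi_fix q) hG //; last exact: V0_sub.
  by have [-> // _ _ _] := FP q; rewrite /subcorner eqxx.
- move=> x /mem_VS[p hp [y hy ->]] hn.
  have [hy0|hy0] := boolP (y \in V0); last first.
    rewrite avg_Psi //; last by left.
    rewrite hG // -(_ : avg n (F p) y = F p y - 1).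
      by apply: eq_avg => z hz /=; rewrite hG.
    by have [_ h _ _] := FP p; exact: h.
  have [yp|yp] := eqVneq y p; first by move: hn; rewrite yp Psi_fix hp.
  rewrite avg_mid // hG //.
  rewrite (_ : avg n (G \o Psi p) y = avg n (F p) y); last first.
    by apply: eq_avg => z hz /=; rewrite hG.
  rewrite (_ : avg n (G \o Psi y) p = avg n (F y) p); last first.
    by apply: eq_avg => z hz /=; rewrite hG.
  have [e1 _ -> // _] := FP p; have [_ _ -> // _] := FP y.
  rewrite e1 // (hsym y p) //.
  have [r [hr n2 n3]] := third_corner hp hy0 yp.
  have py : p != y by rewrite eq_sym.
  have ry : r != y by rewrite eq_sym.
  have pr : p != r by rewrite eq_sym.
  have := scE p y r hp hy0 hr yp n2 n3.
  have := scE y p r hy0 hp hr py ry pr.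
  rewrite [subcorner n d p y]/subcorner (negbTE yp) (vsumE d hp hy0 hr yp n2 n3).
  set A := vsum _; set B := vsum _ => hA hB.
  have {hA} -> : A = d y + ((4 * d y + 3 * d p + 3 * d r) / 5 + 4 * 5 ^+ n) by lra.
  have {hB} -> : B = d p + ((4 * d p + 3 * d y + 3 * d r) / 5 + 4 * 5 ^+ n) by lra.
  rewrite -e3; set a := (3 / 5) ^+ n; set b := 5 ^+ n.
  by field.
- move=> q hq; have [s [r [hs hr n1 n2 n3]]] := others q hq.
  rewrite -{1}(Psi_fix q) avg_Psi //; [|exact: V0_sub|by right].
  rewrite (_ : avg n (G \o Psi q) q = avg n (F q) q); last first.
    by apply: eq_avg => z hz /=; rewrite hG //.
  have [_ _ -> // _] := FP q.
  have h := scE q s r hq hs hr n1 n2 n3.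
  rewrite (_ : subcorner n d q q = d q) ?/subcorner ?eqxx //.
  rewrite -/(subcorner n d q) h (vsumE d hq hs hr n1 n2 n3) !exprS -e3.
  set a := (3 / 5) ^+ n; set b := 5 ^+ n.
  by field.
split.
- move=> c h x /mem_VS[p hp [y hy ->]]; rewrite hG //.
  have [_ _ _ [h' _ _]] := FP p; apply: h' => // q hq.
  rewrite /subcorner; case: eqP => [_|_]; first exact: h.
  have := h _ hp; have := h _ hq; have := h _ (p1V0 T); have := h _ (p2V0 T).
  have := h _ (p3V0 T); rewrite /vsum.
  have : (0 : R) <= 5 ^+ n by rewrite exprn_ge0.
  lra.
- move=> M h x /mem_VS[p hp [y hy ->]]; rewrite hG //.
  have hh : forall q, q \in V0 -> subcorner n d p q <= M + 2 * 5 ^+ n.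
    move=> q hq; have h5 : (0 : R) <= 5 ^+ n by rewrite exprn_ge0.
    rewrite /subcorner; case: eqP => [_|_]; first by have := h _ hp; lra.
    have := h _ hp; have := h _ hq; have := h _ (p1V0 T); have := h _ (p2V0 T).
    have := h _ (p3V0 T); rewrite /vsum.
    lra.
  have [_ _ _ [_ h' _]] := FP p; have := h' _ hh y hy.
  rewrite exprS; lra.
move=> M q0 hq0 h1 h2 x /mem_VS[p hp [y hy ->]]; rewrite hG //.
have h5 : (0 : R) <= 5 ^+ n by rewrite exprn_ge0.
have [pq|pq] := eqVneq p q0.
  subst q0; have [_ _ _ [_ _ h']] := FP p; apply: (h' M p) => //.
    by rewrite /subcorner eqxx.
  move=> q hq qp; have [r [hr n2 n3]] := third_corner hp hq qp.
  rewrite /subcorner (negbTE qp) (vsumE d hp hq hr qp n2 n3).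
  have := h2 _ hq qp; have := h2 _ hr n2; rewrite exprS; lra.
have hh : forall q, q \in V0 -> subcorner n d p q <= M - 5 ^+ n.
  move=> q hq; rewrite /subcorner.
  case: ifPn => [_|qp]; first by have := h2 _ hp pq; rewrite exprS; lra.
  have [r [hr n2 n3]] := third_corner hp hq qp.
  rewrite (vsumE d hp hq hr qp n2 n3).
  have := h2 _ hp pq.
  have [e|qq0] := eqVneq q q0.
    have rq0 : r != q0 by rewrite -e eq_sym.
    by have := h2 _ hr rq0; rewrite e exprS; lra.
  have : d r <= M by have [->//|/(h2 _ hr)] := eqVneq r q0; rewrite exprS; lra.
  by have := h2 _ hq qq0; rewrite exprS; lra.
have [_ _ _ [_ h' _]] := FP p; have := h' _ hh y hy; lra.
Qed.

(** The value 5^n at [p1] is the one for which the equation holds at [p1] as well: the corner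
    average is then 5^n - 3^n + 3^n - 1. Hence [G] is the mean time to reach the other two corners,
    and a crossing has mean 5^n. *)
Lemma exit_time n : exists G : pt R -> R,
  [/\ forall q, q \in V0 -> q != p1 -> G q = 0, G p1 = 5 ^+ n,
      forall x, x \in V n -> ~~ offc p1 x -> avg n G x = G x - 1 &
      forall x, x \in V n -> 0 <= G x <= 5 ^+ n].
Proof.
pose d q : R := if q == p1 then 5 ^+ n else 0.
have h5 : (0 : R) <= 5 ^+ n by rewrite exprn_ge0.
have [G [h1 h2 h3 [h4 _ h5']]] := exit_time_extension n d.
have n21 : p2 != p1 by rewrite eq_sym neq12.
have n31 : p3 != p1 by rewrite eq_sym neq13.
have hp := p1V0 T.
exists G; split.
- by move=> q hq qp; rewrite h1 // /d (negbTE qp).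
- by rewrite h1 // /d eqxx.
- move=> x hx hn; have [x0|x0] := boolP (x \in V0); last exact: h2.
  have {x0} -> : x = p1.
    by apply/eqP; move: hn; rewrite /offc /= x0 /= negbK.
  rewrite h3 // h1 // /vsum /d eqxx (negbTE n21) (negbTE n31).
  have -> : (3 / 5 : R) ^+ n * ((5 ^+ n + 0 + 0 - 5 ^+ n) / 2 - 5 ^+ n) =
    - ((3 / 5) ^+ n * 5 ^+ n) by field.
  by rewrite -exprMn mulfVK //; ring.
move=> x hx; rewrite h4 //=; last first.
  by move=> q hq; rewrite /d; case: ifP.
apply: (h5' _ p1) => //; first by rewrite /d eqxx.
by move=> q hq qp; rewrite /d (negbTE qp) subrr.
Qed.

(** The majorant (5^n - G + k) / 5^n is nonnegative, is at least 1 at the target corners, where [G]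
    vanishes, and satisfies the recursion exactly. As [G] attains its maximum 5^n at [p1], only k /
    5^n is left there. *)
Lemma crossn1_le n k : crossn n 1 k <= k%:R / 5 ^+ n.
Proof.
have [G [h1 h2 h3 h4]] := exit_time n.
have h5 : (0 : R) < 5 ^+ n by rewrite exprn_gt0.
have hp := p1V0 T.
suff H : forall x, x \in V n ->
    hit n (offc p1) (fun _ _ => 1) k x <= (5 ^+ n - G x + k%:R) / 5 ^+ n.
  by have := H p1 (V0_sub _ hp); rewrite h2 subrr add0r.
elim: k => [|k IH] x hx.
  have [b|b] := boolP (offc p1 x).
    rewrite hit_in // ler_pdivlMr // mul1r; case/andP: b => b1 b2.
    by rewrite h1 //; lra.
  rewrite hit0 // ler_pdivlMr // mul0r; have /andP[] := h4 x hx; lra.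
have [b|b] := boolP (offc p1 x).
  rewrite hit_in // ler_pdivlMr // mul1r; case/andP: b => b1 b2.
  have : (0 : R) <= k.+1%:R by [].
  by rewrite h1 //; lra.
rewrite hitS //.
apply: le_trans (_ : avg n (fun z => - (5 ^+ n)^-1 * G z +
   (5 ^+ n + k%:R) / 5 ^+ n) x <= _).
  apply: avg_le => z hz; apply: le_trans (IH z hz) _.
  by rewrite -[X in _ <= X + _]mulrC; have -> : (5 ^+ n - G z + k%:R) / 5 ^+ n =
    G z * - (5 ^+ n)^-1 + (5 ^+ n + k%:R) / 5 ^+ n by ring.
rewrite avgD avgZ avg_cst // h3 // -[k.+1%:R]natr1.
have -> : - (5 ^+ n)^-1 * (G x - 1) + (5 ^+ n + k%:R) / 5 ^+ n =
  (5 ^+ n - G x + (k%:R + 1)) / 5 ^+ n by ring.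
by [].
Qed.

(** Markov's inequality for the crossing time, whose mean is 5^n. *)
Lemma crossn1_ge n k : (2 * 5 ^ n <= k.+1)%N -> 1 / 2 <= crossn n 1 k.
Proof.
move=> hk.
have [G [h1 h2 h3 h4]] := exit_time n.
have h5 : (0 : R) < 5 ^+ n by rewrite exprn_gt0.
have hp := p1V0 T.
pose u j x := hit n (offc p1) (fun _ _ => 1) j x.
have u1 j x : x \in V n -> u j x <= 1.
  by move=> hx; apply: (@hit_bound _ T n (offc p1) _ (fun=> 1)).
(* Partial sums of the tail probabilities P(tau > i) stay below the mean of tau. *)
have H : forall j x, x \in V n -> \sum_(i < j) (1 - u i x) <= G x.
  elim=> [|j IH] x hx.
    by rewrite big_ord0; case/andP: (h4 x hx).
  have [b|b] := boolP (offc p1 x).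
    rewrite big1; first by case/andP: (h4 x hx).
    by move=> i _; rewrite /u hit_in // subrr.
  rewrite big_ord_recl /= {1}/u hit0 // subr0.
  have -> : \sum_(i < j) (1 - u (bump 0 i) x) =
      avg n (fun z => \sum_(i < j) (1 - u i z)) x.
    transitivity (\sum_(i < j) avg n (fun z => 1 - u i z) x).
      apply: eq_bigr => i _; rewrite /bump /= add1n {1}/u hitS //.
      transitivity (avg n (fun z => 1 + -1 * u i z) x).
        by rewrite avgD avgZ avg_cst // mulN1r.
      by apply: eq_avg => z _; rewrite mulN1r.
    rewrite /avg -mulr_suml; congr (_ / _).
    by rewrite exchange_big.
  rewrite -lerBrDl -h3 //; exact: avg_le.
have := H k.+1 p1 (V0_sub _ hp); rewrite h2.
have hs : k.+1%:R * (1 - crossn n 1 k) <= \sum_(i < k.+1) (1 - u i p1).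
  rewrite mulr_natl -{1}[k.+1]card_ord -sumr_const; apply: ler_sum => i _.
  by rewrite lerB // /u; apply: (@crossn_nondec_le _ T n 1 i k); rewrite -ltnS.
move=> /(le_trans hs) hG.
have hk' : 2 * 5 ^+ n <= (k.+1%:R : R).
  by rewrite -natrX -natrM ler_nat.
have c1 : crossn n 1 k <= 1 by exact: u1 (V0_sub _ hp).
have : 2 * 5 ^+ n * (1 - crossn n 1 k) <= 5 ^+ n.
  apply: le_trans hG; rewrite ler_wpM2r //; lra.
rewrite mulrAC -ler_pdivlMr // divff ?gt_eqF //; lra.
Qed.

(** Each of the [l] crossings is granted 2 * 5^n steps, in which it succeeds with probability at
    least 1/2. *)
Lemma crossn_ge n l k : (l * (2 * 5 ^ n) <= k)%N -> (1 / 2) ^+ l <= crossn n l k.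
Proof.
(* A crossing finished within [t] of the [t + k] steps leaves at least [k] steps to [W]. *)
have H : forall W t k x, (forall j, 0 <= W j) -> (forall i j, (i <= j)%N -> W i <= W j) ->
    W k * hit n (offc p1) (fun _ _ => 1) t x <= hit n (offc p1) (fun=> W) (t + k) x.
  move=> W t j x W0 Wn; elim: t x => [|t IH] x.
    have [b|b] := boolP (offc p1 x); first by rewrite !hit_in // mulr1.
    by rewrite hit0 // mulr0; apply: hit_ge0.
  have [b|b] := boolP (offc p1 x).
    by rewrite !hit_in // mulr1 Wn // leq_addl.
  by rewrite addSn !hitS // -avgZ; exact: avg_le.
elim: l k => [|l IH] k; first by rewrite expr0.
rewrite mulSn => hk.
have hk2 : (l * (2 * 5 ^ n) <= k - 2 * 5 ^ n)%N.
  by rewrite leq_subRL ?(leq_trans _ hk) // leq_addr.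
have -> : k = (2 * 5 ^ n + (k - 2 * 5 ^ n))%N.
  by rewrite subnKC // (leq_trans _ hk) // leq_addr.
rewrite exprSr.
apply: le_trans (H (crossn n l) (2 * 5 ^ n)%N _ p1 _ _).
- apply: ler_pM; rewrite ?exprn_ge0 ?divr_ge0 //; first exact: IH.
  exact: (@crossn1_ge n (2 * 5 ^ n)).
- by move=> j; exact: crossn_ge0.
by move=> i j; exact: crossn_nondec_le.
Qed.

End CrossingTime.

(** * Poissonization *)

Section PoissonSeries.
Variable R : realType.
Implicit Types (lam c l : R) (a b : nat -> R).

Definition pois lam (k : nat) : R := expR (- lam) * lam ^+ k / (k`!)%:R.

(* l = E[a(N)] for a Poisson variable N of mean lam *)
Definition pois_mean lam a l : Prop :=
  series (fun k => pois lam k * a k) @ \oo --> l.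

Lemma pois_ge0 lam k : 0 <= lam -> 0 <= pois lam k.
Proof.
by move=> h; rewrite /pois divr_ge0 // mulr_ge0 ?expR_ge0 // exprn_ge0.
Qed.

Lemma pois_mean_le lam a b l l' : 0 <= lam -> (forall k, a k <= b k) ->
  pois_mean lam a l -> pois_mean lam b l' -> l <= l'.
Proof.
move=> h0 h ha hb; apply: (ler_cvg_to ha hb); apply: nearW => n.
by apply: ler_sum => k _; rewrite ler_wpM2l // pois_ge0.
Qed.

Lemma pois_meanD lam a b l l' : pois_mean lam a l -> pois_mean lam b l' ->
  pois_mean lam (fun k => a k + b k) (l + l').
Proof.
move=> ha hb; rewrite /pois_mean.
have -> : series (fun k => pois lam k * (a k + b k)) =
    (fun n => series (fun k => pois lam k * a k) n
            + series (fun k => pois lam k * b k) n).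
  by apply/funext => n; rewrite /series /= -big_split; apply: eq_bigr => k _;
    rewrite mulrDr.
exact: cvgD ha hb.
Qed.

Lemma pois_meanZ lam a c l : pois_mean lam a l ->
  pois_mean lam (fun k => c * a k) (c * l).
Proof.
move=> ha; rewrite /pois_mean.
have -> : series (fun k => pois lam k * (c * a k)) =
    (fun n => c * series (fun k => pois lam k * a k) n).
  by apply/funext => n; rewrite /series /= mulr_sumr; apply: eq_bigr => k _;
    rewrite mulrCA.
exact: cvgMr ha.
Qed.
Arguments pois_meanZ {lam a} c {l}.

Lemma pois_mean_geo lam c : pois_mean lam (fun k => c ^+ k) (expR (lam * c - lam)).
Proof.
rewrite /pois_mean addrC expRD.
have -> : series (fun k => pois lam k * c ^+ k) =
    (fun n => expR (- lam) * series (exp_coeff (lam * c)) n).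
  apply/funext => n; rewrite /series /= mulr_sumr; apply: eq_bigr => k _.
  by rewrite /pois /exp_coeff /= exprMn; ring.
apply: cvgMr; exact: is_cvg_series_exp_coeff.
Qed.
Arguments pois_mean_geo : clear implicits.

Lemma pois_mean1 lam : pois_mean lam (fun=> 1) 1.
Proof.
have := pois_mean_geo lam 1; rewrite mulr1 subrr expR0.
by rewrite (_ : (fun k => 1 ^+ k) = (fun=> 1)) //; apply/funext => k; rewrite expr1n.
Qed.
Arguments pois_mean1 : clear implicits.

Lemma pois_mean_ex lam a : 0 <= lam -> (forall k, 0 <= a k <= 1) ->
  pois_mean lam a (limn (series (fun k => pois lam k * a k))).
Proof.
move=> h0 ha; apply: (@series_le_cvg _ _ (fun k => pois lam k * 1)).
- by move=> k; rewrite mulr_ge0 ?pois_ge0 //; case/andP: (ha k).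
- by move=> k; rewrite mulr_ge0 ?pois_ge0.
- by move=> k; rewrite ler_wpM2l ?pois_ge0 //; case/andP: (ha k).
by apply/cvg_ex; exists 1; exact: pois_mean1.
Qed.

Lemma pois_mean_sum lam (I : Type) (s : seq I) (F : I -> nat -> R) (L : I -> R) :
  (forall i, pois_mean lam (F i) (L i)) ->
  pois_mean lam (fun k => \sum_(i <- s) F i k) (\sum_(i <- s) L i).
Proof.
move=> h; elim: s => [|i s IH].
  have h0 := pois_meanZ 0 (pois_mean1 lam); rewrite mul0r in h0.
  rewrite big_nil [X in pois_mean _ X](_ : _ = (fun=> 0)) //.
  by apply/funext => k; rewrite big_nil.
rewrite big_cons [X in pois_mean _ X](_ : _ = (fun k => F i k + \sum_(j <- s) F j k)).
  exact: pois_meanD.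
by apply/funext => k; rewrite big_cons.
Qed.

(** Chernoff bound: for k > K one has b_k <= 1 <= 2^(k - K), and the mean of 2^N is exp(lam). *)
Lemma pois_mean_ratio lam a b l l' c K : 0 <= lam -> 0 <= c ->
  (forall k, 0 <= a k) -> (forall k, b k <= 1) ->
  (forall k, (k <= K)%N -> b k <= c * a k) ->
  pois_mean lam a l -> pois_mean lam b l' ->
  l' <= c * l + expR lam / 2 ^+ K.
Proof.
move=> h0 c0 a0 b1 hab ha hb.
have h := pois_meanD (pois_meanZ c ha) (pois_meanZ (2 ^+ K)^-1 (pois_mean_geo lam 2)).
rewrite (_ : lam * 2 - lam = lam) in h; last by ring.
rewrite (mulrC _^-1) in h; apply: pois_mean_le h0 _ hb h => k.
have e2 : 0 < (2 : R) ^+ K by rewrite exprn_gt0.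
have [hk|hk] := leqP k K.
  by rewrite (le_trans (hab _ hk)) // lerDl mulr_ge0 // ?invr_ge0 ?exprn_ge0.
rewrite (le_trans (b1 k)) // (le_trans (_ : 1 <= (2 ^+ K)^-1 * 2 ^+ k)) //.
  by rewrite mulrC ler_pdivlMr // mul1r ler_weXn2l ?ler1n // ltnW.
by rewrite lerDr mulr_ge0.
Qed.

(** Two-sided Chernoff bound: the indicators of k > K2 and k < K1 are at most 2^(k - K2) and 2^(K1 -
    k), and the means of 2^N and 2^-N are exp(lam) and exp(-lam/2). *)
Lemma pois_mean_lower lam a l c K1 K2 : 0 <= lam -> 0 <= c ->
  (forall k, 0 <= a k) ->
  (forall k, (K1 <= k)%N -> (k <= K2)%N -> c <= a k) ->
  pois_mean lam a l ->
  c * (1 - expR lam / 2 ^+ K2 - 2 ^+ K1 * expR (- (lam / 2))) <= l.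
Proof.
move=> h0 c0 a0 hac ha.
have h2 := pois_meanZ (- (2 ^+ K2)^-1) (pois_mean_geo lam 2).
have h3 := pois_meanZ (- 2 ^+ K1) (pois_mean_geo lam 2^-1).
have h := pois_meanZ c (pois_meanD (pois_meanD (pois_mean1 lam) h2) h3).
rewrite (_ : lam * 2 - lam = lam) in h; last by ring.
rewrite (_ : lam * 2^-1 - lam = - (lam / 2)) in h; last by field.
rewrite !mulNr in h.
rewrite [expR lam / _]mulrC; apply: pois_mean_le h0 _ h ha => k /=.
have e2 j : 0 < (2 : R) ^+ j by rewrite exprn_gt0.
have t2 : 0 <= (2 ^+ K2)^-1 * (2 : R) ^+ k by rewrite mulr_ge0 ?invr_ge0 // ltW.
have t3 : 0 <= (2 : R) ^+ K1 * 2^-1 ^+ k by rewrite mulr_ge0 // ?ltW // exprn_gt0 ?invr_gt0.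
have neg : forall x : R, x <= 0 -> c * x <= a k.
  by move=> x hx; apply: le_trans (a0 k); exact: mulr_ge0_le0.
have [hk1|hk1] := leqP K1 k; last first.
  apply: neg.
  have : 1 <= (2 : R) ^+ K1 * 2^-1 ^+ k.
    by rewrite exprVn ler_pdivlMr // mul1r ler_weXn2l ?ler1n // ltnW.
  lra.
have [hk2|hk2] := leqP k K2.
  rewrite (le_trans _ (hac k hk1 hk2)) // -[leRHS]mulr1 ler_wpM2l //; lra.
apply: neg.
have : 1 <= (2 ^+ K2)^-1 * (2 : R) ^+ k.
  by rewrite mulrC ler_pdivlMr // mul1r ler_weXn2l ?ler1n // ltnW.
lra.
Qed.

End PoissonSeries.

(** * The walk semigroup and its Poissonization *)

Section Heat.
Variables (R : realType) (T : equilateral R).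
Local Notation p1 := (pp1 T).
Local Notation p2 := (pp2 T).
Local Notation p3 := (pp3 T).
Local Notation V := (V T).
Local Notation avg := (avg T).

Definition heat n (f : pt R -> R) (k : nat) : pt R -> R := iter k (avg n) f.

Lemma trans_avg n (g : pt R -> R) x :
  \sum_(z <- V n) Defs.trans p1 p2 p3 n x z * g z = avg n g x.
Proof.
rewrite /Defs.trans /avg /nb big_filter mulr_suml [RHS]big_mkcond /=.
apply: eq_bigr => z _; rewrite /edge size_filter -/(deg p1 p2 p3 n x).
by case: (nbr p1 p2 p3 n x z); rewrite ?mul1r ?mul0r // mulrC.
Qed.

Lemma transk_heat n k (f : pt R -> R) x : x \in V n ->
  \sum_(y <- V n) transk p1 p2 p3 n k x y * f y = heat n f k x.
Proof.
elim: k x => [|k IH] x hx.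
  rewrite (bigD1_seq x) ?uniq_V //= eqxx mul1r big1 ?addr0 // => y yx.
  by rewrite eq_sym (negbTE yx) mul0r.
rewrite /heat iterS -/(heat n f k) -trans_avg.
under eq_bigr do rewrite /= mulr_suml.
rewrite exchange_big /= [LHS]big_seq [RHS]big_seq; apply: eq_bigr => z hz.
by rewrite -IH // mulr_sumr; apply: eq_bigr => y _; rewrite mulrA.
Qed.

Lemma heat_ge0 n f k x : (forall z, 0 <= f z) -> 0 <= heat n f k x.
Proof. by move=> h; elim: k x => [//|k IH] x; exact: avg_ge0. Qed.

Lemma heat_le1 n f k x : (forall z, f z <= 1) -> x \in V n -> heat n f k x <= 1.
Proof.
move=> h; elim: k x => [//|k IH] x hx.
by rewrite -[leRHS](avg_cst 1 hx); exact: avg_le.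
Qed.

(** The number of jumps up to time [t] is Poisson of mean 5^n t. The finite sum over endpoints is
    exchanged with the series over jumps, each series converging because transition probabilities
    lie in [0, 1]. *)
Lemma rwE_heat n x (t : R) f : x \in V n -> 0 <= t -> (forall z, 0 <= f z <= 1) ->
  pois_mean ((5 ^ n)%:R * t) (fun k => heat n f k x) (rwE p1 p2 p3 n x [:: (t, f)]).
Proof.
move=> hx t0 hf.
have l0 : (0 : R) <= (5 ^ n)%:R * t by rewrite mulr_ge0.
have -> : rwE p1 p2 p3 n x [:: (t, f)] =
    \sum_(y <- V n) f y * rwp p1 p2 p3 n t x y.
  by rewrite /=; apply: eq_bigr => y _; rewrite mulr1 mulrC.
rewrite [X in pois_mean _ X](_ : _ =
    (fun k => \sum_(y <- V n) f y * transk p1 p2 p3 n k x y)); last first.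
  apply/funext => k; rewrite -transk_heat //.
  by apply: eq_bigr => y _; rewrite mulrC.
rewrite big_seq; rewrite [X in pois_mean _ X](_ : _ =
    (fun k => \sum_(y <- V n | y \in V n) f y * transk p1 p2 p3 n k x y)); last first.
  by apply/funext => k; rewrite big_seq.
rewrite -big_filter [X in pois_mean _ X](_ : _ =
   (fun k => \sum_(y <- [seq y <- V n | y \in V n]) f y * transk p1 p2 p3 n k x y)); last first.
  by apply/funext => k; rewrite big_filter.
apply: pois_mean_sum => y; apply: pois_meanZ; apply: pois_mean_ex => // k.
have [hy|hy] := boolP (y \in V n).
  have -> : transk p1 p2 p3 n k x y = heat n (fun z => (z == y)%:R) k x.
    rewrite -transk_heat // (bigD1_seq y) ?uniq_V //= eqxx mulr1 big1 ?addr0 //.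
    by move=> z /negbTE ->; rewrite mulr0.
  rewrite heat_ge0 //=; apply: heat_le1 => // z.
  by case: (_ == _).
have -> : transk p1 p2 p3 n k x y = 0.
  elim: k x hx => [|k IH] x hx /=.
    by case: eqP => // e; move: hy; rewrite -e hx.
  rewrite big_seq big1 // => z hz; by rewrite IH ?mulr0.
by rewrite lexx ler01.
Qed.

End Heat.

(** * Comparison of the random walks *)

Section DiscreteComparison.
Variables (R : realType) (T : equilateral R).
Local Notation p1 := (pp1 T).
Local Notation p2 := (pp2 T).
Local Notation p3 := (pp3 T).
Local Notation V0 := (V0 T).
Local Notation V := (V T).
Local Notation bc := (bc T).
Local Notation tri := (tri T).
Local Notation edge := (edge T).
Local Notation avg := (avg T).
Local Notation heat := (heat T).
Local Notation word := (word T).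
Local Notation reach := (reach T).
Local Notation cell_at := (cell_at T).
Local Notation crossn := (crossn T).

Lemma bc_Psiw_diff i w x y :
  bc i (Psiw w x) - bc i (Psiw w y) = (bc i x - bc i y) / 2 ^+ size w.
Proof.
elim: w => [|p w IH] /=; first by rewrite expr0 divr1.
by rewrite exprS [2 * _]mulrC invfM mulrA -IH !bc_Psi; field.
Qed.

Lemma bc_cell_close i w x y : i \in V0 -> tri x -> tri y ->
  `|bc i (Psiw w x) - bc i (Psiw w y)| <= (2 ^+ size w)^-1.
Proof.
move=> hi hx hy; rewrite bc_Psiw_diff normrM [X in _ * X]ger0_norm; last first.
  by rewrite invr_ge0 exprn_ge0.
rewrite ler_piMl ?invr_ge0 ?exprn_ge0 // ler_norml.
have := hx _ hi; have := hy _ hi; have := bc_le1 hi hx; have := bc_le1 hi hy.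
by move=> *; apply/andP; split; lra.
Qed.

Lemma edge_bc i m u v : i \in V0 -> edge m u v ->
  `|bc i u - bc i v| <= (2 ^+ m)^-1.
Proof.
move=> hi /edge_cell[w [q [q' [[hw <- hq <-] [_ _ hq' <-] _]]]].
by apply: bc_cell_close => //; exact: tri_corner.
Qed.

Lemma reach_trans m K K' u v w : reach m K u v -> reach m K' v w ->
  reach m (K + K') u w.
Proof.
elim: K u => [|K IH] u /=; first by move=> ->.
by case=> u' e h h'; exists u' => //; exact: IH.
Qed.

Lemma reach_sym m K u v : reach m K u v -> reach m K v u.
Proof.
elim: K u => [|K IH] u; first by move=> ->.
case=> u' e /IH h; rewrite -[K.+1]addn1; apply: reach_trans h _.
by exists u => //; rewrite edge_sym.
Qed.

Lemma edge_Psiw w m u v : word w -> edge m u v ->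
  edge (size w + m) (Psiw w u) (Psiw w v).
Proof.
elim: w => [//|p w IH] /= /andP[hp hw] h; apply/edgeS; exists p => //.
by exists (Psiw w u), (Psiw w v); first exact: IH.
Qed.

Lemma reach_Psiw w m K u v : word w -> reach m K u v ->
  reach (size w + m) K (Psiw w u) (Psiw w v).
Proof.
move=> hw; elim: K u => [|K IH] u /=; first by move=> ->.
by case=> u' e /IH h; exists (Psiw w u') => //; exact: edge_Psiw.
Qed.

(* Sliding from a vertex towards the corner [i] along one of the edges that are
   parallel to the two sides through [i]. *)
Lemma slide n i v : i \in V0 -> v \in V n -> v != i ->
  exists2 v', edge n v v' & bc i v' = bc i v + (2 ^+ n)^-1.
Proof.
move=> hi; elim: n v => [|n IH] v.
  move=> hv vi; exists i; first by rewrite edge0 hv hi.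
  by rewrite bc_corner_self // bc_corner // eq_sym (negbTE vi) /= expr0 invr1 add0r.
case/mem_VS => j hj [u hu ->] hn.
have step k y : k \in V0 -> y \in V n -> y != i ->
    exists2 v', edge n.+1 (Psi k y) v' & bc i v' = bc i (Psi k y) + (2 ^+ n.+1)^-1.
  move=> hk hy hyi; have [y' e h] := IH y hy hyi.
  exists (Psi k y'); first by apply/edgeS; exists k => //; exists y, y'.
  by rewrite !bc_Psi h exprS invfM; field; rewrite expf_neq0.
have [ui|ui] := eqVneq u i; last exact: step.
rewrite ui Psi_mid; apply: step => //; first exact: V0_sub.
by apply: contra hn => /eqP ->; rewrite ui Psi_fix.
Qed.

Lemma reach_corner n i v : i \in V0 -> v \in V n ->
  exists2 K, reach n K v i & K%:R = 2 ^+ n * (1 - bc i v).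
Proof.
move=> hi; have e2 : (2 : R) ^+ n != 0 by rewrite expf_neq0.
have H : forall K v, v \in V n -> 2 ^+ n * (1 - bc i v) <= K%:R ->
    exists2 K', reach n K' v i & K'%:R = 2 ^+ n * (1 - bc i v).
  elim=> [|K IH] u hu hK.
    have e : u = i.
      apply: (bc1_corner hi (V_tri hu)).
      by move: hK; rewrite pmulr_rle0 ?exprn_gt0 // subr_le0.
    by exists 0%N => //; rewrite e bc_corner_self // subrr mulr0.
  have [->|ui] := eqVneq u i.
    by exists 0%N => //; rewrite bc_corner_self // subrr mulr0.
  have [u' he hb] := slide hi hu ui.
  have [_ hu'] := edge_mem he.
  have eq1 : 2 ^+ n * (1 - bc i u') = 2 ^+ n * (1 - bc i u) - 1.
    by rewrite hb; field; rewrite e2.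
  have [|K' hr hK'] := IH u' hu'; first by rewrite eq1; move: hK; rewrite -natr1; lra.
  exists K'.+1; first by exists u'.
  by rewrite -natr1 hK' eq1 subrK.
move=> hv; apply: (H (2 ^ n)%N) => //; rewrite natrX ler_piMr ?exprn_ge0 //.
by have := V_tri hv hi; lra.
Qed.

(** The path passes through the corner [i], so it is nearly shortest only if one endpoint is close
    to [i]. *)
Lemma reach_any n i v h : i \in V0 -> v \in V n -> h \in V n ->
  exists2 K, reach n K v h & K%:R = 2 ^+ n * (2 - bc i v - bc i h).
Proof.
move=> hi hv hh; have [K hK eK] := reach_corner hi hv.
have [K' hK' eK'] := reach_corner hi hh.
exists (K + K')%N; first exact: reach_trans hK (reach_sym hK').
by rewrite natrD eK eK'; ring.
Qed.

Lemma heatS n f k : heat n f k.+1 = avg n (heat n f k).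
Proof. by []. Qed.

Lemma heat_refl n f k a b x : a \in V0 -> b \in V0 ->
  heat n (f \o refl a b) k x = heat n f k (refl a b x).
Proof.
move=> ha hb; elim: k x => [//|k IH] x.
by rewrite !heatS avg_refl //; apply: eq_avg => z _ /=; exact: IH.
Qed.

Lemma heatD n f g k x :
  heat n (fun z => f z + g z) k x = heat n f k x + heat n g k x.
Proof.
elim: k x => [//|k IH] x; rewrite !heatS -avgD.
by apply: eq_avg => z _; exact: IH.
Qed.

Lemma Psiw_refl (w : seq (pt R)) a b z :
  refl a b (Psiw w z) = Psiw (map (refl a b) w) (refl a b z).
Proof. by elim: w => [//|p w IH] /=; rewrite refl_Psi IH. Qed.

Lemma word_refl (w : seq (pt R)) a b : a \in V0 -> b \in V0 -> word w -> word (map (refl a b) w).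
Proof.
move=> ha hb /allP h; apply/allP => z /mapP[y hy ->]; apply: refl_V0 => //.
exact: h.
Qed.

(* Reflecting the walk started at a point h of the axis shows that the two cells
   at h carry equal mass. *)
Lemma heat_axis_lower m n w q h (f : pt R -> R) k :
  cell_at m h w q -> refl p1 p2 h = h -> map (refl p1 p2) w != w ->
  (forall z, 0 <= f z) -> (forall y, y \in V n -> 1 <= f (Psiw w y)) ->
  (1 - crossn n 1 k) / 2 <= heat (m + n) f k h.
Proof.
move=> cw hh hne f0 f1.
have h1 := p1V0 T; have h2 := p2V0 T.
have hv : h \in V m.
  by case: cw => hw <- hq <-; rewrite -[size w]addn0; exact: Psiw_V.
have cw' : cell_at m h (map (refl p1 p2) w) (refl p1 p2 q).
  case: cw => hw sw hq e; split.
  - exact: word_refl.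
  - by rewrite size_map.
  - exact: refl_V0.
  - by rewrite -Psiw_refl e hh.
(* The word [w] and its mirror image are distinct cells at h, and there are at most two. *)
have cells w0 q0 : cell_at m h w0 q0 -> w0 = w \/ w0 = map (refl p1 p2) w.
  have [w1 [q1 [w2 [q2 [_ _ _ hu]]]]] := vertex_cells hv.
  move=> c0; case: (hu _ _ c0) => -[e0 _]; case: (hu _ _ cw) => -[e1 _];
  case: (hu _ _ cw') => -[e2 _];
  by first [left; congruence | right; congruence | case/eqP: hne; congruence].
pose F z := f z + (f \o refl p1 p2) z.
(* The symmetrized function [F] is at least 1 on the whole star of h, so the deficit [U] can appear
   at h only after a crossing: [star_upper] applies with [W = 1]. *)
pose U k' x := 1 - heat (m + n) F k' x.
have F0 z : 0 <= F z by rewrite addr_ge0 // f0.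
have eF : heat (m + n) F k h = 2 * heat (m + n) f k h.
  by rewrite heatD heat_refl // hh; ring.
suff : U k h <= crossn n 1 k by rewrite /U eF; lra.
apply: (@star_upper _ T m n h U (fun=> 1)) => //.
- move=> j x hx; rewrite /U heatS.
  have -> : avg (m + n) (fun z => 1 - heat (m + n) F j z) x =
      1 - avg (m + n) (heat (m + n) F j) x; last by [].
  transitivity (avg (m + n) (fun z => 1 + -1 * heat (m + n) F j z) x).
    by apply: eq_avg => z _; rewrite mulN1r.
  by rewrite avgD avgZ avg_cst // mulN1r.
- move=> w0 q0 /cells[] -> y hy; rewrite /U /= subr_le0 /F.
    by rewrite (le_trans (f1 y hy)) // lerDl f0.
  rewrite /= Psiw_refl mapK; last exact: (reflK h1 h2).
  apply: le_trans (f1 _ (refl_V h1 h2 hy)) _.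
  by rewrite lerDr f0.
by move=> w0 q0 q' _ _ _ j; rewrite /U lerBlDr lerDl; exact: heat_ge0.
Qed.

Lemma heat_axis_lower4 m n w q h (f : pt R -> R) k :
  cell_at m h w q -> refl p1 p2 h = h -> map (refl p1 p2) w != w ->
  (forall z, 0 <= f z) -> (forall y, y \in V n -> 1 <= f (Psiw w y)) ->
  (k%:R : R) / 5 ^+ n <= 1 / 2 -> 1 / 4 <= heat (m + n) f k h.
Proof.
move=> cw hh hne f0 f1 hk; apply: le_trans (heat_axis_lower k cw hh hne f0 f1).
by have := crossn1_le T n k; lra.
Qed.

Lemma heat_lower m n w h (f : pt R -> R) K l :
  word w -> size w = m -> (forall z, 0 <= f z) ->
  (forall k, (k <= K)%N -> 1 / 4 <= heat (m + n) f k h) ->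
  (forall q, q \in V0 -> exists2 l', (l' <= l)%N & reach m l' (Psiw w q) h) ->
  forall k y, (k <= K)%N -> y \in V n ->
    1 / 4 ^+ l.+1 * crossn n l.+1 k <= heat (m + n) f k (Psiw w y).
Proof.
move=> hw sw f0 near hr k y hk hy.
have := @cell_reach_lower _ T m n w (heat (m + n) f) (1 / 4) K l h hw sw.
move=> /(_ _ _ _ near hr k y hk hy) H.
apply: le_trans (H _ _ _) => //.
- by apply: ler_wpM2r; [exact: crossn_ge0|rewrite exprS invfM mulrA].
- by move=> j x; exact: heat_ge0.
Qed.

(** A continuous function equal to 1 on the strip where [bc i] is within 2^-m of its value at [h],
    hence on the gasket inside any level-[m] cell with vertex [h], and 0 beyond twice this width. It
    depends on one coordinate only, so that distance to its support can be read off [bc i]. *)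
Definition cutoff m i h (z : pt R) : R :=
  Num.min 1 (Num.max 0 (2 - 2 ^+ m * `|bc i z - bc i h|)).

Lemma cutoff01 m i h z : 0 <= cutoff m i h z <= 1.
Proof. by rewrite /cutoff le_min ler01 le_max lexx ge_min lexx. Qed.

Lemma cutoff_eq0 m i h z : 2 <= 2 ^+ m * `|bc i z - bc i h| -> cutoff m i h z = 0.
Proof.
move=> hz; rewrite /cutoff; have -> : Num.max 0 (2 - 2 ^+ m * `|bc i z - bc i h|) = 0 :> R.
  by apply/max_idPl; lra.
by apply/min_idPr.
Qed.

Lemma cutoff_eq1 m i h z : 2 ^+ m * `|bc i z - bc i h| <= 1 -> cutoff m i h z = 1.
Proof.
by move=> hz; rewrite /cutoff; apply/min_idPl; rewrite le_max; apply/orP; right; lra.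
Qed.

Lemma heat_cutoff_upper m n i h w l b : i \in V0 -> word w -> size w = m ->
  (0 < l)%N -> tri b ->
  l%:R + 3 <= 2 ^+ m * `|bc i (Psiw w b) - bc i h| ->
  forall k y, y \in V n -> heat (m + n) (cutoff m i h) k (Psiw w y) <= crossn n l k.
Proof.
move=> hi hw sw l0 hb hfar.
have e2 : 0 < (2 : R) ^+ m by rewrite exprn_gt0.
(* The shift 2 is the half-width of the support. Where [g] is at least 1 at a corner, the scaled
   distance is at least 3 there and at least 2 on the whole cell. The margin [l + 3] in the
   hypothesis is this 2 plus 1 for passing from [b] to the corners of its cell. *)
pose g z := 2 ^+ m * `|bc i z - bc i h| - 2.
have close u v : `|bc i u - bc i v| <= (2 ^+ m)^-1 -> g u <= g v + 1.
  move=> huv; rewrite /g.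
  have : 2 ^+ m * `|bc i u - bc i h| <= 2 ^+ m * `|bc i v - bc i h| + 1.
    have e1 : 1 = 2 ^+ m * (2 ^+ m)^-1 :> R by rewrite divff ?gt_eqF.
    rewrite [X in _ <= _ + X]e1 -mulrDr ler_wpM2l ?(ltW e2) //.
    have := ler_normD (bc i u - bc i v) (bc i v - bc i h).
    by rewrite addrA subrK; move: huv; lra.
  lra.
apply: (@cell_far_upper _ T m n w (heat (m + n) (cutoff m i h)) g) => //.
- by move=> k x hx; apply: heat_le1 => // z; case/andP: (cutoff01 m i h z).
- by move=> u v he; apply: close; exact: edge_bc.
- move=> w0 q hw0 sw0 hq hg y hy; rewrite /= cutoff_eq0 //.
  have : g (Psiw w0 q) <= g (Psiw w0 y) + 1.
    apply: close; rewrite -sw0; apply: bc_cell_close => //.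
      exact: tri_corner.
    exact: V_tri hy.
  move: hg; rewrite /g; lra.
move=> q hq; have : g (Psiw w b) <= g (Psiw w q) + 1.
  apply: close; rewrite -sw; apply: bc_cell_close => //.
  exact: tri_corner.
rewrite {1}/g; lra.
Qed.

(* The crossing-number comparison: to come near h, the walk from the cell of b
   needs one level-m crossing more than the walk from the cell of a. *)
Lemma heat_ratio m n i h w q wa wb l b (f : pt R -> R) K :
  cell_at m h w q -> refl p1 p2 h = h -> map (refl p1 p2) w != w ->
  (forall z, 0 <= f z) -> (forall y, y \in V n -> 1 <= f (Psiw w y)) ->
  word wa -> size wa = m ->
  (forall q, q \in V0 -> exists2 l', (l' <= l)%N & reach m l' (Psiw wa q) h) ->
  i \in V0 -> word wb -> size wb = m -> tri b ->
  l%:R + 5 <= 2 ^+ m * `|bc i (Psiw wb b) - bc i h| ->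
  (K%:R : R) / 5 ^+ n <= 1 / 2 ->
  forall k y y', (k <= K)%N -> y \in V n -> y' \in V n ->
    heat (m + n) (cutoff m i h) k (Psiw wb y') <=
    K%:R / 5 ^+ n * 4 ^+ l.+1 * heat (m + n) f k (Psiw wa y).
Proof.
move=> cw hh hne f0 f1 hwa swa hr hi hwb swb hb hfar hK k y y' hk hy hy'.
have mono j : (j <= K)%N -> j%:R / 5 ^+ n <= K%:R / 5 ^+ n :> R.
  by move=> hj; rewrite ler_wpM2r ?invr_ge0 ?exprn_ge0 // ler_nat.
have low : 1 / 4 ^+ l.+1 * crossn n l.+1 k <= heat (m + n) f k (Psiw wa y).
  apply: (@heat_lower m n wa h f K l) => // j hj.
  apply: (heat_axis_lower4 cw hh hne f0 f1).
  exact: le_trans (mono j hj) hK.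
(* The margin l + 5 is (l + 2) + 3: the walk from the cell of [a] needs at most [l] edges and one
   exit from its cell, and the walk from the cell of [b] must need one crossing more than that. *)
have up : heat (m + n) (cutoff m i h) k (Psiw wb y') <= crossn n l.+2 k.
  apply: (@heat_cutoff_upper m n i h wb l.+2 b) => //.
  by apply: le_trans hfar; rewrite -!natr1; lra.
rewrite (le_trans up) // (le_trans (crossn_split _ _ _ _)) //.
rewrite -mulrA ler_pM ?crossn_ge0 //.
  exact: le_trans (crossn1_le T n k) (mono k hk).
by move: low; rewrite mulrC mulrA mulr1 ler_pdivrMr ?exprn_gt0 // mulrC.
Qed.

(** The constant 8 is 4 * 2: each crossing costs 4 for its direction and 2 for being completed in
    time. *)
Lemma heat_positive m n w h (f : pt R -> R) K l :
  word w -> size w = m -> (forall z, 0 <= f z) ->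
  (forall k, (k <= K)%N -> 1 / 4 <= heat (m + n) f k h) ->
  (forall q, q \in V0 -> exists2 l', (l' <= l)%N & reach m l' (Psiw w q) h) ->
  forall k y, (l.+1 * (2 * 5 ^ n) <= k)%N -> (k <= K)%N -> y \in V n ->
    1 / 8 ^+ l.+1 <= heat (m + n) f k (Psiw w y).
Proof.
move=> hw sw f0 near hr k y hk1 hk2 hy.
apply: le_trans (heat_lower hw sw f0 near hr hk2 hy).
have -> : (1 : R) / 8 ^+ l.+1 = 1 / 4 ^+ l.+1 * (1 / 2) ^+ l.+1.
  have -> : (8 : R) = 4 * 2 by ring.
  by rewrite exprMn !div1r invfM exprVn.
by rewrite ler_wpM2l ?divr_ge0 ?exprn_ge0 // crossn_ge.
Qed.

End DiscreteComparison.

(** * Geometry of the gasket *)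

Section PlaneConvergence.
Variable R : realType.
Implicit Types (x y z : pt R) (A : set (pt R)) (f : pt R -> R).

Lemma Psiw_diff (w : seq (pt R)) x y :
  (Psiw w x).1 - (Psiw w y).1 = (x.1 - y.1) / 2 ^+ size w /\
  (Psiw w x).2 - (Psiw w y).2 = (x.2 - y.2) / 2 ^+ size w.
Proof.
elim: w => [|p w [IH1 IH2]] /=; first by rewrite expr0 !divr1.
rewrite exprS [2 * _]mulrC invfM !mulrA -IH1 -IH2.
by split; field.
Qed.

Lemma pow2_small (e : R) : 0 < e -> exists n, (2 ^+ n)^-1 < e.
Proof.
move=> e0; exists (Num.truncn e^-1).+1.
rewrite invf_plt ?posrE ?exprn_gt0 //.
apply: lt_trans (_ : (Num.truncn e^-1).+1%:R < _).
  by rewrite truncnS_gt.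
by rewrite -natrX ltr_nat ltn_expl.
Qed.

Lemma cvg_plane (u : nat -> pt R) z (C : R) :
  (forall n, `|(u n).1 - z.1| <= C / 2 ^+ n /\ `|(u n).2 - z.2| <= C / 2 ^+ n) ->
  u @ \oo --> z.
Proof.
move=> h; apply/cvgrPdist_lt => e e0.
have C0 : 0 <= C by have [+ _] := h 0%N; rewrite expr0 divr1; exact: le_trans.
have [n0 hn0] := @pow2_small (e / (C + 1)) (divr_gt0 e0 (ltr_wpDl C0 ltr01)).
exists n0 => // n /= hn.
have small : C / 2 ^+ n < e.
  apply: le_lt_trans (_ : (C + 1) / 2 ^+ n0 < _).
    apply: ler_pM; rewrite ?invr_ge0 ?exprn_ge0 //; first by lra.
    by rewrite lef_pV2 ?posrE ?exprn_gt0 // ler_weXn2l // ler1n.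
  by rewrite mulrC -ltr_pdivlMr //; lra.
have [h1 h2] := h n.
rewrite prod_normE gt_max /=; apply/andP; split.
  by rewrite distrC; exact: le_lt_trans small.
by rewrite distrC; exact: le_lt_trans small.
Qed.

Lemma lipschitz_continuous f (C : R) :
  (forall x y, `|f x - f y| <= C * (`|x.1 - y.1| + `|x.2 - y.2|)) -> continuous f.
Proof.
move=> h x; apply/cvgrPdist_lt => e e0.
have C0 : 0 <= C.
  have := h (1, 0) (0, 0); rewrite /= subrr subr0 normr0 normr1 addr0 mulr1.
  exact: le_trans.
have d0 : 0 < e / (2 * C + 1) by rewrite divr_gt0 //; lra.
near=> y.
have : `|x - y| < e / (2 * C + 1).
  by near: y; apply: cvgr_dist_lt => //; exact: cvg_id.
rewrite prod_normE gt_max /= => /andP[h1 h2].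
apply: le_lt_trans (h x y) _.
apply: le_lt_trans (_ : C * (e / (2 * C + 1) + e / (2 * C + 1)) < _).
  by rewrite ler_wpM2l // lerD // ltW.
rewrite -mulrDl mulrA ltr_pdivrMr; last by lra.
nra.
Unshelve. all: by end_near.
Qed.

Lemma bc_lipschitz (T : equilateral R) q : exists C, forall x y,
  `|bc T q x - bc T q y| <= C * (`|x.1 - y.1| + `|x.2 - y.2|).
Proof.
set g := centroid T.
exists (2 * (`|q.1 - g.1| + `|q.2 - g.2|)) => x y.
have -> : bc T q x - bc T q y =
    2 * ((x.1 - y.1) * (q.1 - g.1) + (x.2 - y.2) * (q.2 - g.2)).
  by rewrite /bc -/g; ring.
rewrite normrM ger0_norm // -mulrA ler_pM2l //.
rewrite (le_trans (ler_normD _ _)) // !normrM.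
have := normr_ge0 (q.1 - g.1); have := normr_ge0 (q.2 - g.2).
have := normr_ge0 (x.1 - y.1); have := normr_ge0 (x.2 - y.2).
move: `|_| `|_| `|_| `|_| => a b c d *; nra.
Qed.

Lemma bc_continuous (T : equilateral R) q : continuous (bc T q).
Proof. by have [C hC] := bc_lipschitz T q; exact: lipschitz_continuous hC. Qed.

Lemma closed_lim A (u : nat -> pt R) z : closed A -> (forall n, A (u n)) ->
  u @ \oo --> z -> A z.
Proof. by move=> cA hu; apply: (closed_cvg A cA); exact: nearW. Qed.

Lemma connected_closed_limit A z : connected A -> closure A z -> connected (A `|` [set z]).
Proof.
move=> cA hz; apply/connectedP => E [E0 hE [s1 s2]].
have sE : separated (E false) (E true) by [].
have sub : A `<=` E false `|` E true by rewrite -hE => y; left.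
have Ez : (E false `|` E true) z by rewrite -hE; right.
have key b : A `<=` E b -> False.
  move=> hA; have [y hy] := E0 (~~ b).
  have hd : closure (E b) `&` E (~~ b) = set0.
    by case: b {hA hy} => //; rewrite setIC.
  have : (closure (E b) `&` E (~~ b)) y.
    split=> //; have : (A `|` [set z]) y.
      by rewrite hE; case: b hy {hA hd}; [left|right].
    case=> [Ay|->]; first exact/subset_closure/hA.
    exact: closureS hA _ hz.
  by rewrite hd.
by have [/key|/key] := connected_subset sE sub cA.
Qed.

Lemma Psi_continuous (p : pt R) : continuous (Psi p).
Proof.
move=> x; apply/cvgrPdist_lt => e e0; near=> y.
have : `|x - y| < e by near: y; apply: cvgr_dist_lt => //; exact: cvg_id.
rewrite !prod_normE !gt_max /= => /andP[h1 h2].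
have -> : (x.1 - p.1) / 2 + p.1 - ((y.1 - p.1) / 2 + p.1) = (x.1 - y.1) / 2.
  by field.
have -> : (x.2 - p.2) / 2 + p.2 - ((y.2 - p.2) / 2 + p.2) = (x.2 - y.2) / 2.
  by field.
rewrite !normrM (@ger0_norm _ 2^-1) ?invr_ge0 //.
have := normr_ge0 (x.1 - y.1); have := normr_ge0 (x.2 - y.2).
by move=> *; apply/andP; split; lra.
Unshelve. all: by end_near.
Qed.

End PlaneConvergence.

(** * Addresses, sides and halves of the gasket *)

Section Gasket.
Variables (R : realType) (T : equilateral R).
Local Notation p1 := (pp1 T).
Local Notation p2 := (pp2 T).
Local Notation p3 := (pp3 T).
Local Notation V0 := (V0 T).
Local Notation V := (V T).
Local Notation bc := (bc T).
Local Notation tri := (tri T).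
Local Notation word := (word T).

Definition gasket (X : set (pt R)) : Prop :=
  [/\ compact X, X !=set0 & X = Psi p1 @` X `|` Psi p2 @` X `|` Psi p3 @` X].

Variable X : set (pt R).
Hypothesis hX : gasket X.

Lemma gasket_closed : closed X.
Proof. by case: hX => h _ _; exact: compact_closed (@norm_hausdorff _ _) h. Qed.

Lemma gasket_Psi p x : p \in V0 -> X x -> X (Psi p x).
Proof.
case: hX => _ _ e /V0P hp hx; rewrite e.
by case: hp => ->; [left; left|left; right|right]; exists x.
Qed.

Lemma gasket_inv x : X x -> exists2 p, p \in V0 & exists2 x', X x' & x = Psi p x'.
Proof.
case: hX => _ _ e; rewrite {1}e => -[[]|] [x' hx' <-].
- by exists p1; [exact: p1V0|exists x'].
- by exists p2; [exact: p2V0|exists x'].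
- by exists p3; [exact: p3V0|exists x'].
Qed.

Lemma gasket_Psiw w x : word w -> X x -> X (Psiw w x).
Proof.
elim: w => [//|p w IH] /= /andP[hp hw] hx; apply: gasket_Psi => //; exact: IH.
Qed.

Lemma gasket_bounded : exists M, forall x, X x -> `|x.1| <= M /\ `|x.2| <= M.
Proof.
case: hX => /compact_bounded[M [_ hM]] _ _; exists (M + 1) => x hx.
have := hM (M + 1) (ltr_pwDr ltr01 (lexx _)) x hx.
by rewrite /= prod_normE ge_max => /andP[].
Qed.

(** A coordinate is bounded below by some -D on the compact set [X], and each application of
    self-similarity halves this bound. *)
Lemma gasket_tri x : X x -> tri x.
Proof.
move=> hx q hq.
have [M hM] := gasket_bounded.
have [C hC] := bc_lipschitz T q.
pose D := `|bc q p1| + `|C| * (`|M| + `|p1.1| + (`|M| + `|p1.2|)).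
have hD y : X y -> - D <= bc q y.
  move=> /hM[h1 h2].
  have a1 := ler_normB y.1 p1.1; have a2 := ler_normB y.2 p1.2.
  have b1 := ler_norm M.
  have hC' : C * (`|y.1 - p1.1| + `|y.2 - p1.2|) <=
      `|C| * (`|M| + `|p1.1| + (`|M| + `|p1.2|)).
    apply: le_trans (_ : `|C| * (`|y.1 - p1.1| + `|y.2 - p1.2|) <= _).
      by rewrite ler_wpM2r ?addr_ge0 // ler_norm.
    by rewrite ler_wpM2l //; lra.
  have := hC y p1; rewrite ler_norml => /andP[+ _].
  have := ler_norm (- bc q p1); rewrite normrN /D; lra.
have D0 : 0 <= D.
  by rewrite addr_ge0 // mulr_ge0 // !addr_ge0.
have iter n : forall y, X y -> - (D / 2 ^+ n) <= bc q y.
  elim: n => [|n IH] y hy; first by rewrite expr0 divr1 hD.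
  have [p hp [y' hy' ->]] := gasket_inv hy.
  rewrite bc_Psi; have := IH y' hy'; have := tri_corner hp hq.
  rewrite exprS [2 * _]mulrC invfM mulrA; lra.
rewrite leNgt; apply/negP => hneg.
have d0 : 0 < - bc q x / (D + 1) by rewrite divr_gt0 // ?oppr_gt0 //; lra.
have [n hn] := pow2_small d0.
have := iter n x hx; apply/negP; rewrite -ltNge ltrNr.
apply: le_lt_trans (_ : (D + 1) / 2 ^+ n < _).
  by rewrite ler_wpM2r ?invr_ge0 ?exprn_ge0 //; lra.
by rewrite mulrC -ltr_pdivlMr //; lra.
Qed.

Lemma gasket_limit (w : nat -> seq (pt R)) (y : nat -> pt R) (z : pt R) :
  (forall n, word (w n) /\ size (w n) = n) ->
  (forall n, z = Psiw (w n) (y n)) ->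
  (exists M, forall n, `|(y n).1| <= M /\ `|(y n).2| <= M) ->
  forall x, (fun n => Psiw (w n) x) @ \oo --> z.
Proof.
move=> hw hz [M hM] x; apply: (@cvg_plane _ _ _ (`|x.1| + M + (`|x.2| + M))) => n.
have [_ sw] := hw n; have [e1 e2] := Psiw_diff (w n) x (y n).
have [m1 m2] := hM n.
rewrite (hz n) e1 e2 sw !normrM !(@ger0_norm _ (2 ^+ n)^-1) ?invr_ge0 ?exprn_ge0 //.
have i0 : 0 <= (2 ^+ n)^-1 :> R by rewrite invr_ge0 exprn_ge0.
have := ler_normB x.1 (y n).1; have := ler_normB x.2 (y n).2.
have := normr_ge0 (y n).1; have := normr_ge0 (y n).2.
have := normr_ge0 x.1; have := normr_ge0 x.2.
by move=> *; split; rewrite ler_wpM2r //; lra.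
Qed.

Lemma gasket_corner p : p \in V0 -> X p.
Proof.
move=> hp; case: (hX) => _ [x0 hx0] _.
apply: (@closed_lim _ X (fun n => Psiw (nseq n p) x0)); first exact: gasket_closed.
  by move=> n; apply: gasket_Psiw => //; exact: word_nseq.
apply: (@gasket_limit (fun n => nseq n p) (fun=> p)).
- by move=> n; rewrite size_nseq word_nseq.
- by move=> n; rewrite Psiw_nseq.
by exists (`|p.1| + `|p.2|) => n; split; rewrite ?lerDl ?lerDr.
Qed.

Lemma gasket_V n z : z \in V n -> X z.
Proof.
elim: n z => [|n IH] z; first exact: gasket_corner.
by case/mem_VS => p hp [x /IH hx ->]; exact: gasket_Psi.
Qed.

Lemma gasket_address x : X x -> exists2 s : nat -> pt R,
  forall i, s i \in V0 & forall n, exists2 x', X x' & x = Psiw (mkseq s n) x'.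
Proof.
move=> hx.
have step y : exists u : pt R * pt R, X y -> [/\ u.1 \in V0, X u.2 & y = Psi u.1 u.2].
  have [hy|hy] := pselect (X y); last by exists (y, y).
  by have [p hp [y' hy' e]] := gasket_inv hy; exists (p, y').
have [F hF] := choice step.
pose o n := iter n (fun y => (F y).2) x.
have ho n : X (o n) by elim: n => [//|n IH]; case: (hF _ IH).
exists (fun n => (F (o n)).1) => [i|n].
  by case: (hF _ (ho i)).
exists (o n) => //; elim: n => [//|n IH].
rewrite IH mkseqS -cats1 Psiw_cat /=; congr Psiw.
by case: (hF _ (ho n)).
Qed.

Lemma word_mkseq (s : nat -> pt R) n : (forall i, s i \in V0) -> word (mkseq s n).
Proof. by move=> hs; apply/allP => z /mapP[i _ ->]; exact: hs. Qed.

(** Approximations of a point along its address stay in the level-[m] cell of the address, which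
    makes the estimates at level [m] available for all finer walks. *)
Lemma mkseq_cut (s : nat -> pt R) m n y : (forall i, s i \in V0) -> y \in V0 ->
  exists2 y', y' \in V n & Psiw (mkseq s (m + n)) y = Psiw (mkseq s m) y'.
Proof.
move=> hs hy; exists (Psiw (mkseq (fun i => s (m + i)%N) n) y).
  have := @Psiw_V _ T (mkseq (fun i => s (m + i)%N) n) 0 y _ hy.
  by rewrite size_mkseq addn0; apply; exact: word_mkseq.
rewrite -Psiw_cat; congr Psiw; rewrite /mkseq iotaD map_cat; congr cat.
by rewrite [RHS](map_comp s (addn m)) -iotaDl addn0.
Qed.

Lemma address_cvg (s : nat -> pt R) x y : (forall i, s i \in V0) ->
  (forall n, exists2 x', X x' & x = Psiw (mkseq s n) x') ->
  (fun n => Psiw (mkseq s n) y) @ \oo --> x.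
Proof.
move=> hs hx.
have hx2 n : exists x', X x' /\ x = Psiw (mkseq s n) x'.
  by have [x' h1 h2] := hx n; exists x'.
have [z hz] := choice hx2.
have [M hM] := gasket_bounded.
apply: (@gasket_limit (mkseq s) z).
- by move=> n; rewrite size_mkseq; split => //; exact: word_mkseq.
- by move=> n; case: (hz n).
by exists M => n; apply: hM; case: (hz n).
Qed.

Definition seg (a b : pt R) (t : R) : pt R :=
  ((1 - t) * a.1 + t * b.1, (1 - t) * a.2 + t * b.2).

(** The binary digits of [t] give an address of the point by words in [a] and [b]; [X] is closed. *)
Lemma seg_gasket a b t : a \in V0 -> b \in V0 -> 0 <= t <= 1 -> X (seg a b t).
Proof.
move=> ha hb ht.
have step u : 0 <= u <= 1 -> exists c u', [/\ c \in V0, 0 <= u' <= 1 &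
    seg a b u = Psi c (seg a b u')].
  case/andP => u0 u1; have [h|h] := leP u (1 / 2).
    exists a, (2 * u); split => //; first by apply/andP; split; lra.
    by rewrite /seg /Psi /=; congr pair; field.
  exists b, (2 * u - 1); split => //; first by apply/andP; split; lra.
  by rewrite /seg /Psi /=; congr pair; field.
have words n : exists w, [/\ word w, size w = n &
    exists2 u, 0 <= u <= 1 & seg a b t = Psiw w (seg a b u)].
  elim: n => [|n [w [hw sw [u hu e]]]]; first by exists [::]; split=> //; exists t.
  have [c [u' [hc hu' e']]] := step u hu.
  exists (rcons w c); split.
  - by rewrite word_rcons hc.
  - by rewrite size_rcons sw.
  by exists u' => //; rewrite -cats1 Psiw_cat /= -e'.
have [w hw] := choice words.
have uex n : exists u, 0 <= u <= 1 /\ seg a b t = Psiw (w n) (seg a b u).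
  by have [_ _ [u hu e]] := hw n; exists u.
have [u hu] := choice uex.
apply: (@closed_lim _ X (fun n => Psiw (w n) a)); first exact: gasket_closed.
  by move=> n; apply: gasket_Psiw; [case: (hw n)|exact: gasket_corner].
apply: (@gasket_limit w (fun n => seg a b (u n))).
- by move=> n; case: (hw n).
- by move=> n; case: (hu n).
exists (`|a.1| + `|b.1| + (`|a.2| + `|b.2|)) => n.
have [/andP[u0 u1] _] := hu n.
have bound (x y : R) : `|(1 - u n) * x + u n * y| <= `|x| + `|y|.
  rewrite (le_trans (ler_normD _ _)) // !normrM.
  rewrite (@ger0_norm _ (u n)) // (@ger0_norm _ (1 - u n)); last by lra.
  by apply: lerD; rewrite ler_piMl //; lra.
have := bound a.1 b.1; have := bound a.2 b.2.
have := normr_ge0 a.1; have := normr_ge0 a.2.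
have := normr_ge0 b.1; have := normr_ge0 b.2.
by move=> *; split; rewrite /=; lra.
Qed.

Lemma seg_continuous a b : continuous (seg a b).
Proof.
have lin (c d : R) : continuous (fun u : R => (1 - u) * c + u * d).
  move=> t; apply: cvgD; apply: cvgM; try exact: cvg_cst; last exact: cvg_id.
  by apply: cvgB; [exact: cvg_cst|exact: cvg_id].
move=> t; exact: (cvg_pair (lin a.1 b.1 t) (lin a.2 b.2 t)).
Qed.

Lemma seg_connected a b : connected (seg a b @` `[0, 1]).
Proof.
apply: connected_continuous_connected; first exact: segment_connected.
by apply: continuous_subspaceT => t; exact: seg_continuous.
Qed.

Lemma bc_seg q a b t : bc q (seg a b t) = (1 - t) * bc q a + t * bc q b.
Proof. by rewrite /bc /seg /=; field. Qed.

(** Inside the cell of [i] one moves by induction to [Psi i a = Psi a i], and then to [a] along a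
    side of the cell of [a]. The last clause says that the way never comes closer to the line
    [bc a = bc b] than its start, which keeps it in one half. *)
Lemma connect_corner n a b z : a \in V0 -> b \in V0 -> a != b -> z \in V n ->
  exists K : set (pt R), [/\ connected K, K `<=` X, K a, K z &
    forall y, K y -> bc a z - bc b z <= bc a y - bc b y].
Proof.
move=> ha hb ab; elim: n z => [|n IH] z.
  move=> hz; exists (seg a z @` `[0, 1]); split.
  - exact: seg_connected.
  - by move=> y [t /=]; rewrite in_itv /= => ht <-; exact: seg_gasket.
  - exists 0; first by rewrite /= in_itv /= lexx ler01.
    by rewrite /seg; case: (a) => ? ? /=; congr pair; ring.
  - exists 1; first by rewrite /= in_itv /= ler01 lexx.
    by rewrite /seg; case: (z) => ? ? /=; congr pair; ring.
  move=> y [t /=]; rewrite in_itv /= => /andP[t0 t1] <-; rewrite !bc_seg.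
  rewrite (bc_corner_self ha) (bc_corner hb ha) eq_sym (negbTE ab).
  have := bc_le1 ha (tri_corner hz); have := tri_corner hz hb.
  by move=> ? ?; rewrite mulr0 mulr1; nra.
case/mem_VS => i hi [z' hz' ->].
have [K [cK KX Ka Kz hK]] := IH z' hz'.
have cont (p : pt R) (A : set (pt R)) : {within A, continuous (Psi p)}.
  by apply: continuous_subspaceT => t; exact: Psi_continuous.
exists (Psi i @` K `|` Psi a @` (seg a i @` `[0, 1])).
have seg1 : (seg a i @` `[0, 1]) i.
  exists 1; first by rewrite /= in_itv /= ler01 lexx.
  by rewrite /seg; case: (i) => ? ? /=; congr pair; ring.
have seg0 : (seg a i @` `[0, 1]) a.
  exists 0; first by rewrite /= in_itv /= lexx ler01.
  by rewrite /seg; case: (a) => ? ? /=; congr pair; ring.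
split.
- apply: connectedU.
  + exists (Psi i a); split; first by exists a.
    by exists i => //; rewrite Psi_mid.
  + exact: connected_continuous_connected.
  by apply: connected_continuous_connected => //; exact: seg_connected.
- move=> y [[k hk <-]|[k [t /= + <-] <-]].
    by apply: gasket_Psi => //; exact: KX.
  by rewrite in_itv /= => ht; apply: gasket_Psi => //; exact: seg_gasket.
- by right; exists a => //; rewrite Psi_fix.
- by left; exists z'.
move=> y [[k hk <-]|[k [t /= + <-] <-]].
  by rewrite !bc_Psi; have := hK k hk; lra.
rewrite in_itv /= => /andP[t0 t1]; rewrite !bc_Psi !bc_seg.
have hia := bc_le1 ha (tri_corner hi); have hib := tri_corner hi hb.
have := hK a Ka.
rewrite (bc_corner_self ha) (bc_corner hb ha) eq_sym (negbTE ab) /= => h.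
nra.
Qed.

(** The component stays in the half by the intermediate value theorem. Conversely, a point of the
    half is a limit of vertices of the half; their connections to [a] share the point [a], and
    adding the limit point keeps the union connected. *)
Lemma component_corner a b : a \in V0 -> b \in V0 -> a != b ->
  connected_component (X `\` [set z | bc a z = bc b z]) a =
  X `&` [set z | bc b z < bc a z].
Proof.
move=> ha hb ab.
have haa : bc b a < bc a a.
  by rewrite (bc_corner_self ha) (bc_corner hb ha) eq_sym (negbTE ab) ltr01.
have cont : continuous (fun z => bc a z - bc b z).
  move=> z; apply: cvgB; exact: bc_continuous.
apply/seteqP; split=> z.
  case=> C [Ca Csub Cc] Cz; split; first by case: (Csub z Cz).
  rewrite /= ltNge; apply/negP => hz.
  have hI : is_interval ((fun z => bc a z - bc b z) @` C).
    apply/connected_intervalP; apply: connected_continuous_connected => //.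
    by apply: continuous_subspaceT => t; exact: cont.
  have : ((fun z => bc a z - bc b z) @` C) 0.
    apply: (hI (bc a z - bc b z) (bc a a - bc b a)); [by exists z|by exists a|].
    by apply/andP; split; lra.
  case=> y Cy e; case: (Csub y Cy) => _; apply => /=; lra.
case=> Xz /= hz.
have [s hs hsz] := gasket_address Xz.
have hcv := address_cvg a hs hsz.
pose xs n := Psiw (mkseq s n) a.
have hV n : xs n \in V n.
  rewrite /xs -{2}(size_mkseq s n) -[size _]addn0; apply: Psiw_V => //.
  exact: word_mkseq.
have Kex n : exists K : set (pt R), [/\ connected K, K `<=` X, K a, K (xs n) &
    forall y, K y -> bc a (xs n) - bc b (xs n) <= bc a y - bc b y].
  exact: connect_corner.
have [K hK] := choice Kex.
pose P n := bc b (xs n) < bc a (xs n).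
pose S := \bigcup_(n in P) K n.
have cS : connected S.
  apply: bigcup_connected; last by move=> n _; case: (hK n).
  by exists a => n _; case: (hK n).
have evP : \forall n \near \oo, P n.
  have h1 : (fun n => bc a (xs n) - bc b (xs n)) @ \oo --> bc a z - bc b z.
    exact: (cvg_comp _ _ hcv (cont z)).
  have [N _ HN] : \forall n \near \oo, 0 < bc a (xs n) - bc b (xs n).
    by apply: (cvgr_gt _ h1); rewrite subr_gt0.
  by exists N => // n hn; rewrite /P -subr_gt0; exact: HN.
have clz : closure S z.
  move=> B hB; have := hcv B hB => hBn.
  have [n [h1 h2]] : exists n, B (xs n) /\ P n.
    have [N1 _ h1] : \forall n \near \oo, B (xs n) by exact: hBn.
    have [N2 _ h2] := evP; exists (maxn N1 N2).
    by split; [apply: h1; exact: leq_maxl|apply: h2; exact: leq_maxr].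
  by exists (xs n); split => //; exists n => //; case: (hK n).
have hconn := connected_closed_limit cS clz.
exists (S `|` [set z]); last by right.
split=> //.
  have [n _ hn] := evP; left; exists n; first exact: hn n (leqnn n).
  by case: (hK n).
move=> y [[n Pn Ky]|->].
  have [_ KX _ _ hy] := hK n; split; first exact: KX.
  have := hy y Ky; move: Pn; rewrite /P /= => h1 h2 h3; lra.
by split => //= h; move: hz; rewrite h ltxx.
Qed.

End Gasket.

(** * Measurability and weak limits *)

Section PlaneMeasurability.
Variable R : realType.
Implicit Types (U A : set (pt R)) (f : pt R -> R).

(** The sigma-algebra of the plane is the product one, so an open set is exhibited as a countable
    union of boxes with rational centres. *)
Lemma open_measurable_plane U : open U -> measurable U.
Proof.
move=> oU.
pose I (q : rat) n : set R := `](ratr q - (2 ^+ n)^-1), (ratr q + (2 ^+ n)^-1)[%classic.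
pose box q s n : set (pt R) := I q n `*` I s n.
pose F q s n := if pselect (box q s n `<=` U) then box q s n else set0.
have -> : U = \bigcup_q \bigcup_s \bigcup_n F q s n.
  apply/seteqP; split=> [z Uz|z]; last first.
    move=> [q _ [s _ [n _]]]; rewrite /F; case: pselect => // h; exact: h.
  have [e /= e0 he] : nbhs_ball z U.
    by apply/nbhs_ballP; exact: open_nbhs_nbhs.
  (* A box of half-width 2^-n containing z lies within 2 * 2^-n of z, hence the half of [e]. *)
  have [n hn] := @pow2_small R (e / 2) (divr_gt0 e0 (ltr0Sn _ 1)).
  have i0 : 0 < (2 ^+ n)^-1 :> R by rewrite invr_gt0 exprn_gt0.
  have rat_near (x : R) : exists q : rat, `|x - ratr q| < (2 ^+ n)^-1.
    have [q] := @rat_in_itvoo R (x - (2 ^+ n)^-1) x ltac:(by rewrite ltrBlDr ltrDl).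
    rewrite in_itv /= => /andP[q1 q2]; exists q.
    by rewrite ltr_norml; apply/andP; split; lra.
  have [q hq] := rat_near z.1; have [s hs] := rat_near z.2.
  exists q => //; exists s => //; exists n => //; rewrite /F.
  move: hq hs; rewrite !ltr_norml => /andP[q1 q2] /andP[s1 s2].
  case: pselect => [h|h].
    by split; rewrite /I /= in_itv /=; apply/andP; split; lra.
  exfalso; apply: h => y []; rewrite /I /= !in_itv /= => /andP[y1 y2] /andP[y3 y4].
  apply: he; split; rewrite /ball /= ltr_norml; apply/andP; split; lra.
apply: bigcupT_measurable_rat => q; apply: bigcupT_measurable_rat => s.
apply: bigcupT_measurable => n; rewrite /F; case: pselect => h; last exact: measurable0.
by apply: measurableX; exact: measurable_itv.
Qed.

Lemma closed_measurable_plane A : closed A -> measurable A.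
Proof. by move/closed_openC/open_measurable_plane/measurableC; rewrite setCK. Qed.

Lemma continuous_measurable_plane f : continuous f -> measurable_fun setT f.
Proof.
move=> /continuousP cf.
apply: (measurability _ (measurable_realfun.RGenOpens.measurableE R)).
move=> _ [_ [a [b ->] <-]]; rewrite setTI; apply: open_measurable_plane.
exact/cf/interval_open.
Qed.

Lemma eval_measurable (t : R) :
  measurable_fun setT (fun w : PathM R => pf w t : pt R).
Proof.
move=> _ B mB; rewrite setTI; apply: sub_sigma_algebra.
by exists t => //; exists B.
Qed.

Lemma measurable_eval_preimage (t : R) A : measurable A ->
  measurable [set w : PathM R | A (pf w t)].
Proof.
by move=> mA; have := @eval_measurable t measurableT A mA; rewrite setTI.
Qed.

Definition mean (P : probability (PathM R) R) (t : R) f : \bar R :=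
  (\int[P]_w (f (pf w t))%:E)%E.

Lemma mean_measurable t f : continuous f ->
  measurable_fun setT (fun w : PathM R => (f (pf w t))%:E).
Proof.
move=> cf; apply/measurable_EFinP.
exact: (measurableT_comp (continuous_measurable_plane cf) (eval_measurable t)).
Qed.

Lemma mean_ge_prob (P : probability (PathM R) R) t f A : continuous f ->
  measurable A -> (forall z, 0 <= f z) -> (forall z, A z -> 1 <= f z) ->
  (P [set w : PathM R | A (pf w t)] <= mean P t f)%E.
Proof.
move=> cf mA f0 f1; have mB := measurable_eval_preimage t mA.
set B := [set w | _] in mB *.
rewrite -(setIT B) -integral_indic //; apply: ge0_le_integral => //.
- by apply/measurable_EFinP; exact: measurable_indic.
- exact: mean_measurable.
move=> w _; rewrite lee_fin indicE; have [hw|hw] := boolP (w \in B); last exact: f0.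
by apply: f1; move: hw; rewrite inE.
Qed.

Lemma mean_le_prob (P : probability (PathM R) R) t f A : continuous f ->
  measurable A -> (forall z, 0 <= f z <= 1) -> (forall z, ~ A z -> f z = 0) ->
  (mean P t f <= P [set w : PathM R | A (pf w t)])%E.
Proof.
move=> cf mA f01 f0; have mB := measurable_eval_preimage t mA.
set B := [set w | _] in mB *.
rewrite -(setIT B) -integral_indic //; apply: ge0_le_integral => //.
- by move=> w _; rewrite lee_fin; case/andP: (f01 (pf w t)).
- exact: mean_measurable.
- by apply/measurable_EFinP; exact: measurable_indic.
move=> w _; rewrite lee_fin indicE; have [hw|hw] := boolP (w \in B).
  by case/andP: (f01 (pf w t)).
by rewrite f0 // => h; move: hw; rewrite notin_setE; apply.
Qed.

Lemma mean_fin (P : probability (PathM R) R) t f : continuous f ->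
  (forall z, 0 <= f z <= 1) -> mean P t f \is a fin_num.
Proof.
move=> cf f01; rewrite ge0_fin_numE; last first.
  by apply: integral_ge0 => w _; rewrite lee_fin; case/andP: (f01 (pf w t)).
have := @mean_le_prob P t f setT cf measurableT f01 (fun z h => match h I with end).
move=> /le_lt_trans; apply.
rewrite (_ : [set w | _] = setT) ?probability_setT ?ltry //.
Qed.

Definition l1dist (z a : pt R) : R := `|z.1 - a.1| + `|z.2 - a.2|.
Definition dist_to A z : R := inf [set l1dist z a | a in A].

Lemma dist_to_ge0 A z : A !=set0 -> 0 <= dist_to A z.
Proof.
move=> [a ha]; apply: lb_le_inf; first by exists (l1dist z a); exists a.
by move=> _ [b _ <-]; rewrite addr_ge0.
Qed.

Lemma dist_to_le A z a : A a -> dist_to A z <= l1dist z a.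
Proof.
move=> ha; apply: ge_inf; last by exists a.
by exists 0 => _ [b _ <-]; rewrite addr_ge0.
Qed.

Lemma dist_to_lipschitz A z z' : A !=set0 ->
  `|dist_to A z - dist_to A z'| <= l1dist z z'.
Proof.
move=> A0.
have H x y : dist_to A x - l1dist x y <= dist_to A y.
  case: A0 => a ha; apply: lb_le_inf; first by exists (l1dist y a); exists a.
  move=> _ [b hb <-]; have := dist_to_le x hb; rewrite /l1dist.
  have := ler_distD y.1 x.1 b.1; have := ler_distD y.2 x.2 b.2; lra.
have := H z z'; have := H z' z; rewrite ler_norml.
have -> : l1dist z' z = l1dist z z' by rewrite /l1dist distrC [X in _ + X]distrC.
by move=> *; apply/andP; split; lra.
Qed.

Lemma dist_to_eq0 A z : closed A -> A !=set0 -> dist_to A z <= 0 -> A z.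
Proof.
move=> cA A0 hz; apply: cA => B /nbhs_ballP[e /= e0 he].
have [a ha] : exists2 a, A a & l1dist z a < e.
  have : dist_to A z < e by exact: le_lt_trans e0.
  move=> hlt; apply: contrapT => hn.
  have : e <= dist_to A z.
    case: A0 => a ha; apply: lb_le_inf; first by exists (l1dist z a); exists a.
    move=> _ [b hb <-]; rewrite leNgt; apply/negP => h; apply: hn.
    by exists b.
  by rewrite leNgt hlt.
rewrite /l1dist => hd; exists a; split => //; apply: he.
have h1 := normr_ge0 (z.1 - a.1); have h2 := normr_ge0 (z.2 - a.2).
by split; rewrite /ball /=; lra.
Qed.

Definition urysohn A (j : nat) z : R := Num.max 0 (1 - j%:R * dist_to A z).

Lemma max_lipschitz (a b : R) : `|Num.max 0 a - Num.max 0 b| <= `|a - b|.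
Proof.
have [h1|h1] := leP 0 a; have [h2|h2] := leP 0 b; rewrite ?subrr ?normr0 //.
- by rewrite subr0 !ger0_norm; lra.
- by rewrite sub0r normrN (ger0_norm h2) ler0_norm; lra.
Qed.

Lemma urysohn_continuous A j : A !=set0 -> continuous (urysohn A j).
Proof.
move=> A0; apply: (@lipschitz_continuous _ _ j%:R) => x y.
apply: le_trans (max_lipschitz _ _) _.
have -> : 1 - j%:R * dist_to A x - (1 - j%:R * dist_to A y) =
  j%:R * (dist_to A y - dist_to A x) by ring.
by rewrite normrM ger0_norm // ler_wpM2l // distrC; exact: dist_to_lipschitz.
Qed.

Lemma urysohn01 A j z : A !=set0 -> 0 <= urysohn A j z <= 1.
Proof.
move=> A0; rewrite /urysohn le_max lexx /= ge_max ler01 /=.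
by rewrite lerBlDr lerDl mulr_ge0 // dist_to_ge0.
Qed.

Lemma urysohn_eq1 A j z : A z -> 1 <= urysohn A j z.
Proof.
move=> hz; rewrite /urysohn le_max; apply/orP; right.
have := dist_to_le z hz; rewrite /l1dist !subrr !normr0 addr0 => h.
have := mulr_ge0_le0 (ler0n R j) h; lra.
Qed.

Lemma urysohn_support A j z : 0 < urysohn A j z -> j%:R * dist_to A z < 1.
Proof. by rewrite /urysohn lt_max ltxx /= subr_gt0. Qed.

(** Outside the open set [O j] the function [urysohn A j] vanishes, and the [O j] decrease to the
    closed set [A]; continuity of the measure from above gives the bound for [A] itself. *)
Lemma prob_closed_ge (P : probability (PathM R) R) t A (c : \bar R) :
  closed A -> A !=set0 -> (forall j, c <= mean P t (urysohn A j))%E ->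
  (c <= P [set w : PathM R | A (pf w t)])%E.
Proof.
move=> cA A0 hc.
pose O j : set (pt R) := [set z | j%:R * dist_to A z < 1].
have mO j : measurable (O j).
  apply: open_measurable_plane; rewrite /O.
  have cf : continuous (fun z => j%:R * dist_to A z : R).
    apply: (@lipschitz_continuous _ _ j%:R) => x y.
    by rewrite -mulrBr normrM ger0_norm // ler_wpM2l //; exact: dist_to_lipschitz.
  rewrite (_ : [set z | _] = (fun z => j%:R * dist_to A z) @^-1` [set x | x < 1]) //.
  by apply: open_comp => [z _|]; [exact: cf|exact: open_lt].
pose F j := [set w : PathM R | O j (pf w t)].
have mF j : measurable (F j) by exact: measurable_eval_preimage.
have hF j : (c <= P (F j))%E.
  apply: le_trans (hc j) _; apply: mean_le_prob => //.
  - exact: urysohn_continuous.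
  - by move=> z; exact: urysohn01.
  move=> z nz; have /andP[h _] := urysohn01 j z A0.
  apply/eqP; rewrite eq_le h andbT leNgt; apply/negP => /urysohn_support.
  exact: nz.
have eF : \bigcap_j F j = [set w : PathM R | A (pf w t)].
  apply/seteqP; split=> w hw /=; last first.
    move=> j _; rewrite /F /O /=.
    have := dist_to_le (pf w t) hw; rewrite /l1dist !subrr !normr0 addr0 => h.
    by have := mulr_ge0_le0 (ler0n R j) h; lra.
  apply: dist_to_eq0 => //; rewrite leNgt; apply/negP => d0.
  set d := dist_to A _ in d0 *.
  have := hw (Num.truncn d^-1).+1 I; rewrite /F /O /= -/d ltNge => /negP; apply.
  by rewrite mulrC -ler_pdivrMl // mulr1 ltW // truncnS_gt.
have := @nonincreasing_cvg_mu _ _ _ P F.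
rewrite eF => H.
have Hc : (P \o F) @ \oo --> P [set w : PathM R | A (pf w t)].
  apply: H.
  - exact: le_lt_trans (probability_le1 P (mF 0%N)) (ltry _).
  - exact: mF.
  - by apply: measurable_eval_preimage; exact: closed_measurable_plane.
  move=> i j ij; apply/subsetPset => w; rewrite /F /O /=.
  apply: le_lt_trans; rewrite ler_wpM2r ?ler_nat //; exact: dist_to_ge0.
by apply: (cvge_ge _ Hc); apply: nearW => j; exact: hF.
Qed.

End PlaneMeasurability.

(** * Comparison of the diffusion from two points *)

Section Comparison.
Variables (R : realType) (T : equilateral R).
Local Notation p1 := (pp1 T).
Local Notation p2 := (pp2 T).
Local Notation p3 := (pp3 T).
Local Notation V0 := (V0 T).
Local Notation V := (V T).
Local Notation bc := (bc T).
Local Notation tri := (tri T).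
Local Notation word := (word T).
Local Notation heat := (heat T).

(** From 2 >= exp(1/2) one gets 2^K >= exp(2 lam - 1/2); the rational bound then follows from exp(x)
    >= 1 + x. *)
Lemma expR_pow2_upper (lam : R) K : 0 <= lam -> 4 * lam - 1 <= K%:R ->
  expR lam / 2 ^+ K <= (lam + 1 / 2)^-1.
Proof.
move=> l0 hK.
have e1 : expR (- (lam - 1 / 2)) <= (lam + 1 / 2)^-1.
  rewrite expRN lef_pV2 ?posrE ?expR_gt0 //; last by lra.
  by rewrite (le_trans _ (expR_ge1Dx _)) //; lra.
have e2 : expR (K%:R / 2) <= 2 ^+ K :> R.
  rewrite expRM_natl; apply: lerXn2r; rewrite ?nnegrE ?expR_ge0 //.
  have := expR_ge1Dx (- 2^-1 : R); rewrite expRN => h.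
  have : (1 - 2^-1) * expR (2^-1) <= 1 :> R.
    by rewrite -ler_pdivlMr ?expR_gt0 // div1r.
  lra.
apply: le_trans e1; rewrite ler_pdivrMr ?exprn_gt0 //.
apply: le_trans (_ : expR (- (lam - 1 / 2)) * expR (K%:R / 2) <= _).
  by rewrite -expRD ler_expR; lra.
by rewrite ler_wpM2l // expR_ge0.
Qed.

Lemma expR_pow2_lower (lam : R) K : 0 <= lam -> K%:R <= lam / 4 ->
  2 ^+ K * expR (- (lam / 2)) <= (1 + lam / 4)^-1.
Proof.
move=> l0 hK.
have e2 : 2 ^+ K <= expR K%:R :> R.
  rewrite -[K%:R]mulr1 expRM_natl; apply: lerXn2r; rewrite ?nnegrE ?expR_ge0 //.
  by have := expR_ge1Dx (1 : R); lra.
apply: le_trans (_ : expR K%:R * expR (- (lam / 2)) <= _).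
  by rewrite ler_wpM2r // expR_ge0.
rewrite -expRD; apply: le_trans (_ : expR (- (lam / 4)) <= _).
  by rewrite ler_expR; lra.
rewrite expRN lef_pV2 ?posrE ?expR_gt0 //; last by lra.
exact: expR_ge1Dx.
Qed.

Lemma min_lipschitz (a b : R) : `|Num.min 1 a - Num.min 1 b| <= `|a - b|.
Proof.
have e (x : R) : Num.min 1 x = 1 - Num.max 0 (1 - x).
  by have [h1|h1] := leP 1 x; have [h2|h2] := leP 0 (1 - x); lra.
rewrite !e; have -> : forall u v : R, 1 - u - (1 - v) = v - u by move=> u v; ring.
apply: le_trans (max_lipschitz _ _) _.
by have -> : 1 - b - (1 - a) = a - b by ring.
Qed.

Lemma cutoff_continuous m i h : continuous (cutoff T m i h).
Proof.
have [C hC] := bc_lipschitz T i.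
apply: (@lipschitz_continuous _ _ (2 ^+ m * C)) => x y.
apply: le_trans (min_lipschitz _ _) _; apply: le_trans (max_lipschitz _ _) _.
set u := `|bc i x - bc i h|; set v := `|bc i y - bc i h|.
have -> : 2 - 2 ^+ m * u - (2 - 2 ^+ m * v) = 2 ^+ m * (v - u) by ring.
rewrite normrM ger0_norm ?exprn_ge0 // -mulrA ler_wpM2l ?exprn_ge0 //.
apply: le_trans (hC x y); rewrite distrC.
apply: le_trans (ler_dist_dist _ _) _.
by have -> : bc i x - bc i h - (bc i y - bc i h) = bc i x - bc i y by ring.
Qed.

Lemma Psiw_continuous (w : seq (pt R)) : continuous (Psiw w).
Proof.
elim: w => [|p w IH] z; first exact: cvg_id.
exact: (continuous_comp (IH z) (@Psi_continuous _ p _)).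
Qed.

Lemma V_mono n k z : z \in V n -> z \in V (n + k).
Proof.
elim: n z => [|n IH] z; first exact: V0_sub.
by case/mem_VS => p hp [x /IH hx ->]; rewrite addSn; exact: Psi_V.
Qed.

Lemma heat_cutoff_le1 n m i h k x : x \in V n -> heat n (cutoff T m i h) k x <= 1.
Proof. by move=> hx; apply: heat_le1 => // z; case/andP: (cutoff01 T m i h z). Qed.

Variables (X : set (pt R)) (P : pt R -> probability (PathM R) R).
Hypothesis hX : gasket T X.
Hypothesis hP : IsBMonSG p1 p2 p3 X P.

Lemma bm_limit x (xs : nat -> pt R) (r : R) (f : pt R -> R) : X x -> (forall n, xs n \in V n) ->
  xs @ \oo --> x -> 0 <= r -> continuous f -> (forall z, 0 <= f z <= 1) ->
  (fun n => rwE p1 p2 p3 n (xs n) [:: (r, f)]) @ \oo --> fine (mean (P x) r f).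
Proof.
move=> hx hxs hcv r0 cf f01.
have := @hP x hx xs hxs hcv [:: (r, f)].
have hl : forall e, e \in [:: (r, f)] -> 0 <= e.1 /\ bounded_cont e.2.
  move=> e; rewrite inE => /eqP -> /=; split => //; split=> //; exists 1 => z.
  by case/andP: (f01 z) => h0 h1; rewrite ger0_norm.
move=> /(_ hl).
have -> : (\int[P x]_w (prodF w 0 [:: (r, f)])%:E)%E = mean (P x) r f.
  by rewrite /mean; apply: eq_integral => w _ /=; rewrite add0r mulr1.
rewrite -{1}(fineK (mean_fin (P x) r cf f01)) => /fine_cvgP[_].
exact.
Qed.

(** The level-[m] cell of [a] along its address is joined to [h] by at most [l] edges, while [b] is
    at least [l + 5] edge lengths from [h] in the coordinate [i]. The target is the cell [w] at the
    axis point [h], on whichever side it lies. *)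
Lemma bm_compare a b h m w q i l (s : nat -> pt R) :
  X a -> X b -> cell_at T m h w q -> refl p1 p2 h = h ->
  map (refl p1 p2) w != w ->
  (forall j, s j \in V0) ->
  (forall n, exists2 a', X a' & a = Psiw (mkseq s n) a') ->
  (forall q, q \in V0 -> exists2 l', (l' <= l)%N & reach T m l' (Psiw (mkseq s m) q) h) ->
  i \in V0 -> l%:R + 5 <= 2 ^+ m * `|bc i b - bc i h| ->
  exists2 r0 : R, 0 < r0 & forall r, 0 < r -> r < r0 ->
    (P b [set z : PathM R | (Psiw w @` X) (pf z r)] <
     P a [set z : PathM R | (Psiw w @` X) (pf z r)])%E.
Proof.
move=> Xa Xb cw hh hne hs ha hreach hi hfar.
have hq1 := p1V0 T.
have [hw sw hq ew] := cw.
set A := Psiw w @` X.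
have cA : closed A.
  apply: compact_closed; first exact: norm_hausdorff.
  apply: continuous_compact; last by case: hX.
  by apply: continuous_subspaceT => z; exact: Psiw_continuous.
have A0 : A !=set0 by case: hX => _ [x hx] _; exists (Psiw w x); exists x.
have [t ht hb] := gasket_address hX Xb.
have [b' Xb' eb] := hb m.
(* Below this time the factor in [heat_ratio], taken over 4 times the mean number of steps, is at
   most 1/2. *)
exists (8 * 5 ^+ m * 4 ^+ l.+1)^-1.
  by rewrite invr_gt0 !mulr_gt0 // exprn_gt0.
move=> r r_gt0 hr.
have r_ge0 := ltW r_gt0.
have c4 : 4 * r * 5 ^+ m * 4 ^+ l.+1 <= 1 / 2.
  have : r * (8 * 5 ^+ m * 4 ^+ l.+1) <= 1.
    by rewrite -ler_pdivlMr ?div1r ?ltW // !mulr_gt0 // exprn_gt0.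
  set u := 5 ^+ m; set v := 4 ^+ l.+1 => hu.
  have -> : 4 * r * u * v = r * (8 * u * v) / 2 by field.
  lra.
have c4' : 4 * r * 5 ^+ m <= 1 / 2.
  apply: le_trans c4; rewrite ler_peMr //.
    by rewrite !mulr_ge0 // exprn_ge0.
  by rewrite exprn_ege1 // ler1n.
pose lam n : R := (5 ^ n)%:R * r.
have lam0 n : 0 <= lam n by rewrite mulr_ge0.
(* With four times the mean, the Poisson error exp(lam) / 2^K tends to 0 with n. *)
pose K n := Num.truncn (4 * lam n).
have K_le n : (K n)%:R <= 4 * lam n by rewrite /K truncn_le mulr_ge0.
have K_ge n : 4 * lam n - 1 <= (K n)%:R.
  have h1 : 4 * lam n < (K n).+1%:R := truncnS_gt _.
  by move: h1; rewrite -[(K n).+1%:R]natr1; lra.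
have KN N : (K (m + N)%N)%:R / 5 ^+ N <= 4 * r * 5 ^+ m.
  rewrite ler_pdivrMr ?exprn_gt0 //; apply: le_trans (K_le _) _.
  by rewrite /lam natrX exprD; rewrite le_eqVlt; apply/orP; left; apply/eqP; ring.
pose as_ n := Psiw (mkseq s n) p1.
pose bs n := Psiw (mkseq t n) p1.
have inV (u : nat -> pt R) : (forall j, u j \in V0) ->
    forall n, Psiw (mkseq u n) p1 \in V n.
  move=> hu n; have := @Psiw_V _ T (mkseq u n) 0 p1 (word_mkseq n hu) hq1.
  by rewrite size_mkseq addn0.
have as_cvg : as_ @ \oo --> a := address_cvg hX p1 hs ha.
have bs_cvg : bs @ \oo --> b := address_cvg hX p1 ht hb.
pose f j := urysohn A j.
have f01 j z : 0 <= f j z <= 1 by exact: urysohn01.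
have f0 j z : 0 <= f j z by case/andP: (f01 j z).
have fA j N y : y \in V N -> 1 <= f j (Psiw w y).
  by move=> hy; apply: urysohn_eq1; exists y => //; exact: gasket_V hy.
pose g := cutoff T m i h.
have g01 z : 0 <= g z <= 1 by exact: cutoff01.
have near j N k : (k <= K (m + N)%N)%N -> 1 / 4 <= heat (m + N) (f j) k h.
  move=> hk; apply: (heat_axis_lower4 cw hh hne) => //; first by move=> y; exact: fA.
  apply: le_trans c4'; apply: le_trans (KN N).
  by rewrite ler_wpM2r ?invr_ge0 ?exprn_ge0 // ler_nat.
have ratio j n : (m <= n)%N -> rwE p1 p2 p3 n (bs n) [:: (r, g)] <=
    1 / 2 * rwE p1 p2 p3 n (as_ n) [:: (r, f j)] + (lam n + 1 / 2)^-1.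
  move=> hmn; have {hmn} -> : n = (m + (n - m))%N by rewrite subnKC.
  move: (n - m)%N => N.
  have ma := rwE_heat (inV s hs (m + N)%N) r_ge0 (f01 j).
  have mb := rwE_heat (inV t ht (m + N)%N) r_ge0 g01.
  have [y hy ey] := mkseq_cut m N hs hq1.
  have [y' hy' ey'] := mkseq_cut m N ht hq1.
  apply: le_trans (pois_mean_ratio (c := 1 / 2) (K := K (m + N)%N) (lam0 _) _ _ _ _ ma mb) _.
  - by rewrite divr_ge0.
  - by move=> k; exact: heat_ge0.
  - by move=> k; apply: heat_cutoff_le1; exact: inV.
  - move=> k hk; rewrite ey ey'.
    have H := @heat_ratio _ T m N i h w q (mkseq s m) (mkseq t m) l b' (f j)
      (K (m + N)%N) cw hh hne (f0 j) (@fA j N) (word_mkseq m hs) (size_mkseq _ _)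
      hreach hi (word_mkseq m ht) (size_mkseq _ _) (gasket_tri hX Xb').
    rewrite -eb in H.
    apply: le_trans (H hfar (le_trans (KN N) c4') k y y' hk hy hy') _.
    apply: ler_wpM2r; first exact: heat_ge0.
    apply: le_trans c4; rewrite ler_wpM2r ?exprn_ge0 //.
  by rewrite lerD2l; exact: expR_pow2_upper.
have lam_small (e : R) : 0 < e -> exists n0, forall n, (n0 <= n)%N -> (lam n / 4)^-1 < e.
  move=> e0; have [n0 hn0] := @pow2_small R (e * r / 4) ltac:(by rewrite divr_gt0 ?mulr_gt0).
  exists n0 => n hn; rewrite /lam invf_div ltr_pdivrMr ?mulr_gt0 ?ltr0n ?expn_gt0 //.
  have h5 : (2 ^+ n0 : R) <= (5 ^ n)%:R.
    rewrite natrX; apply: le_trans (_ : 2 ^+ n <= _).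
      by rewrite ler_weXn2l // ler1n.
    by apply: lerXn2r; rewrite ?nnegrE // ler_nat.
  move: hn0; rewrite -div1r ltr_pdivrMr ?exprn_gt0 // => hn0.
  have := ler_wpM2l (ltW (mulr_gt0 e0 r_gt0)) h5.
  move: hn0; set u := 2 ^+ n0; set v := (5 ^ n)%:R; lra.
have near_n j n k : (m <= n)%N -> (k <= K n)%N -> 1 / 4 <= heat n (f j) k h.
  by move=> hmn hk; have := @near j (n - m)%N k; rewrite subnKC //; exact.
(* The constant 24 makes 24 <= r 2^m', which is what [time] consumes. The level m' depends on r but
   not on n, and so does the resulting constant [eta]. *)
have [n0 hn0] := @pow2_small R (r / 24) ltac:(by rewrite divr_gt0).
pose m' := (m + n0)%N.
pose l' := (2 * 2 ^ m')%N.
have hv : h \in V m'.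
  apply: V_mono; rewrite -ew -sw -[size w]addn0; exact: Psiw_V.
have hreach' q0 : q0 \in V0 ->
    exists2 l0, (l0 <= l')%N & reach T m' l0 (Psiw (mkseq s m') q0) h.
  move=> hq0.
  have hq0V : Psiw (mkseq s m') q0 \in V m'.
    by have := @Psiw_V _ T _ 0 q0 (word_mkseq m' hs) hq0; rewrite size_mkseq addn0.
  have [L hL eL] := reach_any hq1 hq0V hv; exists L => //.
  rewrite -(ler_nat R) eL /l' natrM natrX mulrC ler_wpM2r ?exprn_ge0 //.
  by have := V_tri hq0V hq1; have := V_tri hv hq1; lra.
(* A path to h at level m' has at most 2 * 2^m' edges, each granted 2 * 5^N steps, while r 5^m' 5^N
   steps are available on average. As 4^m' <= 5^m', a fine level leaves enough time however small r
   is. *)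
have time N : (l'.+1 * (2 * 5 ^ N))%N%:R <= lam (m' + N)%N / 4.
  rewrite /lam natrM natrM !natrX exprD.
  have u1 : (1 : R) <= 2 ^+ m' by rewrite exprn_ege1 // ler1n.
  have u2 : 2 ^+ m' * 2 ^+ m' <= 5 ^+ m' :> R.
    by rewrite -exprMn; apply: lerXn2r; rewrite ?nnegrE // -natrM ler_nat.
  have u3 : 24 <= r * 2 ^+ m'.
    move: hn0; rewrite -div1r ltr_pdivrMr ?exprn_gt0 // => hn0.
    have : 2 ^+ n0 <= 2 ^+ m' :> R by rewrite ler_weXn2l ?ler1n // leq_addl.
    move=> /(ler_wpM2l r_ge0); move: hn0; set v := 2 ^+ n0; lra.
  have u4 : 0 < (5 : R) ^+ N by rewrite exprn_gt0.
  have el : l'.+1%:R = 2 * 2 ^+ m' + 1 :> R by rewrite -natr1 /l' natrM natrX.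
  rewrite el; move: u1 u2 u3 u4; set u := 2 ^+ m'; set v := 5 ^+ m'; set z := 5 ^+ N.
  move=> u1 u2 u3 u4.
  have w1 : 24 * u <= r * v.
    apply: le_trans (_ : r * (u * u) <= _); last by rewrite ler_wpM2l.
    by rewrite mulrA ler_wpM2r //; lra.
  have w2 : (2 * u + 1) * 8 <= v * r by lra.
  have := ler_wpM2r (ltW u4) w2; lra.
pose eta : R := 1 / 8 ^+ l'.+1.
have eta0 : 0 < eta by rewrite divr_gt0 // exprn_gt0.
have low j n : (m' <= n)%N ->
    eta * (1 - 2 * (lam n / 4)^-1) <= rwE p1 p2 p3 n (as_ n) [:: (r, f j)].
  move=> hmn.
  have lamgt : 0 < lam n by rewrite mulr_gt0 // ltr0n expn_gt0.
  have ma := rwE_heat (inV s hs n) r_ge0 (f01 j).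
  have hn : n = (m' + (n - m'))%N by rewrite subnKC.
  have K1n : ((l'.+1 * (2 * 5 ^ (n - m')))%N%:R : R) <= lam n / 4.
    by rewrite {2}hn; exact: time.
  have H := pois_mean_lower (c := eta) (K1 := (l'.+1 * (2 * 5 ^ (n - m')))%N)
    (K2 := K n) (lam0 n) (ltW eta0) (fun k => heat_ge0 T n k _ (f0 j)) _ ma.
  apply: le_trans (H _); last first.
    move=> k hk1 hk2.
    have [y hy ey] := mkseq_cut m' (n - m') hs hq1.
    rewrite -hn in ey; rewrite ey {1}hn.
    apply: (heat_positive (word_mkseq m' hs) (size_mkseq _ _) (f0 j) (K := K n)) => //.
      move=> k' hk'; rewrite -hn; apply: near_n => //.
      by rewrite (leq_trans _ hmn) // leq_addr.
    exact: hreach'.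
  rewrite ler_wpM2l ?(ltW eta0) //.
  have t1 := expR_pow2_upper (lam0 n) (K_ge n).
  have t2 := expR_pow2_lower (lam0 n) K1n.
  have t3 : (lam n + 1 / 2)^-1 <= (lam n / 4)^-1.
    by rewrite lef_pV2 ?posrE //; lra.
  have t4 : (1 + lam n / 4)^-1 <= (lam n / 4)^-1.
    by rewrite lef_pV2 ?posrE //; lra.
  lra.
pose mb := fine (mean (P b) r g).
pose ma j := fine (mean (P a) r (f j)).
have cg : continuous g by exact: cutoff_continuous.
have cf j : continuous (f j) by exact: urysohn_continuous.
have lb := bm_limit Xb (inV t ht) bs_cvg r_ge0 cg g01.
have la j := bm_limit Xa (inV s hs) as_cvg r_ge0 (cf j) (f01 j).
have half j : mb <= 1 / 2 * ma j.
  apply/ler_addgt0Pr => e e0; have [n1 hn1] := lam_small e e0.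
  have lc : (fun n => 1 / 2 * rwE p1 p2 p3 n (as_ n) [:: (r, f j)] + e) @ \oo -->
      1 / 2 * ma j + e.
    by apply: cvgD; [apply: cvgMr; exact: la|exact: cvg_cst].
  apply: (ler_cvg_to lb lc); exists (maxn m n1) => // n /=.
  rewrite geq_max => /andP[h1 h2].
  apply: le_trans (ratio j n h1) _; rewrite lerD2l.
  apply: le_trans (_ : (lam n / 4)^-1 <= _); last exact/ltW/hn1.
  have lamgt : 0 < lam n by rewrite mulr_gt0 // ltr0n expn_gt0.
  by rewrite lef_pV2 ?posrE //; lra.
have pos j : eta / 2 <= ma j.
  have [n1 hn1] := @lam_small (1 / 4) ltac:(lra).
  have lc : (fun n : nat => eta / 2) @ \oo --> eta / 2 by exact: cvg_cst.
  apply: (ler_cvg_to lc (la j)); exists (maxn m' n1) => // n /=.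
  rewrite geq_max => /andP[h1 h2].
  apply: le_trans (low j n h1); rewrite ler_wpM2l ?(ltW eta0) //.
  by have := hn1 n h2; lra.
have ub : (P b [set z : PathM R | A (pf z r)] <= mb%:E)%E.
  rewrite /mb fineK; last exact: mean_fin.
  apply: mean_ge_prob => //.
  - exact: closed_measurable_plane.
  - by move=> z; case/andP: (g01 z).
  move=> z [x Xx <-]; rewrite /g cutoff_eq1 // -ew -sw.
  have := bc_cell_close w hi (gasket_tri hX Xx) (tri_corner hq).
  by rewrite -div1r ler_pdivlMr ?exprn_gt0 // mulrC.
(* From mb <= ma/2 and ma >= eta/2 there is a gap eta/4, uniform in j, which survives the passage
   from [f j] to the cell itself. *)
have lbd : ((mb + eta / 4)%:E <= P a [set z : PathM R | A (pf z r)])%E.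
  apply: prob_closed_ge => // j.
  have -> : mean (P a) r (urysohn A j) = (ma j)%:E.
    by rewrite /ma fineK //; apply: mean_fin.
  by rewrite lee_fin; have := half j; have := pos j; lra.
apply: le_lt_trans ub _; apply: lt_le_trans lbd.
by rewrite lte_fin; lra.
Qed.

End Comparison.

(** * Reflection symmetry and the theorem *)

Section Symmetry.
Variables (R : realType) (T : equilateral R).
Local Notation p1 := (pp1 T).
Local Notation p2 := (pp2 T).
Local Notation p3 := (pp3 T).
Local Notation V0 := (V0 T).
Local Notation V := (V T).
Local Notation bc := (bc T).
Local Notation tri := (tri T).

Variables (X : set (pt R)) (P : pt R -> probability (PathM R) R).
Hypothesis hX : gasket T X.
Hypothesis hP : IsBMonSG p1 p2 p3 X P.

(** Treats both sides of the axis at once; the first component names the side under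
    consideration. *)
Definition base_pair (c d : pt R) : Prop := (c = p1 /\ d = p2) \/ (c = p2 /\ d = p1).

Lemma base_pairP c d : base_pair c d ->
  [/\ c \in V0, d \in V0, c != d, p3 != c & p3 != d].
Proof.
have n12 := neq12 T; have n13 := neq13 T; have n23 := neq23 T.
by case=> -[-> ->]; split; rewrite ?p1V0 ?p2V0 // eq_sym.
Qed.

Lemma base_refl c d : base_pair c d ->
  [/\ refl p1 p2 c = d, refl p1 p2 d = c & refl p1 p2 p3 = p3].
Proof.
have n12 := neq12 T; have n13 := neq13 T; have n23 := neq23 T.
have h1 := p1V0 T; have h2 := p2V0 T; have h3 := p3V0 T.
have e1 : refl p1 p2 p1 = p2 by rewrite (@refl_corner _ T) // eqxx.
have e2 : refl p1 p2 p2 = p1.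
  by rewrite (@refl_corner _ T) // eqxx eq_sym (negbTE n12).
have e3 : refl p1 p2 p3 = p3.
  by rewrite (@refl_corner _ T) // !(eq_sym p3) (negbTE n13) (negbTE n23).
by case=> -[-> ->].
Qed.

Lemma bc_nseq j p q z : p \in V0 -> q \in V0 -> p != q ->
  bc q (Psiw (nseq j p) z) = bc q z / 2 ^+ j.
Proof.
move=> hp hq pq; have := bc_Psiw_diff T q (nseq j p) z p.
rewrite Psiw_nseq size_nseq (bc_corner hq hp) eq_sym (negbTE pq) /=.
by rewrite !subr0.
Qed.

Lemma axis_cell c d j x : base_pair c d -> X x ->
  let z := Psiw (nseq j p3) (Psi c x) in X z /\ bc d z <= bc c z.
Proof.
move=> hcd Xx z; have [hc hd cd c3 d3] := base_pairP hcd.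
have h3 := p3V0 T.
split.
  apply: (gasket_Psiw hX) => //; first exact: word_nseq.
  exact: (gasket_Psi hX).
rewrite /z !bc_nseq // !bc_Psi (bc_corner_self hc) (bc_corner hd hc) eq_sym (negbTE cd).
rewrite ler_wpM2r ?invr_ge0 ?exprn_ge0 //=.
have := bc_le1 hd (gasket_tri hX Xx); have := gasket_tri hX Xx hc; lra.
Qed.

(** Scale-free form of [bm_compare]: [D] is the length of the paths from [a] to [h] when an edge of
    level [m] has length 2^-m, up to one edge. A strict inequality between [D] and the distance of
    [b] becomes an arbitrarily large number of edges at fine levels. *)
Lemma compare_at_axis c d j h a b i (s : nat -> pt R) (D : R) :
  h = Psiw (nseq j p3) (Psi c d) -> base_pair c d -> X a -> X b ->
  (forall j, s j \in V0) ->
  (forall n, exists2 a', X a' & a = Psiw (mkseq s n) a') ->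
  (forall m q, (j < m)%N -> q \in V0 -> exists2 L,
     reach T m L (Psiw (mkseq s m) q) h & L%:R <= 2 ^+ m * D + 1) ->
  i \in V0 -> D < `|bc i b - bc i h| ->
  exists A, [/\ measurable A, A `<=` X `&` [set z | bc d z <= bc c z] &
    exists2 r0 : R, 0 < r0 & forall r, 0 < r -> r < r0 ->
      (P b [set z : PathM R | A (pf z r)] < P a [set z : PathM R | A (pf z r)])%E].
Proof.
move=> eh hcd Xa Xb hs ha hreach hi hD.
have [hc hd cd c3 d3] := base_pairP hcd; have h3 := p3V0 T.
have [rc rd r3] := base_refl hcd.
(* Six edges are required: one for the rounding in the path length and five for [bm_compare]. *)
have [n0 hn0] := @pow2_small R ((`|bc i b - bc i h| - D) / 6)
  ltac:(by rewrite divr_gt0 // subr_gt0).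
pose m := (j.+1 + n0)%N.
(* The level-[m] cell at [h] on the side of [c]; repeating [d] shrinks it towards [h]. *)
pose w := nseq j p3 ++ c :: nseq n0 d.
have cw : cell_at T m h w d.
  split => //.
  - by rewrite word_cat /= hc !word_nseq //; apply/andP; split=> //; exact: word_nseq.
  - by rewrite /w size_cat /= !size_nseq /m addSn addnS.
  - by rewrite eh /w Psiw_cat /= Psiw_nseq.
have hh : refl p1 p2 h = h.
  by rewrite eh Psiw_refl map_nseq r3 refl_Psi rc rd Psi_mid.
have hne : map (refl p1 p2) w != w.
  rewrite /w map_cat /= !map_nseq r3 rc rd eqseq_cat ?size_nseq // eqxx /=.
  by rewrite eqseq_cons eq_sym (negbTE cd).
have hL q : q \in V0 -> exists2 L, reach T m L (Psiw (mkseq s m) q) h &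
    L%:R <= 2 ^+ m * D + 1.
  by move=> hq; apply: hreach => //; rewrite /m leq_addr.
have D1 : 0 <= 2 ^+ m * D + 1.
  by have [L _ hLD] := hL _ (p1V0 T); apply: le_trans hLD.
pose l := Num.truncn (2 ^+ m * D + 1).
have hl : l%:R <= 2 ^+ m * D + 1 by rewrite /l truncn_le.
have hl' L : L%:R <= 2 ^+ m * D + 1 -> (L <= l)%N.
  by rewrite /l truncn_ge_nat.
have hr : forall q, q \in V0 -> exists2 l', (l' <= l)%N &
    reach T m l' (Psiw (mkseq s m) q) h.
  by move=> q /hL[L h1 h2]; exists L => //; exact: hl'.
have hfar : l%:R + 5 <= 2 ^+ m * `|bc i b - bc i h|.
  move: hn0; rewrite -div1r ltr_pdivrMr ?exprn_gt0 // => hn0.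
  have e2 : 2 ^+ n0 <= 2 ^+ m :> R by rewrite ler_weXn2l ?ler1n // leq_addl.
  have d0 : 0 <= `|bc i b - bc i h| - D by lra.
  have := ler_wpM2l d0 e2; move: hn0 hl.
  set u := 2 ^+ n0; set v := 2 ^+ m; set y := `|_|; lra.
exists (Psiw w @` X); split.
- apply: closed_measurable_plane; apply: compact_closed; first exact: norm_hausdorff.
  apply: continuous_compact; last by case: hX.
  by apply: continuous_subspaceT => z; exact: Psiw_continuous.
- move=> _ [x Xx <-]; rewrite /w Psiw_cat /=.
  by apply: axis_cell => //; apply: (gasket_Psiw hX) => //; exact: word_nseq.
exact: (bm_compare hX hP Xa Xb cw hh hne hs ha hr hi hfar).
Qed.

(** The axis point [h] is at height 1 - 2^-j. The way from [a] up to [p3] and down to [h] has length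
    1 - bc p3 a + 2^-j, while [b] is 1 - 2^-j - bc p3 b below [h]. For 2^-j less than half the
    difference of heights the former is smaller. *)
Lemma compare_height c d a b : base_pair c d -> X a -> X b ->
  bc p3 b < bc p3 a ->
  exists A, [/\ measurable A, A `<=` X `&` [set z | bc d z <= bc c z] &
    exists2 r0 : R, 0 < r0 & forall r, 0 < r -> r < r0 ->
      (P b [set z : PathM R | A (pf z r)] < P a [set z : PathM R | A (pf z r)])%E].
Proof.
move=> hcd Xa Xb hab; have [hc hd cd c3 d3] := base_pairP hcd.
have h3 := p3V0 T.
have [j hj] := @pow2_small R ((bc p3 a - bc p3 b) / 2)
  ltac:(by rewrite divr_gt0 // subr_gt0).
have [s hs ha] := gasket_address hX Xa.
pose h := Psiw (nseq j p3) (Psi c d).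
have bh : bc p3 h = 1 - (2 ^+ j)^-1.
  have := bc_Psiw_diff T p3 (nseq j p3) (Psi c d) p3.
  rewrite Psiw_nseq size_nseq (bc_corner_self h3) bc_Psi (bc_corner h3 hc) (bc_corner h3 hd).
  by rewrite (negbTE c3) (negbTE d3) /= addr0 mul0r sub0r mulN1r -/h; lra.
apply: (@compare_at_axis c d j h a b p3 s (1 - bc p3 a + (2 ^+ j)^-1)) => //.
  move=> m q hjm hq.
  have hqV : Psiw (mkseq s m) q \in V m.
    by have := @Psiw_V _ T _ 0 q (word_mkseq m hs) hq; rewrite size_mkseq addn0.
  have hv : h \in V m.
    have hpq : Psi c d \in V 1 by apply: Psi_V.
    have := @Psiw_V _ T (nseq j p3) 1 _ _ hpq.
    rewrite size_nseq addn1 word_nseq // => /(_ isT) hV.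
    by rewrite -(subnKC hjm); exact: V_mono.
  have [L hL eL] := reach_any h3 hqV hv; exists L => //.
  rewrite eL bh; have [a' Xa' ea] := ha m.
  have := bc_cell_close (mkseq s m) h3 (gasket_tri hX Xa') (tri_corner hq).
  rewrite -ea size_mkseq ler_norml => /andP[_ hle].
  have e2 : 0 < (2 : R) ^+ m by rewrite exprn_gt0.
  have := ler_wpM2l (ltW e2) hle; rewrite divff ?gt_eqF //.
  set u := 2 ^+ m; set z := (2 ^+ j)^-1; lra.
rewrite bh ltr_normr; apply/orP; right; lra.
Qed.

(** Undoing [Psi p3] doubles [bc c - bc d], which never exceeds 1, so this stops. The cell of [d] is
    excluded because the difference is nonpositive there; the cell of [c] remains. *)
Lemma side_cell c d a : base_pair c d -> X a -> bc d a < bc c a ->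
  exists k, exists2 a', X a' & a = Psiw (nseq k p3) (Psi c a').
Proof.
move=> hcd; have [hc hd cd c3 d3] := base_pairP hcd; have h3 := p3V0 T.
have three p : p \in V0 -> [\/ p = c, p = d | p = p3].
  by case: hcd => -[-> ->] /V0P[->|->|->];
    by [constructor 1|constructor 2|constructor 3].
have H n : forall a, X a -> 1 <= 2 ^+ n * (bc c a - bc d a) ->
    exists k, exists2 a', X a' & a = Psiw (nseq k p3) (Psi c a').
  have hdc : (d == c) = false by rewrite eq_sym (negbTE cd).
  elim: n => [|n IH] {}a Xa hn; have [p hp [a' Xa' ea]] := gasket_inv hX Xa;
    have t1 := bc_le1 hc (gasket_tri hX Xa'); have t2 := gasket_tri hX Xa' hd;
    have t3 := bc_le1 hd (gasket_tri hX Xa'); have t4 := gasket_tri hX Xa' hc;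
    case: (three p hp) => ep; rewrite ep in ea; try by exists 0%N, a'.
  - move: hn; rewrite ea !bc_Psi (bc_corner_self hd) (bc_corner hc hd) (negbTE cd).
    by rewrite /= expr0; lra.
  - move: hn; rewrite ea !bc_Psi (bc_corner hc h3) (bc_corner hd h3).
    by rewrite (eq_sym c) (eq_sym d) (negbTE c3) (negbTE d3) /= expr0; lra.
  - exfalso; move: hn; rewrite ea !bc_Psi (bc_corner_self hd) (bc_corner hc hd).
    rewrite (negbTE cd) /= => hn.
    have : 2 ^+ n.+1 * ((bc c a' + 0) / 2 - (bc d a' + 1) / 2) <= 0.
      by apply: mulr_ge0_le0; [exact: exprn_ge0|lra].
    lra.
  have [|k [a'' X'' e'']] := IH a' Xa'.
    move: hn; rewrite ea !bc_Psi (bc_corner hc h3) (bc_corner hd h3).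
    rewrite (eq_sym c) (eq_sym d) (negbTE c3) (negbTE d3) /= exprS.
    by set u := 2 ^+ n; lra.
  by exists k.+1, a'' => //=; rewrite -e''.
move=> Xa hlt.
have [n hn] := @pow2_small R (bc c a - bc d a) ltac:(by rewrite subr_gt0).
apply: (H n) => //; move: hn; rewrite -div1r ltr_pdivrMr ?exprn_gt0 // mulrC.
exact: ltW.
Qed.

(** Here [h] is the corner [d] of the cell Psi_p3^k Psi_c containing [a], and both [bc c] and [bc d]
    equal 2^-(k+1) there. Inside this cell the way from [a] to [h] has length 2^-(k+1) - bc d a,
    whereas in the coordinate [c] the point [b] is at distance at least 2^-(k+1) - bc c b, which is
    larger. The target side is chosen separately by [c']. *)
Lemma compare_width c d c' d' a b : base_pair c d -> base_pair c' d' -> X a -> X b ->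
  bc d a < bc c a -> bc c b < bc d a ->
  exists A, [/\ measurable A, A `<=` X `&` [set z | bc d' z <= bc c' z] &
    exists2 r0 : R, 0 < r0 & forall r, 0 < r -> r < r0 ->
      (P b [set z : PathM R | A (pf z r)] < P a [set z : PathM R | A (pf z r)])%E].
Proof.
move=> hcd hcd' Xa Xb hac hab; have [hc hd cd c3 d3] := base_pairP hcd.
have h3 := p3V0 T.
have [k [a' Xa' ea]] := side_cell hcd Xa hac.
have [s' hs' ha'] := gasket_address hX Xa'.
pose w0 := rcons (nseq k p3) c.
have sw0 : size w0 = k.+1 by rewrite size_rcons size_nseq.
have hw0 : word T w0.
  by rewrite word_rcons hc word_nseq.
have Pw0 z : Psiw w0 z = Psiw (nseq k p3) (Psi c z).
  by rewrite /w0 -cats1 Psiw_cat.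
(* An address of [a] that begins with the word of this cell; an arbitrary address of [a] might start
   in another cell. *)
pose s n := if (n < k.+1)%N then nth c w0 n else s' (n - k.+1)%N.
have hs n : s n \in V0.
  rewrite /s; case: ifP => // hn.
  by have /allP := hw0; apply; apply: mem_nth; rewrite sw0.
have es N : mkseq s (k.+1 + N) = w0 ++ mkseq s' N.
  rewrite /mkseq iotaD map_cat; congr cat.
    rewrite -[RHS](mkseq_nth c) sw0; apply/eq_in_map => n; rewrite mem_iota add0n /= => hn.
    by rewrite /s hn.
  rewrite add0n -{1}[k.+1]addn0 iotaDl -map_comp; apply: eq_map => n /=.
  by rewrite /s ltnNge leq_addr /= addKn.
have ha n : exists2 a'', X a'' & a = Psiw (mkseq s n) a''.
  have [hn|hn] := leqP k.+1 n.
    have [a'' X'' e] := ha' (n - k.+1)%N; exists a'' => //.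
    by rewrite -(subnKC hn) es Psiw_cat -e Pw0.
  exists (Psiw (drop n w0) a').
    apply: (gasket_Psiw hX) => //; apply/allP => z /mem_drop; exact: (allP hw0).
  rewrite -Psiw_cat ea -Pw0; congr Psiw.
  rewrite -{1}(cat_take_drop n w0); congr cat.
  have := es 0%N; rewrite addn0 cats0 => e0.
  rewrite -e0 /mkseq -map_take take_iota; congr map; congr iota.
  by apply/minn_idPl; exact: ltnW.
pose h := Psiw (nseq k p3) (Psi c' d').
have eh : h = Psiw w0 d.
  rewrite Pw0 /h; congr Psiw.
  by case: hcd hcd' => -[-> ->] [] [-> ->] //; rewrite Psi_mid.
have bh q : q \in [:: c; d] -> bc q h = (2 ^+ k.+1)^-1.
  have e : Psi c d = Psi d c by rewrite Psi_mid.
  rewrite eh Pw0 !inE => /orP[]/eqP->.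
    by rewrite bc_nseq // bc_Psi bc_corner_self // bc_corner // (negbTE cd) exprS /=; field.
  rewrite bc_nseq // e bc_Psi bc_corner_self // bc_corner // (eq_sym d) (negbTE cd).
  by rewrite exprS /=; field.
apply: (@compare_at_axis c' d' k h a b c s ((2 ^+ k.+1)^-1 - bc d a)) => //.
  move=> m q hm hq; rewrite -(subnKC hm); move: (m - k.+1)%N => N.
  pose u := Psiw (mkseq s' N) q.
  have hu : u \in V N.
    by have := @Psiw_V _ T _ 0 q (word_mkseq N hs') hq; rewrite size_mkseq addn0.
  have [L hL eL] := reach_corner hd hu.
  exists L.
    rewrite es Psiw_cat -/u eh -sw0; exact: reach_Psiw.
  rewrite eL.
  have hdiff := bc_Psiw_diff T d w0 d u.
  rewrite -eh bh ?inE ?eqxx ?orbT // bc_corner_self // sw0 in hdiff.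
  have [a'' X'' e''] := ha (k.+1 + N)%N.
  have := bc_cell_close (mkseq s (k.+1 + N)) hd (gasket_tri hX X'') (tri_corner hq).
  rewrite -e'' es Psiw_cat -/u size_cat sw0 size_mkseq ler_norml => /andP[_ hle].
  have e2 : 0 < (2 : R) ^+ (k.+1 + N) by rewrite exprn_gt0.
  have := ler_wpM2l (ltW e2) hle; rewrite divff ?gt_eqF // => hle2.
  have -> : 2 ^+ N * (1 - bc d u) = 2 ^+ (k.+1 + N) * ((1 - bc d u) / 2 ^+ k.+1).
    rewrite exprD; field; by rewrite expf_neq0.
  rewrite -hdiff; move: hle2; set v := 2 ^+ (k.+1 + N); set z := (2 ^+ k.+1)^-1; lra.
by rewrite bh ?inE ?eqxx // ltr_normr; apply/orP; right; lra.
Qed.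

(** The point closer to h gains mass in cells on either side; the side is chosen so as to contradict
    the domination required in [Chat]. If neither the heights nor the widths [bc p2 x] and [bc p1 y]
    differ, the points are mirror images. *)
Lemma compare_sym x y : X x -> X y -> bc p2 x < bc p1 x -> bc p1 y < bc p2 y ->
  x <> refl p1 p2 y ->
  (exists A, [/\ measurable A, A `<=` X `&` [set z | bc p2 z <= bc p1 z] &
    exists2 r0 : R, 0 < r0 & forall r, 0 < r -> r < r0 ->
      (P x [set z : PathM R | A (pf z r)] < P y [set z : PathM R | A (pf z r)])%E]) \/
  (exists A, [/\ measurable A, A `<=` X `&` [set z | bc p1 z <= bc p2 z] &
    exists2 r0 : R, 0 < r0 & forall r, 0 < r -> r < r0 ->
      (P y [set z : PathM R | A (pf z r)] < P x [set z : PathM R | A (pf z r)])%E]).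
Proof.
move=> Xx Xy hx hy hxy.
have b12 : base_pair p1 p2 by left.
have b21 : base_pair p2 p1 by right.
have [h3|h3|h3] := ltgtP (bc p3 x) (bc p3 y).
- by left; apply: compare_height.
- by right; apply: compare_height.
have [h1|h1|h1] := ltgtP (bc p2 x) (bc p1 y).
- by left; apply: (@compare_width p2 p1 p1 p2).
- by right; apply: (@compare_width p1 p2 p2 p1).
have q1 := p1V0 T; have q2 := p2V0 T; have q3 := p3V0 T.
have n12 := neq12 T; have n13 := neq13 T; have n23 := neq23 T.
case: hxy; apply: (@bc_inj _ T) => q /V0P[] ->.
- by rewrite bc_refl //; have := bc_sum T x; have := bc_sum T y; lra.
- by rewrite refl_sym bc_refl // 1?eq_sym.
- by rewrite bc_refl_third // 1?eq_sym.
Qed.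

Lemma refl_fixE z : (refl p1 p2 z = z) <-> bc p1 z = bc p2 z.
Proof.
have q1 := p1V0 T; have q2 := p2V0 T; have q3 := p3V0 T.
have n12 := neq12 T; have n13 := neq13 T; have n23 := neq23 T.
split=> [e|e]; first by rewrite -{1}e bc_refl.
apply: (@bc_inj _ T) => q /V0P[] ->.
- by rewrite bc_refl.
- by rewrite refl_sym bc_refl // eq_sym.
- by rewrite bc_refl_third // eq_sym.
Qed.

Lemma X1setE : X1set p1 p2 X = X `&` [set z | bc p2 z < bc p1 z].
Proof.
rewrite -(component_corner hX (p1V0 T) (p2V0 T) (neq12 T)) /X1set /Hset.
congr connected_component; apply/seteqP; split=> z [Xz h]; split=> // h'; apply: h.
  by split=> //; exact/refl_fixE.
by case: h' => _ /refl_fixE.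
Qed.

Lemma X2setE : X2set p1 p2 X = X `&` [set z | bc p1 z < bc p2 z].
Proof.
have n21 : p2 != p1 by rewrite eq_sym neq12.
rewrite -(component_corner hX (p2V0 T) (p1V0 T) n21) /X2set /Hset.
congr connected_component; apply/seteqP; split=> z [Xz h]; split=> // h'; apply: h.
  by split=> //; exact/refl_fixE.
by case: h' => _ /refl_fixE.
Qed.

Lemma bc_lt_measurable a b : measurable [set z | bc a z < bc b z].
Proof.
apply: open_measurable_plane.
rewrite (_ : [set z | _] = (fun z => bc b z - bc a z) @^-1` [set x | 0 < x]).
  apply: open_comp => [z _|]; last exact: open_gt.
  by apply: cvgB; exact: bc_continuous.
by apply/seteqP; split=> z /=; rewrite subr_gt0.
Qed.

Lemma Chat_of_coupling (Q : probability (PathM R * PathM R)%type R) :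
  coupling Q (P p1) (P p2) ->
  Chat P p1 p2 (X1set p1 p2 X) (X2set p1 p2 X) (Hset p1 p2 X) (refl p1 p2) Q.
Proof.
move=> hQ; split=> // t _; exists (X1set p1 p2 X `*` X2set p1 p2 X).
have mX : measurable X := closed_measurable_plane (gasket_closed hX).
split=> //; split.
  apply: measurableX; rewrite ?X1setE ?X2setE; apply: measurableI => //;
  exact: bc_lt_measurable.
split.
  rewrite (_ : [set w | _] = set0) ?measure0 //.
  by apply/seteqP; split=> // w [].
move=> x y [/=]; rewrite X1setE X2setE => -[Xx hx] [Xy hy].
move=> [r [rpos [_ [rcv hr]]]].
(* The strict inequality holds for all small times, in particular at some [r n], and there it
   contradicts the assumed domination on the half containing the target cell. *)
apply: contrapT => hxy.
have small (r0 : R) : 0 < r0 -> exists n, r n < r0.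
  move=> h0; have [N _ hN] : \forall n \near \oo, r n < r0.
    exact: (cvgr_lt _ rcv).
  by exists N; apply: hN => /=.
have cover A (c d : pt R) : A `<=` X `&` [set z | bc d z <= bc c z] ->
    (bc d = bc p2 /\ bc c = bc p1) \/ (bc d = bc p1 /\ bc c = bc p2) ->
    A `<=` (X `&` [set z | bc d z < bc c z]) `|` Hset p1 p2 X.
  move=> hA hcd z /hA[Xz /=]; rewrite le_eqVlt => /orP[/eqP e|e]; last by left.
  right; split => //; apply/refl_fixE.
  by case: hcd => -[e1 e2]; rewrite -e1 -e2 e.
have [[A [mA hA [r0 r0p H]]]|[A [mA hA [r0 r0p H]]]] := compare_sym Xx Xy hx hy hxy.
  have [n hn] := small r0 r0p; have [h1 _] := hr n.
  have := H (r n) (rpos n) hn; rewrite ltNge h1 //.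
  by apply: cover hA _; left.
have [n hn] := small r0 r0p; have [_ h2] := hr n.
have := H (r n) (rpos n) hn; rewrite ltNge h2 //.
by apply: cover hA _; right.
Qed.

End Symmetry.

Theorem mainTheorem10 (R : realType) (p1 p2 p3 : pt R)
  (hp12 : dist p1 p2 = 1) (hp23 : dist p2 p3 = 1) (hp13 : dist p1 p3 = 1)
  (X : set (pt R))
  (hXc : compact X) (hX0 : X !=set0)
  (hXfix : X = Psi p1 @` X `|` Psi p2 @` X `|` Psi p3 @` X)
  (P : pt R -> probability (PathM R) R)
  (hP : IsBMonSG p1 p2 p3 X P)
  (Q : probability (PathM R * PathM R)%type R) :
  markov_coupling P p1 p2 Q ->
  Chat P p1 p2 (X1set p1 p2 X) (X2set p1 p2 X) (Hset p1 p2 X) (refl p1 p2) Q.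
Proof.
case=> hQ _; pose T := Equilateral hp12 hp23 hp13.
have hX : gasket T X by split.
exact: (@Chat_of_coupling R T X P hX hP Q hQ).
Qed.
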